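(* Let $N\ge1$, $0<s<1$ and $2<q\le p<r<p_s^*$ with $N>sp$, $p_s^*=\frac{Np}{N-sp}$, and let $\lambda>0$. Let $g\in L^\infty(\mathbb{R}^N)$ be integrable with $g\in L^{t_s}(\mathbb{R}^N)$, $t_s=\frac{p_s^*}{p_s^*-r}$. Let $u\in D^{s,p}(\mathbb{R}^N)\cap D^{s,q}(\mathbb{R}^N)$ be a weak solution of $$(-\Delta_p)^su+(-\Delta_q)^su=|u|^{p_s^*-2}u+\lambda g|u|^{r-2}u\ \text{ in }\mathbb{R}^N,\qquad u(x)\ge0,\ x\in\mathbb{R}^N.$$ Then $u\in L^\infty(\mathbb{R}^N)\cap C^\alpha_{loc}(\mathbb{R}^N)$ for some $\alpha\in(0,1)$.
   Context: For $1<m<N/s$ let $m_s^*=\frac{Nm}{N-sm}$, $\|u\|_{s,m}=\left(\int_{\mathbb{R}^N}\int_{\mathbb{R}^N}\frac{|u(x)-u(y)|^m}{|x-y|^{N+sm}}\,dx\,dy\right)^{1/m}$ and $D^{s,m}(\mathbb{R}^N)=\{u\in L^{m_s^*}(\mathbb{R}^N):\|u\|_{s,m}<\infty\}$; put $\mathcal{W}=D^{s,p}(\mathbb{R}^N)\cap D^{s,q}(\mathbb{R}^N)$. Write $J_m(t)=|t|^{m-2}t$ and $u^+=\max\{u,0\}$. A weak solution is a function $u\in\mathcal{W}$, $u\ge0$, such that for all $\varphi\in\mathcal{W}$ $$\int_{\mathbb{R}^N}\int_{\mathbb{R}^N}\left(\frac{J_p(u(x)-u(y))}{|x-y|^{N+sp}}+\frac{J_q(u(x)-u(y))}{|x-y|^{N+sq}}\right)(\varphi(x)-\varphi(y))\,dx\,dy=\int_{\mathbb{R}^N}(u^+)^{p_s^*-2}u^+\varphi\,dx+\lambda\int_{\mathbb{R}^N}g(u^+)^{r-2}u^+\varphi\,dx.$$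 $u\in C^\alpha_{loc}(\mathbb{R}^N)$ means that (a representative of) $u$ is bounded with $\sup_{x\ne y\in\Omega}|u(x)-u(y)|/|x-y|^\alpha<\infty$ on every compact $\Omega\subset\mathbb{R}^N$. *)

(* Defs.v *)
From HB Require Import structures.
From mathcomp Require Import all_boot all_order all_algebra.
From mathcomp Require Import all_classical all_reals all_analysis.
From mathcomp Require Import measurable_realfun.

Set Implicit Arguments.
Unset Strict Implicit.
Unset Printing Implicit Defensive.

Import Order.TTheory GRing.Theory Num.Theory.
Import numFieldNormedType.Exports.

Local Open Scope classical_set_scope.
Local Open Scope ring_scope.

(* R^n is 'rV[R]_n with its library topology; it carries the Borel
   sigma-algebra of that topology. *)
Definition rV_borel_display : measure_display. Proof. exact. Qed.

Section rV_borel.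
Context {R : realType} {n : nat}.

Let rV_borel : set (set 'rV[R]_n) := <<s [set U : set 'rV[R]_n | open U] >>.

Let rV_borel0 : rV_borel set0.
Proof. exact: sigma_algebra0. Qed.

Let rV_borelC A : rV_borel A -> rV_borel (~` A).
Proof. exact: sigma_algebraC. Qed.

Let rV_borel_bigcup (F : (set 'rV[R]_n)^nat) :
  (forall i, rV_borel (F i)) -> rV_borel (\bigcup_i F i).
Proof. exact: sigma_algebra_bigcup. Qed.

HB.instance Definition _ := @isMeasurable.Build rV_borel_display
  'rV[R]_n rV_borel rV_borel0 rV_borelC rV_borel_bigcup.

Lemma rV_open_measurable (U : set 'rV[R]_n) : open U -> measurable U.
Proof. by move=> oU; exact: sub_sigma_algebra. Qed.

Lemma rV_measurable_coord (i : 'I_n) :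
  measurable_fun [set: 'rV[R]_n] (fun v : 'rV[R]_n => v ord0 i).
Proof.
apply: (measurability (@RGenOpens.G R)); first exact: RGenOpens.measurableE.
move=> _ [_ [a [b ->]] <-]; rewrite setTI; apply: rV_open_measurable.
apply: open_comp; last exact: interval_open.
by move=> v _; exact: coord_continuous.
Qed.

(* The open box with rational centre c.1 and rational half-width c.2. *)
Let qbox (c : 'rV[rat]_n * rat) : set 'rV[R]_n :=
  [set v | forall i, `|ratr (c.1 ord0 i) - v ord0 i| < ratr c.2].

Lemma rV_open_qbox (U : set 'rV[R]_n) : open U ->
  U = \bigcup_(c in [set c | qbox c `<=` U]) qbox c.
Proof.
move=> oU; apply/seteqP; split=> [x Ux|x [c cU cx]]; last exact: cU.
move: (oU); rewrite openE => /(_ x Ux); rewrite /interior -nbhs_ballE.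
case=> e /= e0 eU.
have [r /andP[r0 re]] : exists r : rat, (0 : R) < ratr r < e / 2.
  have /rat_in_itvoo[r] : 0 < e / 2 by rewrite divr_gt0.
  by rewrite in_itv/= => ?; exists r.
have cP i : {q : rat | `|ratr q - x ord0 i| < ratr r}.
  apply/cid; have /rat_in_itvoo[q] : x ord0 i - ratr r < x ord0 i + ratr r.
    by rewrite ltrD2l gtrN.
  by rewrite in_itv/= => ?; exists q; rewrite ltr_distl.
exists (\row_i sval (cP i), r) => /=; last first.
  by move=> i; rewrite mxE; exact: svalP (cP i).
move=> y yc; apply: eU; split => // i j.
rewrite (ord1 i) /ball/=.
have := yc j; rewrite /= mxE; set q := sval _ => qy.
have qx : `|ratr q - x ord0 j| < ratr r := svalP (cP j).
rewrite (le_lt_trans (ler_distD (ratr q) _ _))// (splitr e) ltrD//.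
  by rewrite distrC (lt_trans qx).
exact: lt_trans re.
Qed.

Lemma rV_measurable_fun d (T : measurableType d) (f : T -> 'rV[R]_n) :
  (forall i, measurable_fun [set: T] (fun t => f t ord0 i)) ->
  measurable_fun [set: T] f.
Proof.
move=> mf; apply: (measurability [set U : set 'rV[R]_n | open U]) => //.
move=> _ [U oU <-]; rewrite setTI (rV_open_qbox oU) preimage_bigcup.
rewrite bigcup_mkcond; apply: countable_bigcupT_measurable => // c.
case: ifPn => // _.
have -> : f @^-1` qbox c =
    \bigcap_(i in [set: 'I_n]) (fun t => f t ord0 i) @^-1`
      [set x | `|ratr (c.1 ord0 i) - x| < ratr c.2].
  apply/seteqP; split=> t /=; first by move=> h i _; exact: h.
  by move=> h i; exact: (h i).
apply: fin_bigcap_measurable => [|i _]; first exact: finite_finset.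
rewrite -[X in measurable X]setTI; apply: mf => //.
by apply: open_measurable; exact: (@ball_open R R).
Qed.

End rV_borel.

Definition rV_cons (R : realType) (n : nat) (z : R * 'rV[R]_n) : 'rV[R]_n.+1 :=
  row_mx (const_mx z.1 : 'rV_1) z.2.

Definition rV_uncons (R : realType) (n : nat) (v : 'rV[R]_n.+1) :
    R * 'rV[R]_n :=
  (v ord0 ord0, \row_i v ord0 (lift ord0 i)).

Section rV_cons.
Context {R : realType} {n : nat}.

Lemma rV_consE0 (z : R * 'rV[R]_n) : rV_cons z ord0 ord0 = z.1.
Proof.
by rewrite mxE; case: splitP => [j _|j //]; rewrite mxE.
Qed.

Lemma rV_consES (z : R * 'rV[R]_n) (i : 'I_n) :
  rV_cons z ord0 (lift ord0 i) = z.2 ord0 i.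
Proof.
rewrite mxE; case: splitP => [[[]//]|k /= /eqP].
by rewrite /bump /= eqn_add2l => /eqP/val_inj ->.
Qed.

Lemma rV_consK : cancel (@rV_cons R n) (@rV_uncons R n).
Proof.
move=> [x v]; rewrite /rV_uncons rV_consE0; congr pair.
by apply/rowP => i; rewrite mxE rV_consES.
Qed.

Lemma rV_unconsK : cancel (@rV_uncons R n) (@rV_cons R n).
Proof.
move=> v; apply/rowP => i; have [j ->|->] := unliftP ord0 i.
  by rewrite rV_consES mxE.
by rewrite rV_consE0.
Qed.

Lemma measurable_rV_cons : measurable_fun
  [set: (measurableTypeR R * 'rV[R]_n)%type] (@rV_cons R n).
Proof.
apply: rV_measurable_fun => i; have [j ->|->] := unliftP ord0 i.
  apply: (eq_measurable_fun (fun z : measurableTypeR R * 'rV[R]_n => z.2 ord0 j)).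
    by move=> z _; rewrite rV_consES.
  exact: (measurableT_comp (rV_measurable_coord j)).
apply: (eq_measurable_fun fst) => //.
by move=> z _; rewrite rV_consE0.
Qed.

Lemma measurable_rV_uncons :
  measurable_fun [set: 'rV[R]_n.+1]
    (@rV_uncons R n : _ -> (measurableTypeR R * 'rV[R]_n)%type).
Proof.
apply/measurable_fun_pairP; split; first exact: rV_measurable_coord.
apply: rV_measurable_fun => i /=.
apply: (eq_measurable_fun (fun v : 'rV[R]_n.+1 => v ord0 (lift ord0 i))).
  by move=> v _; rewrite mxE.
exact: rV_measurable_coord.
Qed.

Variable m1 : {sigma_finite_measure set (measurableTypeR R) -> \bar R}.
Variable m : {sigma_finite_measure set 'rV[R]_n -> \bar R}.

Definition rV_cons_measure : set 'rV[R]_n.+1 -> \bar R :=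
  pushforward (m1 \x m)%E (@rV_cons R n).

Let preimage_rV_cons (A : set 'rV[R]_n.+1) :
  measurable A -> measurable (@rV_cons R n @^-1` A).
Proof.
by move=> mA; rewrite -[X in measurable X]setTI; exact: measurable_rV_cons.
Qed.

Let rV_cons_measure0 : rV_cons_measure set0 = 0%E.
Proof. by rewrite /rV_cons_measure /pushforward preimage_set0 measure0. Qed.

Let rV_cons_measure_ge0 A : (0 <= rV_cons_measure A)%E.
Proof. exact: (measure_ge0 (m1 \x m)%E). Qed.

Let rV_cons_measure_sigma_additive : semi_sigma_additive rV_cons_measure.
Proof.
move=> F mF tF mUF; rewrite /rV_cons_measure /pushforward preimage_bigcup.
apply: measure_semi_sigma_additive.
- by move=> k; exact: preimage_rV_cons.
- apply/trivIsetP => /= i j _ _ ij; rewrite -preimage_setI.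
  by move/trivIsetP : tF => /(_ _ _ _ _ ij) ->//; rewrite preimage_set0.
- by rewrite -preimage_bigcup; exact: preimage_rV_cons.
Qed.

HB.instance Definition _ := isMeasure.Build _ _ _ rV_cons_measure
  rV_cons_measure0 rV_cons_measure_ge0 rV_cons_measure_sigma_additive.

Let rV_cons_measure_sigma_finite : sigma_finite setT rV_cons_measure.
Proof.
have /sigma_finiteP[F [TF ndF Foo]] := sigma_finiteT m1.
have /sigma_finiteP[G [TG ndG Goo]] := sigma_finiteT m.
exists (fun k => @rV_uncons R n @^-1` (F k `*` G k)) => [|k].
  rewrite -preimage_bigcup; apply/esym; rewrite -subTset => v _.
  have [i _ Fi] : (\bigcup_i F i) (rV_uncons v).1 by rewrite -TF.
  have [j _ Gj] : (\bigcup_i G i) (rV_uncons v).2 by rewrite -TG.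
  exists (maxn i j) => //; split.
  - by move: Fi; exact/subsetPset/ndF/leq_maxl.
  - by move: Gj; exact/subsetPset/ndG/leq_maxr.
have [? ?] := Foo k; have [? ?] := Goo k.
split.
  rewrite -[X in measurable X]setTI.
  by apply: measurable_rV_uncons => //; exact: measurableX.
rewrite /rV_cons_measure /pushforward -comp_preimage.
rewrite (_ : _ \o _ = id); last by apply/funext => z; exact: rV_consK.
by rewrite preimage_id product_measure1E// lte_mul_pinfty// ge0_fin_numE.
Qed.

HB.instance Definition _ := Measure_isSigmaFinite.Build _ _ _ rV_cons_measure
  rV_cons_measure_sigma_finite.

End rV_cons.

(* Lebesgue measure on R^n, as the n-fold product of the one-dimensional one;
   see lebesgue_measure_rV_box for its value on boxes. *)
Fixpoint lebesgue_measure_rV (R : realType) (n : nat) :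
    {sigma_finite_measure set 'rV[R]_n -> \bar R} :=
  match n with
  | 0%N => \d_(0 : 'rV[R]_0)
  | n'.+1 => rV_cons_measure (@lebesgue_measure R) (lebesgue_measure_rV R n')
  end.

Lemma lebesgue_measure_rV_box (R : realType) (n : nat) (a b : 'rV[R]_n) :
  (forall i, a ord0 i <= b ord0 i) ->
  lebesgue_measure_rV R n
    [set x : 'rV[R]_n | forall i, x ord0 i \in `[a ord0 i, b ord0 i]]
  = (\prod_(i < n) (b ord0 i - a ord0 i))%:E.
Proof.
elim: n a b => [|n IHn] a b ab.
  rewrite big_ord0 (_ : [set x | _] = setT); first exact: diracT.
  by rewrite -subTset => x _ [].
pose a' := (rV_uncons a).2; pose b' := (rV_uncons b).2.
pose B := [set x : 'rV[R]_n | forall i, x ord0 i \in `[a' ord0 i, b' ord0 i]].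
have mB : measurable B.
  have -> : B = \bigcap_(i in [set: 'I_n]) (fun x : 'rV[R]_n => x ord0 i) @^-1`
      `[a' ord0 i, b' ord0 i].
    by apply/seteqP; split=> x /= xB i; [move=> _; exact: xB|exact: (xB i)].
  apply: fin_bigcap_measurable => [|i _]; first exact: finite_finset.
  by rewrite -[X in measurable X]setTI; exact: rV_measurable_coord.
rewrite big_ord_recl EFinM /= /rV_cons_measure /pushforward.
rewrite (_ : _ @^-1` _ = `[a ord0 ord0, b ord0 ord0] `*` B); last first.
  apply/seteqP; split=> [z zB|z [z1 z2] i].
    split=> [|i]; first by have := zB ord0; rewrite rV_consE0.
    by have := zB (lift ord0 i); rewrite rV_consES !mxE.
  have [j ->|->] := unliftP ord0 i; last by rewrite rV_consE0.
  by have := z2 j; rewrite rV_consES !mxE.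
rewrite product_measure1E//; congr mule.
  rewrite [LHS](lebesgue_measure_itv `[a ord0 ord0, b ord0 ord0])/= lte_fin.
  move: (ab ord0); rewrite le_eqVlt => /orP[/eqP ->|->]; last by [].
  by rewrite ltxx subrr.
rewrite IHn => [|i]; last by rewrite !mxE.
by congr EFin; apply: eq_bigr => i _; rewrite !mxE.
Qed.

Section fractional_pq.
Context {R : realType} {N : nat}.
Implicit Types (s m p q r lambda alpha : R) (u v g phi : 'rV[R]_N -> R).

Local Notation mu := (lebesgue_measure_rV R N).

(* The norm on 'rV[R]_N provided by the library is the sup norm. *)
Definition euclidean_norm (x : 'rV[R]_N) : R :=
  Num.sqrt (\sum_(i < N) x ord0 i ^+ 2).

Definition sobolev_exponent s m : R := N%:R * m / (N%:R - s * m).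

(* The integrand is 0 on the diagonal, since _ / 0 = 0 in a field. *)
Definition gagliardo_seminorm s m u : \bar R :=
  ((\int[mu \x mu]_z
      (`|u z.1 - u z.2| `^ m / euclidean_norm (z.1 - z.2) `^ (N%:R + s * m))%:E)
    `^ m^-1)%E.

(* Functions defined everywhere and Borel measurable stand for their classes
   modulo equality almost everywhere. *)
Definition Dspace s m : set ('rV[R]_N -> R) :=
  [set u | u \in Lfun mu (sobolev_exponent s m)%:E /\
           (gagliardo_seminorm s m u < +oo)%E].

Definition Wspace s p q : set ('rV[R]_N -> R) := Dspace s p `&` Dspace s q.

Definition Jfun m (t : R) : R := `|t| `^ (m - 2) * t.

Definition pq_energy s p q u phi : \bar R :=
  (\int[mu \x mu]_z
     ((Jfun p (u z.1 - u z.2) / euclidean_norm (z.1 - z.2) `^ (N%:R + s * p)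
       + Jfun q (u z.1 - u z.2) / euclidean_norm (z.1 - z.2) `^ (N%:R + s * q))
      * (phi z.1 - phi z.2))%:E)%E.

Definition weak_solution s p q r lambda g u : Prop :=
  [/\ Wspace s p q u,
      {ae mu, forall x, 0 <= u x}
    & forall phi, Wspace s p q phi ->
        pq_energy s p q u phi =
          ((\int[mu]_x
              (u^\+ x `^ (sobolev_exponent s p - 2) * u^\+ x * phi x)%:E)
           + lambda%:E *
             (\int[mu]_x (g x * (u^\+ x `^ (r - 2)) * u^\+ x * phi x)%:E))%E].

(* v is the Hoelder continuous representative of the class of u. *)
Definition hoelder_loc alpha u : Prop :=
  exists v, [/\ ae_eq mu setT u v,
    exists M : R, forall x, `|v x| <= M
  & forall Omega : set 'rV[R]_N, compact Omega ->
      exists C : R, forall x y, Omega x -> Omega y -> x != y ->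
        `|v x - v y| / euclidean_norm (x - y) `^ alpha <= C].

End fractional_pq.

Arguments sobolev_exponent {R} N s m.

(* Main.v *)
(* A weak solution u is first shown to be bounded by a De Giorgi iteration at
   the critical exponent. Testing with (u - k)_+ and using the Sobolev
   inequality, the p_s^*-masses Y_j of (u - M (2 - 2^-j))_+ satisfy
   Y_(j+1) <= (C b^j Y_j)^(p_s^*/p), and Y_0 is as small as needed for M large.

   Hence (-Delta_p)^s u + (-Delta_q)^s u is bounded, and a barrier argument
   gives Hoelder continuity. Suppose v >= 0 in a cube of size r and v >= omega/2
   on half of it. Testing with the positive part of (delta omega bump - v_+),
   the interaction with {v >= omega/2} is at least of order
   omega^(m-1) r^(-sm), whereas the bump and the slowly growing negative part of
   v outside the cube cost at most delta times that; this holds for m = p and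
   m = q separately, so that the two operators need not be compared. It follows
   that v >= delta omega/2 in a smaller cube. Applied to u - m or M - u, with m
   and M the current bounds of u, this makes the oscillation of u decay
   geometrically. The assumption 2 < q makes the bump, which is only of class
   C^(1,1), have bounded fractional p- and q-Laplacians. *)
From HB Require Import structures.
Require Import Defs.
From mathcomp Require Import all_boot all_order all_algebra.
From mathcomp Require Import all_classical all_reals all_analysis.
From mathcomp Require Import measurable_realfun ess_sup_inf ring lra.

Set Implicit Arguments.
Unset Strict Implicit.
Unset Printing Implicit Defensive.

Import Order.TTheory GRing.Theory Num.Theory.
Import numFieldNormedType.Exports.

Local Open Scope classical_set_scope.
Local Open Scope ring_scope.

(** * Reflections, cubes and norms *)

(** No fractional Laplacian is evaluated pointwise: every estimate compares energies tested with a
    non-negative function. The obstacle is that the inner integral defining the operator on the bump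
    need not converge absolutely when [s * m >= m - 1]. It is therefore cut off near the diagonal,
    and its first-order part is cancelled by averaging over the reflection [y |-> x + x - y]; this
    is the use of the invariance of Lebesgue measure under reflections.

    The negative part of [v] may grow with exponent [s]: as [s * (m - 1) < s * m], its tail then
    converges for [m = p] and [m = q] alike. In the balance with the bounded right-hand side only
    the gain of the [p]-energy is used, while the [q]-energy enters through its sign. The gain
    [omega ^ (p - 1) / r ^ (s * p)] does not shrink along the iteration, because the oscillation
    decays with an exponent [alpha] for which [alpha * (p - 1) <= s * p].

    In the De Giorgi step the [q]-energy is dropped, being non-negative, and the term with [g] is
    absorbed by the critical one because all levels are at least [1]. *)

Section reflection.
Context {R : realType}.

Lemma lebesgue_measure_reflect (c : R) (A : set R) : measurable A ->
  pushforward (@lebesgue_measure R)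
    (fun x : measurableTypeR R => (c - x : measurableTypeR R)) A = lebesgue_measure A.
Proof.
pose f : measurableTypeR R -> measurableTypeR R := fun x => c - x.
have mf : measurable_fun setT f by exact: measurable_funB.
pose mf_mixin := isMeasurableFun.Build _ _ _ _ f mf.
pose mf_pack : {mfun measurableTypeR R >-> measurableTypeR R} := HB.pack f mf_mixin.
move=> mA; apply/esym.
apply: (@lebesgue_measure_unique R (pushforward (@lebesgue_measure R) mf_pack)) => //=.
move=> _ [[a b]] _ <-.
rewrite /pushforward /= /f.
have -> : (fun x : R => c - x) @^-1` `]a, b] = `[c - b, c - a[%classic.
  apply/seteqP; split => x /=; rewrite !in_itv/= => /andP[h1 h2]; apply/andP; split; lra.
rewrite !lebesgue_measure_itv/= !lte_fin.
case: (ltP a b) => ab.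
  rewrite (_ : (c - b < c - a) = true); last by apply/idP; lra.
  by rewrite -!EFinB; congr EFin; lra.
by rewrite (_ : (c - b < c - a) = false)//; apply/negbTE; rewrite -leNgt; lra.
Qed.

Lemma measurable_reflect_rV (n : nat) (c : 'rV[R]_n) :
  measurable_fun setT (fun x : 'rV[R]_n => c - x).
Proof.
apply: rV_measurable_fun => i.
apply: (eq_measurable_fun (fun x : 'rV[R]_n => c ord0 i - x ord0 i)).
  by move=> x _; rewrite !mxE.
by apply: measurable_funB => //; exact: rV_measurable_coord.
Qed.

(** Induction along the recursive definition of the measure: the induction hypothesis reflects the
    sections, and the one-dimensional change of variables [x |-> c0 - x] reflects the first
    coordinate. *)
Lemma lebesgue_measure_rV_reflect (n : nat) (c : 'rV[R]_n) (A : set 'rV[R]_n) :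
  measurable A ->
  lebesgue_measure_rV R n ((fun x => c - x) @^-1` A) = lebesgue_measure_rV R n A.
Proof.
elim: n c A => [|n IHn] c A mA.
  have E (x : 'rV[R]_0) : c - x = x by apply/rowP => -[].
  by congr (lebesgue_measure_rV R 0 _); apply/seteqP; split => x /=; rewrite E.
rewrite /= /rV_cons_measure /pushforward.
set B := rV_cons (n:=n) @^-1` A.
have mB : measurable (B : set (measurableTypeR R * 'rV[R]_n)).
  by rewrite -[X in measurable X]setTI; exact: measurable_rV_cons.
pose c0 := c ord0 ord0; pose c' : 'rV[R]_n := \row_i c ord0 (lift ord0 i).
rewrite /product_measure1 /=.
transitivity (\int[lebesgue_measure]_x
   (lebesgue_measure_rV R n (xsection B (c0 - x)%R)))%E; last first.
  pose f : measurableTypeR R -> measurableTypeR R := fun x => c0 - x.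
  have mf : measurable_fun setT f by exact: measurable_funB.
  have := @ge0_integral_pushforward _ _ _ _ R _ mf (@lebesgue_measure R) setT
    (fun x => lebesgue_measure_rV R n (xsection B x)) measurableT.
  rewrite preimage_setT => <-//; last by apply: measurable_fun_xsection.
  apply: eq_measure_integral => D mD _; exact: lebesgue_measure_reflect.
apply: eq_integral => x _ /=.
rewrite -[in RHS](IHn c'); last by apply: measurable_xsection.
congr (lebesgue_measure_rV R n _); apply/seteqP; split=> y /=; rewrite !xsectionE /B /=.
all: suff -> : c - rV_cons (x, y) = rV_cons (c0 - x, c' - y) by [].
all: apply/rowP => i; have [j ->|->] := unliftP ord0 i; rewrite [LHS]mxE [X in _ + X]mxE ?rV_consES ?rV_consE0 //=; by rewrite !mxE.
Qed.

Lemma ge0_integral_reflect (n : nat) (c : 'rV[R]_n) (f : 'rV[R]_n -> \bar R) :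
  measurable_fun setT f -> (forall x, 0 <= f x)%E ->
  (\int[lebesgue_measure_rV R n]_x f (c - x)%R = \int[lebesgue_measure_rV R n]_x f x)%E.
Proof.
move=> mf f0.
have := @ge0_integral_pushforward _ _ _ _ R _ (measurable_reflect_rV c)
  (lebesgue_measure_rV R n) setT f measurableT mf.
rewrite preimage_setT => <-; last by move=> *; exact: f0.
apply: eq_measure_integral; first exact: measurable_reflect_rV.
move=> mg D mD _; exact: lebesgue_measure_rV_reflect.
Qed.

End reflection.

Section cubes.
Context {R : realType} {n : nat}.
Local Notation mu := (lebesgue_measure_rV R n).
Implicit Types (x y c h : 'rV[R]_n).

Lemma rV_norm_leP x (r : R) : 0 <= r ->
  `|x| <= r <-> (forall i, `|x ord0 i| <= r).
Proof.
move=> r0; rewrite /Num.norm /= mx_normrE; split.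
  by move/bigmax_leP => [_ h] i; exact: (h (ord0, i)).
by move=> h; apply/bigmax_leP; split => // -[i j] _ /=; rewrite (ord1 i); exact: h.
Qed.

Lemma rV_norm_coord x i : `|x ord0 i| <= `|x|.
Proof. exact: ((rV_norm_leP x (normr_ge0 x)).1 (lexx _) i). Qed.

(** A closed ball of the sup norm. Being a box, it has an explicit measure, so it replaces Euclidean
    balls throughout. *)
Definition cube c (r : R) : set 'rV[R]_n := [set y | `|y - c| <= r].

Lemma cubeE c (r : R) : 0 <= r -> cube c r =
  [set x | forall i, x ord0 i \in `[(c - const_mx r) ord0 i, (c + const_mx r) ord0 i]].
Proof.
move=> r0; apply/seteqP; split => x /=.
  move=> /(rV_norm_leP _ r0) h i; have := h i.
  by rewrite in_itv/= !mxE ler_distl.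
move=> h; apply/(rV_norm_leP _ r0) => i; have := h i.
by rewrite in_itv/= !mxE ler_distl.
Qed.

Lemma measurable_rV_norm : measurable_fun [set: 'rV[R]_n] (fun x : 'rV[R]_n => `|x|).
Proof.
apply: (measurability (@RGenOpens.G R)); first exact: RGenOpens.measurableE.
move=> _ [_ [a [b ->]] <-]; rewrite setTI; apply: rV_open_measurable.
apply: open_comp; last exact: interval_open.
by move=> v _; exact: norm_continuous.
Qed.

Lemma measurable_rVB d (T : measurableType d) (f g : T -> 'rV[R]_n) :
  measurable_fun setT f -> measurable_fun setT g ->
  measurable_fun setT (fun t => f t - g t).
Proof.
move=> mf mg; apply: rV_measurable_fun => i.
apply: (eq_measurable_fun (fun t => f t ord0 i - g t ord0 i)).
  by move=> x _; rewrite !mxE.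
by apply: measurable_funB; apply: (measurableT_comp (rV_measurable_coord i)).
Qed.

Lemma measurable_cube c (r : R) : measurable (cube c r).
Proof.
have -> : cube c r = setT `&` (fun y => `|y - c|) @^-1` `]-oo, r].
  by rewrite setTI; apply/seteqP; split => x; rewrite /cube /= in_itv/=.
apply: (measurableT_comp measurable_rV_norm) => //.
by apply: measurable_rVB => //; exact: measurable_cst.
Qed.

Lemma measure_cube c (r : R) : 0 <= r -> mu (cube c r) = ((2 * r) ^+ n)%:E.
Proof.
move=> r0; rewrite cubeE// lebesgue_measure_rV_box.
  congr EFin; rewrite (eq_bigr (fun=> 2 * r)) ?prodr_const ?card_ord//.
  by move=> i _; rewrite !mxE; ring.
by move=> i; rewrite !mxE; lra.
Qed.

Lemma euclidean_norm_ge0 x : 0 <= euclidean_norm x.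
Proof. exact: sqrtr_ge0. Qed.

Lemma norm_le_euclidean_norm x : `|x| <= euclidean_norm x.
Proof.
apply/rV_norm_leP; first exact: sqrtr_ge0.
move=> i; rewrite -sqrtr_sqr ler_sqrt ?sumr_ge0//; last by move=> *; exact: sqr_ge0.
rewrite (bigD1 i)//= lerDl sumr_ge0// => *; exact: sqr_ge0.
Qed.

(** The sharp factor is the square root of [n]; the larger factor [n%:R] only changes constants. *)
Lemma euclidean_norm_le_norm x : euclidean_norm x <= n%:R * `|x|.
Proof.
have n0 : 0 <= n%:R * `|x| by rewrite mulr_ge0.
rewrite -(ger0_norm n0) -sqrtr_sqr ler_sqrt ?sqr_ge0//.
apply: (@le_trans _ _ (\sum_(i < n) `|x| ^+ 2)).
  apply: ler_sum => i _; rewrite -[leLHS]real_normK ?num_real//.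
  by rewrite lerXn2r ?nnegrE// rV_norm_coord.
rewrite sumr_const card_ord -[leLHS]mulr_natl exprMn ler_wpM2r ?sqr_ge0//.
by case: (n) => [|m]; [rewrite expr0n | rewrite expr2 ler_peMl// ler1n].
Qed.

Lemma euclidean_normN x : euclidean_norm (- x) = euclidean_norm x.
Proof. by congr Num.sqrt; apply: eq_bigr => i _; rewrite mxE sqrrN. Qed.

Lemma measurable_euclidean_norm :
  measurable_fun [set: 'rV[R]_n] (@euclidean_norm R n).
Proof.
apply: (measurableT_comp (continuous_measurable_fun _)); first exact: sqrt_continuous.
apply: measurable_sum => i; apply: (@measurable_funX _ _ R _ (fun x : 'rV[R]_n => x ord0 i)).
exact: rV_measurable_coord.
Qed.

End cubes.

(** * Singular integrals over dyadic shells *)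

Section singular_integrals.
Context {R : realType} {n : nat}.
Local Notation mu := (lebesgue_measure_rV R n).
Implicit Types (x y c h : 'rV[R]_n).

Lemma exists_expr2_gt (t : R) : exists i : nat, t < 2 ^+ i.
Proof. by exists (Num.bound t); apply: upper_nthrootP. Qed.

Lemma dyadic_shell_below (r t : R) : 0 < t -> t <= r ->
  exists i : nat, r / 2 ^+ i.+1 < t <= r / 2 ^+ i.
Proof.
move=> t0 tr.
have ex : exists i : nat, r / 2 ^+ i.+1 < t.
  have [i hi] := exists_expr2_gt (r / t); exists i.
  rewrite ltr_pdivrMr ?exprn_gt0// mulrC -ltr_pdivrMr// (lt_le_trans hi)//.
  by rewrite ler_weXn2l// ler1n.
case: (ex_minnP ex) => -[|i] h1 h2.
  by exists 0%N; rewrite h1 expr0 divr1.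
by exists i.+1; rewrite h1 /= leNgt; apply/negP => /h2; rewrite ltnn.
Qed.

Lemma dyadic_shell_above (r t : R) : 0 < r -> r < t ->
  exists i : nat, r * 2 ^+ i < t <= r * 2 ^+ i.+1.
Proof.
move=> r0 rt.
have ex : exists i : nat, t <= r * 2 ^+ i.+1.
  have [i hi] := exists_expr2_gt (t / r); exists i.
  rewrite mulrC -ler_pdivrMr// (le_trans (ltW hi))//.
  by rewrite ler_weXn2l// ler1n.
case: (ex_minnP ex) => -[|i] h1 h2.
  by exists 0%N; rewrite h1 expr0 mulr1 rt.
by exists i.+1; rewrite h1 andbT ltNge; apply/negP => /h2; rewrite ltnn.
Qed.

(** [f] lies below the sum of the functions [c i] times the indicator of [cube x (r i)], whose
    integrals form a series dominated by a geometric one. One term is enough at each point, so full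
    cubes can stand for dyadic shells. *)
Lemma integral_le_cube_series x (f : 'rV[R]_n -> R) (r c : nat -> R) (C z : R) :
  measurable_fun setT f -> (forall y, 0 <= f y) ->
  (forall i, 0 <= r i) -> (forall i, 0 <= c i) -> 0 <= C -> 0 < z < 1 ->
  (forall y, f y = 0 \/ exists i, `|y - x| <= r i /\ f y <= c i) ->
  (forall i, c i * (2 * r i) ^+ n <= C * z ^+ i) ->
  (\int[mu]_y (f y)%:E <= (C / (1 - z))%:E)%E.
Proof.
move=> mf f0 r0 c0 C0 /andP[z0 z1] fc cz.
pose g i y : \bar R := (c i * \1_(cube x (r i)) y)%:E.
have g0 i y : (0 <= g i y)%E by rewrite lee_fin mulr_ge0// ler0n.
have mg i : measurable_fun setT (g i).
  apply/measurable_EFinP; apply: measurable_funM => //.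
  by apply: measurable_indic; exact: measurable_cube.
have gE i : (\int[mu]_y g i y = (c i * (2 * r i) ^+ n)%:E)%E.
  rewrite /g; under eq_integral do rewrite EFinM.
  rewrite ge0_integralZl_EFin//; last first.
    by apply/measurable_EFinP/measurable_indic; exact: measurable_cube.
  rewrite integral_indic; [|exact: measurableT|exact: measurable_cube].
  by rewrite setIT [X in (_ * X)%E]measure_cube.
apply: (@le_trans _ _ (\int[mu]_y \sum_(i <oo) g i y)%E).
  apply: ge0_le_integral => //.
  - by move=> y _; rewrite lee_fin.
  - exact/measurable_EFinP.
  - exact: ge0_emeasurable_sum.
  - move=> y _; have [->|[i [yi fi]]] := fc y; first by apply: nneseries_ge0 => *; exact: g0.
    apply: (@le_trans _ _ (g i y)).
      by rewrite /g indicE mem_set//= mulr1 lee_fin.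
    rewrite (@nneseriesD1 _ (g ^~ y) i xpredT)// leeDl//.
    by apply: nneseries_ge0 => *; exact: g0.
rewrite integral_nneseries//.
apply: lime_le; first by apply: is_cvg_nneseries => i _ _; apply: integral_ge0.
apply: nearW => k; rewrite (eq_bigr _ (fun i _ => gE i)) sumEFin lee_fin.
apply: (@le_trans _ _ (series (geometric C z) k)).
  by apply: ler_sum => i _; exact: cz.
by apply: geometric_le_lim => //; rewrite gtr0_norm.
Qed.

Lemma half_powR_lt1 (a : R) : 0 < a -> 0 < 2^-1 `^ a < 1.
Proof.
move=> a0; rewrite powR_gt0//=.
have e : 1 `^ a = 1 :> R by rewrite powR1.
rewrite -[X in _ < X]e; apply: gt0_ltr_powR; rewrite ?nnegrE//.
by rewrite invf_lt1// ltr1n.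
Qed.

Lemma powR_exprn (a b : R) k : 0 <= a -> (a ^+ k) `^ b = (a `^ b) ^+ k.
Proof.
by move=> a0; rewrite -(powR_mulrn k a0) -(powR_mulrn k (powR_ge0 _ _)) powRAC.
Qed.

(** On the shell of index [i] the bound for [f] times the volume of the cube is
    [K * r ^ a * 4 ^ n * 2 ^ (- a * i)]. One factor [2 ^ n] comes from the side of the cube, the
    other from the inner radius of the shell in the denominator. The shells never reach the centre,
    where [f] has to vanish. *)
Lemma integral_powR_near_le x (f : 'rV[R]_n -> R) (K r a : R) :
  0 < a -> 0 < r -> 0 <= K -> measurable_fun setT f -> (forall y, 0 <= f y) ->
  f x = 0 ->
  (forall y, `|y - x| <= r -> f y <= K * `|y - x| `^ a / `|y - x| `^ n%:R) ->
  (forall y, r < `|y - x| -> f y = 0) ->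
  (\int[mu]_y (f y)%:E <= (K * r `^ a * (4 ^+ n / (1 - 2^-1 `^ a)))%:E)%E.
Proof.
move=> a0 r0 K0 mf f0 fx fnear ffar.
have z1 := half_powR_lt1 a0.
rewrite mulrA.
apply: (@integral_le_cube_series x f (fun i => r / 2 ^+ i)
  (fun i => K * (r / 2 ^+ i) `^ a / (r / 2 ^+ i.+1) ^+ n)) => //.
- by move=> i; rewrite divr_ge0 ?exprn_ge0// ltW.
- move=> i; rewrite divr_ge0 ?mulr_ge0 ?powR_ge0//.
  by rewrite exprn_ge0// divr_ge0 ?exprn_ge0// ltW.
- by rewrite !mulr_ge0 ?powR_ge0 ?exprn_ge0.
- move=> y; have [yx|xy] := eqVneq y x; first by left; rewrite yx.
  case: (ltP r `|y - x|) => yr; first by left; exact: ffar.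
  have t0 : 0 < `|y - x| by rewrite normr_gt0 subr_eq0.
  right; have [i /andP[h1 h2]] := dyadic_shell_below t0 yr; exists i; split => //.
  apply: le_trans (fnear _ yr) _.
  have p1 : 0 < r / 2 ^+ i.+1 by rewrite divr_gt0// exprn_gt0.
  rewrite powR_mulrn// ler_pM ?invr_ge0 ?exprn_ge0 ?mulr_ge0 ?powR_ge0//.
    by rewrite ler_wpM2l// ge0_ler_powR ?nnegrE// ltW// divr_gt0// exprn_gt0.
  by rewrite lef_pV2 ?posrE ?exprn_gt0// lerXn2r ?nnegrE// ltW.
- move=> i; rewrite le_eqVlt; apply/orP; left; apply/eqP.
  have r2 : 0 < r / 2 ^+ i by rewrite divr_gt0// exprn_gt0.
  have e2 : 0 < (2 : R) ^+ i by rewrite exprn_gt0.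
  rewrite powRM ?invr_ge0 ?(ltW e2) ?(ltW r0)//.
  rewrite -exprVn powR_exprn// exprVn.
  have -> : (2 * (r / 2 ^+ i)) = 4 * (r / 2 ^+ i.+1).
    by rewrite exprS; field; rewrite gt_eqF.
  rewrite [(4 * _) ^+ n]exprMn.
  have : r / 2 ^+ i.+1 != 0 by rewrite gt_eqF// divr_gt0// exprn_gt0.
  move: (r / _) => q q0. field; exact: expf_neq0.
Qed.

(** The same computation with shells growing outwards; the ratio of the series is now
    [2 ^ (- b)]. *)
Lemma integral_powR_far_le x (f : 'rV[R]_n -> R) (K r b : R) :
  0 < b -> 0 < r -> 0 <= K -> measurable_fun setT f -> (forall y, 0 <= f y) ->
  (forall y, `|y - x| <= r -> f y = 0) ->
  (forall y, r < `|y - x| -> f y <= K / (`|y - x| `^ b * `|y - x| `^ n%:R)) ->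
  (\int[mu]_y (f y)%:E <= (K / r `^ b * (4 ^+ n / (1 - 2^-1 `^ b)))%:E)%E.
Proof.
move=> b0 r0 K0 mf f0 fnear ffar.
have z1 := half_powR_lt1 b0.
rewrite mulrA.
have p1 i : 0 < r * 2 ^+ i by rewrite mulr_gt0// exprn_gt0.
apply: (@integral_le_cube_series x f (fun i => r * 2 ^+ i.+1)
  (fun i => K / ((r * 2 ^+ i) `^ b * (r * 2 ^+ i) ^+ n))) => //.
- by move=> i; rewrite ltW.
- by move=> i; rewrite divr_ge0// mulr_ge0 ?powR_ge0// exprn_ge0// ltW.
- by rewrite !mulr_ge0 ?invr_ge0 ?powR_ge0 ?exprn_ge0.
- move=> y.
  case: (leP `|y - x| r) => yr; first by left; exact: fnear.
  right; have [i /andP[h1 h2]] := dyadic_shell_above r0 yr; exists i; split => //.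
  apply: le_trans (ffar _ yr) _.
  have t0 := lt_trans r0 yr.
  rewrite ler_wpM2l// lef_pV2; last 2 first.
  - by rewrite posrE mulr_gt0 ?powR_gt0.
  - by rewrite posrE mulr_gt0 ?powR_gt0 ?exprn_gt0.
  rewrite powR_mulrn// ler_pM ?exprn_ge0 ?powR_ge0 ?(ltW (p1 _))//.
    by rewrite ge0_ler_powR ?nnegrE// ?ltW.
  by rewrite lerXn2r ?nnegrE// ltW.
- move=> i; rewrite le_eqVlt; apply/orP; left; apply/eqP.
  have e2 : 0 < (2 : R) ^+ i by rewrite exprn_gt0.
  rewrite powRM ?(ltW e2) ?(ltW r0)// powR_exprn//.
  rewrite -[2^-1]powR_inv1// -powRrM mulN1r powRN exprVn.
  have -> : (2 * (r * 2 ^+ i.+1)) = 4 * (r * 2 ^+ i) by rewrite exprS; ring.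
  rewrite [(4 * _) ^+ n]exprMn.
  have : (r * 2 ^+ i) ^+ n != 0 by rewrite expf_neq0// gt_eqF.
  have : (2 `^ b) ^+ i != 0 by rewrite expf_neq0// gt_eqF// powR_gt0.
  have : r `^ b != 0 by rewrite gt_eqF// powR_gt0.
  move: (_ ^+ n) (_ ^+ i) (r `^ _) => *; field.
  by apply/and3P.
Qed.

End singular_integrals.

(** * The power nonlinearity *)

Section Jfun_inequalities.
Context {R : realType}.
Implicit Types (m k t a b M : R).

(** Young's inequality for the product [t * 1] with exponents [k] and [k / (k - 1)]. It takes the
    place of differentiation in the estimates for powers. *)
Lemma powR_bernoulli k t : 1 <= k -> 0 <= t -> k * t <= t `^ k + (k - 1).
Proof.
rewrite le_eqVlt => /predU1P[<- t0|k1 t0]; first by rewrite powRr1//; lra.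
have k0 : 0 < k by lra.
have q0 : 0 < k / (k - 1) by rewrite divr_gt0//; lra.
have kq : k^-1 + (k / (k - 1))^-1 = 1.
  by field; apply/andP; split; rewrite gt_eqF//; lra.
have := @conjugate_powR R t 1 _ _ t0 ler01 k0 q0 kq.
rewrite mulr1 powR1 -(ler_pM2l k0) => h; apply: (le_trans h).
rewrite le_eqVlt; apply/orP; left; apply/eqP.
by field; apply/andP; split; rewrite gt_eqF//; lra.
Qed.

Lemma JfunN m t : Jfun m (- t) = - Jfun m t.
Proof. by rewrite /Jfun normrN mulrN. Qed.

Lemma Jfun0 m : Jfun m 0 = 0.
Proof. by rewrite /Jfun mulr0. Qed.

Lemma Jfun_ge0E m t : 2 < m -> 0 <= t -> Jfun m t = t `^ (m - 1).
Proof.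
move=> m2 t0; rewrite /Jfun ger0_norm// mulrC.
have -> : m - 2 = (m - 1) - 1 by ring.
by rewrite mulr_powRB1//; lra.
Qed.

Lemma Jfun_ge0 m t : 0 <= t -> 0 <= Jfun m t.
Proof. by move=> t0; rewrite /Jfun mulr_ge0 ?powR_ge0. Qed.

Lemma Jfun_le0 m t : t <= 0 -> Jfun m t <= 0.
Proof. by move=> t0; rewrite /Jfun mulr_ge0_le0 ?powR_ge0. Qed.

Lemma normr_Jfun m t : 2 < m -> `|Jfun m t| = `|t| `^ (m - 1).
Proof.
by move=> m2; rewrite -Jfun_ge0E// /Jfun normrM normr_id ger0_norm ?powR_ge0.
Qed.

Lemma Jfun_nondecreasing m a b : 2 < m -> a <= b -> Jfun m a <= Jfun m b.
Proof.
move=> m2 ab; case: (leP 0 a) => a0.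
  rewrite !Jfun_ge0E//; last exact: le_trans ab.
  by apply: ge0_ler_powR; rewrite ?nnegrE//; lra.
case: (leP 0 b) => b0.
  by apply: (@le_trans _ _ 0); [apply: Jfun_le0; exact: ltW|exact: Jfun_ge0].
rewrite -[a]opprK -[b]opprK (JfunN _ (- a)) (JfunN _ (- b)) lerN2.
rewrite !Jfun_ge0E//; try lra.
by apply: ge0_ler_powR; rewrite ?nnegrE//; lra.
Qed.

(** Cruder than Young's inequality: both factors are replaced by the larger of [|a|] and [|b|]. This
    suffices for integrability. *)
Lemma Jfun_young m a b : 2 < m -> `|Jfun m a * b| <= `|a| `^ m + `|b| `^ m.
Proof.
move=> m2; rewrite normrM normr_Jfun//.
have m0 : 0 < m by lra.
have E t : 0 <= t -> t `^ (m - 1) * t = t `^ m.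
  by move=> t0; rewrite mulrC mulr_powRB1.
case: (leP `|a| `|b|) => ab.
  apply: (@le_trans _ _ (`|b| `^ (m - 1) * `|b|)).
    by rewrite ler_wpM2r// ge0_ler_powR ?nnegrE//; lra.
  by rewrite E// lerDr powR_ge0.
apply: (@le_trans _ _ (`|a| `^ (m - 1) * `|a|)).
  by rewrite ler_wpM2l ?powR_ge0// ltW.
by rewrite E// lerDl powR_ge0.
Qed.

(** Meant for [a] an increment of [u] and [b] the increment of a truncation of [u]: truncating
    contracts increments and keeps their sign. *)
Lemma Jfun_mul_ge m a b : 2 < m -> `|b| <= `|a| -> 0 <= a * b ->
  `|b| `^ m <= Jfun m a * b.
Proof.
move=> m2 ba ab; rewrite /Jfun -mulrA -(ger0_norm ab) normrM mulrA.
have m0 : 0 < m by lra.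
rewrite -[`|a| `^ _ * _]mulrC.
have -> : m - 2 = (m - 1) - 1 by ring.
rewrite mulr_powRB1//; last by lra.
rewrite -(mulr_powRB1 (normr_ge0 b) m0) mulrC ler_wpM2r//.
by rewrite ge0_ler_powR ?nnegrE//; lra.
Qed.

(** The mean value inequality for powers: [powR_bernoulli] at [b / a], multiplied by [a ^ k]. *)
Lemma powR_sub_le k M a b : 1 <= k -> 0 <= b -> b <= a -> a <= M ->
  a `^ k - b `^ k <= k * M `^ (k - 1) * (a - b).
Proof.
move=> k1 b0 ba aM; have k0 : 0 < k by lra.
case: (ltP 0 a) => a0; last first.
  have -> : a = b by lra.
  by rewrite !subrr mulr0.
have := powR_bernoulli k1 (divr_ge0 b0 (ltW a0)).
have ak0 : 0 < a `^ k by exact: powR_gt0.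
rewrite -(ler_pM2l ak0) => h.
have ek : a `^ k * (b / a) `^ k = b `^ k.
  by rewrite -powRM ?divr_ge0// ?(ltW a0)//; congr (_ `^ _); field; rewrite gt_eqF.
have ea : a `^ k * (k * (b / a)) = k * (a `^ (k - 1) * b).
  by rewrite -(mulr_powRB1 (ltW a0) k0); field; rewrite gt_eqF.
rewrite mulrDr ek ea in h.
apply: (@le_trans _ _ (k * a `^ (k - 1) * (a - b))).
  have e2 := mulr_powRB1 (ltW a0) k0.
  rewrite -e2 in h *; move: h; set A := a `^ (k - 1); nra.
rewrite ler_wpM2r ?subr_ge0// ler_wpM2l ?(ltW k0)//.
by rewrite ge0_ler_powR ?nnegrE//; lra.
Qed.

Lemma Jfun_lipschitz m M a b : 2 < m -> `|a| <= M -> `|b| <= M ->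
  `|Jfun m a - Jfun m b| <= (m - 1) * M `^ (m - 2) * `|a - b|.
Proof.
move=> m2; wlog ba : a b / b <= a.
  move=> H; case: (leP b a) => [ba|/ltW ab]; first exact: H.
  by move=> aM bM; rewrite distrC [`|a - b|]distrC; exact: H.
have m1 : 1 <= m - 1 by lra.
have em : m - 2 = (m - 1) - 1 by ring.
move=> aM bM; rewrite !ger0_norm ?subr_ge0 ?Jfun_nondecreasing//.
move: aM bM; rewrite !ler_norml => /andP[a1 a2] /andP[b1 b2].
case: (leP 0 b) => b0.
  by rewrite !Jfun_ge0E ?(le_trans b0)// em powR_sub_le.
case: (leP a 0) => a0.
  have e t : t <= 0 -> Jfun m t = - (- t) `^ (m - 1).
    by move=> t0; rewrite -Jfun_ge0E ?oppr_ge0// JfunN opprK.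
  rewrite !e//; last exact: le_trans a0.
  rewrite opprK addrC; have -> : a - b = - b - - a by ring.
  rewrite em; apply: powR_sub_le; lra.
(* For [b < 0 < a] both terms are compared with [0]: here [|a - b| = a + (- b)], so the two bounds
   add up. *)
have h t : 0 <= t -> t <= M -> Jfun m t <= (m - 1) * M `^ (m - 2) * t.
  move=> t0 tM; rewrite /Jfun ger0_norm// ler_wpM2r//.
  apply: (@le_trans _ _ (M `^ (m - 2))).
    by apply: ge0_ler_powR; rewrite ?nnegrE//; lra.
  by rewrite ler_peMl ?powR_ge0.
have ha := h a (ltW a0) a2.
have hb : Jfun m (- b) <= (m - 1) * M `^ (m - 2) * (- b) by apply: h; lra.
rewrite JfunN in hb.
lra.
Qed.

End Jfun_inequalities.

Section measurability.
Context d (T : measurableType d) (R : realType).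
Implicit Types f : T -> R.

Lemma measurable_fun_powR f (p : R) :
  measurable_fun setT f -> measurable_fun setT (fun x => f x `^ p).
Proof. exact: (@measurableT_comp _ _ _ _ _ _ (@powR R ^~ p)). Qed.

Lemma measurable_fun_normr f :
  measurable_fun setT f -> measurable_fun setT (fun x => `|f x|).
Proof. exact: (@measurableT_comp _ _ _ _ _ _ (@Num.norm R R)). Qed.

Lemma measurable_fun_Jfun f (m : R) :
  measurable_fun setT f -> measurable_fun setT (fun x => Jfun m (f x)).
Proof.
move=> mf; apply: measurable_funM => //.
exact/measurable_fun_powR/measurable_fun_normr.
Qed.

(** The inverse is expressed through powers, whose measurability is available; at a zero of [f] both
    expressions are [0], since [0^-1 = 0]. *)
Lemma measurable_fun_inv f :
  measurable_fun setT f -> measurable_fun setT (fun x => (f x)^-1).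
Proof.
move=> mf; have -> : (fun x => (f x)^-1) =
    (fun x => f x * (`|f x| `^ 2) `^ (-1)).
  apply/funext => x; rewrite powR_inv1 ?powR_ge0// powR_mulrn//.
  have [->|h] := eqVneq (f x) 0; first by rewrite mul0r invr0.
  by rewrite real_normK ?num_real// expr2; field.
apply: measurable_funM => //.
exact/measurable_fun_powR/measurable_fun_powR/measurable_fun_normr.
Qed.

End measurability.

Lemma gt0_powRD (R : realType) (x a b : R) :
  0 < x -> x `^ (a + b) = x `^ a * x `^ b.
Proof. by move=> x0; apply: powRD; apply/implyP => _; rewrite gt_eqF. Qed.

(** * Integrals against the fractional kernel *)

Section kernel.
Context {R : realType} {n : nat}.
Local Notation mu := (lebesgue_measure_rV R n).
Implicit Types (s m : R) (x y c h : 'rV[R]_n) (f g phi : 'rV[R]_n -> R).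

Definition kernel s m h : R := (euclidean_norm h `^ (n%:R + s * m))^-1.

Lemma kernel_ge0 s m h : 0 <= kernel s m h.
Proof. by rewrite invr_ge0 powR_ge0. Qed.

Lemma kernelN s m h : kernel s m (- h) = kernel s m h.
Proof. by rewrite /kernel euclidean_normN. Qed.

Lemma kernelC s m x y : kernel s m (x - y) = kernel s m (y - x).
Proof. by rewrite -kernelN opprB. Qed.

Lemma kernel_le s m h : 0 < s * m -> h != 0 ->
  kernel s m h <= (`|h| `^ (s * m) * `|h| `^ n%:R)^-1.
Proof.
move=> sm0 h0; have p0 : 0 < `|h| by rewrite normr_gt0.
have q0 : 0 < n%:R + s * m by rewrite ltr_wpDl.
rewrite mulrC -powRD; last by rewrite gt_eqF.
rewrite lef_pV2 ?posrE ?powR_gt0// ?(lt_le_trans p0) ?norm_le_euclidean_norm//.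
rewrite ge0_ler_powR ?nnegrE ?(ltW q0)//; first exact: euclidean_norm_ge0.
exact: norm_le_euclidean_norm.
Qed.

Lemma kernel_ge s m h r : 0 < s * m -> h != 0 -> `|h| <= r ->
  ((n%:R * r) `^ (n%:R + s * m))^-1 <= kernel s m h.
Proof.
move=> sm0 h0 hr; have p0 : 0 < `|h| by rewrite normr_gt0.
have q0 : 0 < n%:R + s * m by rewrite ltr_wpDl.
have e0 : 0 < euclidean_norm h.
  by rewrite (lt_le_trans p0)// norm_le_euclidean_norm.
have er : euclidean_norm h <= n%:R * r.
  by rewrite (le_trans (euclidean_norm_le_norm _))// ler_wpM2l.
rewrite lef_pV2 ?posrE ?powR_gt0//; last exact: lt_le_trans er.
rewrite ge0_ler_powR ?nnegrE ?(ltW q0) ?(ltW e0)//.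
by rewrite (le_trans _ er)// ltW.
Qed.

Lemma kernel0 s m : 0 < s * m -> kernel s m 0 = 0.
Proof.
move=> sm0; have q0 : 0 < n%:R + s * m by rewrite ltr_wpDl.
rewrite /kernel; have -> : euclidean_norm (0 : 'rV[R]_n) = 0.
  apply/eqP; rewrite eq_le euclidean_norm_ge0 andbT.
  by rewrite (le_trans (euclidean_norm_le_norm _))// normr0 mulr0.
by rewrite powR0 ?invr0// gt_eqF.
Qed.

Lemma measurable_kernel d (T : measurableType d) (f g : T -> 'rV[R]_n) s m :
  measurable_fun setT f -> measurable_fun setT g ->
  measurable_fun setT (fun t => kernel s m (f t - g t)).
Proof.
move=> mf mg; apply/measurable_fun_inv/measurable_fun_powR.
apply: (measurableT_comp measurable_euclidean_norm).
exact: measurable_rVB.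
Qed.

(** Near [x] the factor [(|y - x| / r) ^ m] beats the singularity because [s * m < m]; away from [x]
    boundedness suffices because [0 < s * m]. The constant does not depend on [x], [r], [A] or [f],
    which gives the scaling [r ^ (- s * m)] of all estimates for the bump. *)
Lemma kernel_integral_le s m : 0 < s * m -> s * m < m -> exists C, 0 < C /\
  forall x (r A : R) f, 0 < r -> 0 <= A -> measurable_fun setT f ->
  (forall y, 0 <= f y) ->
  (forall y, `|y - x| <= r -> f y <= A * (`|y - x| / r) `^ m * kernel s m (x - y)) ->
  (forall y, r < `|y - x| -> f y <= A * kernel s m (x - y)) ->
  (\int[mu]_y (f y)%:E <= (A * C / r `^ (s * m))%:E)%E.
Proof.
move=> sm0 smm; have m0 : 0 < m by lra.
pose C1 : R := 4 ^+ n / (1 - 2^-1 `^ (m - s * m)).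
pose C2 : R := 4 ^+ n / (1 - 2^-1 `^ (s * m)).
have C10 : 0 < C1.
  have /half_powR_lt1 /andP[_ h] : 0 < m - s * m by lra.
  by rewrite divr_gt0 ?exprn_gt0// subr_gt0.
have C20 : 0 < C2.
  have /half_powR_lt1 /andP[_ h] := sm0.
  by rewrite divr_gt0 ?exprn_gt0// subr_gt0.
exists (C1 + C2); split; first exact: addr_gt0.
move=> x r A f r0 A0 mf f0 fnear ffar.
pose f1 y := f y * \1_(cube x r) y; pose f2 y := f y * \1_(~` cube x r) y.
have mf1 : measurable_fun setT f1.
  by apply: measurable_funM => //; apply: measurable_indic; exact: measurable_cube.
have mf2 : measurable_fun setT f2.
  apply: measurable_funM => //; apply: measurable_indic.
  by apply: measurableC; exact: measurable_cube.
have f10 y : 0 <= f1 y by rewrite mulr_ge0// ler0n.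
have f20 y : 0 <= f2 y by rewrite mulr_ge0// ler0n.
have f12 y : (f y)%:E = ((f1 y)%:E + (f2 y)%:E)%E.
  rewrite -EFinD -mulrDr !indicE; congr EFin.
  by rewrite in_setC; case: (_ \in _); rewrite /= ?addr0 ?add0r mulr1.
under eq_integral do rewrite f12.
rewrite ge0_integralD//; last 4 first.
- by move=> y _; rewrite lee_fin.
- exact/measurable_EFinP.
- by move=> y _; rewrite lee_fin.
- exact/measurable_EFinP.
rewrite mulrDr mulrDl EFinD; apply: leeD.
- apply: le_trans (@integral_powR_near_le _ _ x f1 (A / r `^ m) r (m - s * m)
    _ _ _ _ _ _ _ _) _ => //.
  + by lra.
  + by rewrite divr_ge0// powR_ge0.
  + have := fnear x; rewrite subrr normr0 => /(_ (ltW r0)).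
    rewrite kernel0// mulr0 => fx; rewrite /f1 (_ : f x = 0) ?mul0r//.
    by apply/eqP; rewrite eq_le fx f0.
  + move=> y yr; rewrite /f1 indicE mem_set// mulr1.
    have [->|yx] := eqVneq y x.
      have := fnear x; rewrite subrr normr0 => /(_ (ltW r0)).
      rewrite kernel0// mulr0 => /le_trans -> //.
      by rewrite !mulr_ge0 ?invr_ge0 ?powR_ge0.
    have t0 : 0 < `|y - x| by rewrite normr_gt0 subr_eq0.
    apply: le_trans (fnear y yr) _.
    rewrite kernelC; have : y - x != 0 by rewrite subr_eq0.
    move=> /(kernel_le sm0) k; apply: le_trans (ler_wpM2l _ k) _.
      by rewrite mulr_ge0 ?powR_ge0.
    rewrite powRM ?invr_ge0 ?(ltW r0)// -[r^-1]powR_inv1 ?(ltW r0)//.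
    rewrite powRAC powR_inv1 ?powR_ge0// powRB; last by rewrite gt_eqF// implybT.
    rewrite le_eqVlt; apply/orP; left; apply/eqP.
    have : `|y - x| `^ (s * m) != 0 by rewrite gt_eqF ?powR_gt0.
    have : `|y - x| `^ n%:R != 0 by rewrite gt_eqF ?powR_gt0.
    have : r `^ m != 0 by rewrite gt_eqF ?powR_gt0.
    move: (_ `^ m) (r `^ m) (_ `^ n%:R) (_ `^ (s * m)) => a b c d b0 c0 d0.
    by field; apply/and3P.
  + move=> y yr; rewrite /f1 indicE memNset ?mulr0//.
    by rewrite /cube /= => /(lt_le_trans yr); rewrite ltxx.
  + rewrite lee_fin le_eqVlt; apply/orP; left; apply/eqP.
    rewrite -/C1 powRB; last by rewrite gt_eqF// implybT.
    have : r `^ (s * m) != 0 by rewrite gt_eqF ?powR_gt0.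
    have : r `^ m != 0 by rewrite gt_eqF ?powR_gt0.
    by move: (r `^ m) (r `^ _) => a b a0 b0; field; apply/andP.
- apply: le_trans (@integral_powR_far_le _ _ x f2 A r (s * m)
    _ _ _ _ _ _ _) _ => //.
  + by move=> y yr; rewrite /f2 indicE memNset ?mulr0//; exact.
  + move=> y yr; apply: (@le_trans _ _ (f y)).
      by rewrite /f2 ler_piMr// indicE lern1; case: (_ \in _).
    apply: le_trans (ffar y yr) _; apply: ler_wpM2l => //.
    rewrite kernelC kernel_le//; rewrite -normr_gt0; exact: lt_trans yr.
  + by rewrite lee_fin -/C2 mulrAC.
Qed.

(** Growth of order [s * (m - 1)] against decay of order [n + s * m] leaves decay of order [n + s],
    whatever [m] is. This is what [Jfun m] makes of a function growing like [|y - x| ^ s]. *)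
Lemma tail_integral_le s m : 0 < s -> 1 < m -> exists C, 0 < C /\
  forall x (r A : R) f, 0 < r -> 0 <= A -> measurable_fun setT f ->
  (forall y, 0 <= f y) ->
  (forall y, `|y - x| <= r -> f y = 0) ->
  (forall y, r < `|y - x| -> f y <= A * (`|y - x| / r) `^ (s * (m - 1)) /
     `|y - x| `^ (n%:R + s * m)) ->
  (\int[mu]_y (f y)%:E <= (A * C / r `^ (s * m))%:E)%E.
Proof.
move=> s0 m1; exists (4 ^+ n / (1 - 2^-1 `^ s)); split.
  have /half_powR_lt1 /andP[_ h] := s0.
  by rewrite divr_gt0 ?exprn_gt0// subr_gt0.
move=> x r A f r0 A0 mf f0 fnear ffar.
have p0 b : 0 < r `^ b by rewrite powR_gt0.
apply: le_trans (@integral_powR_far_le _ _ x f (A / r `^ (s * (m - 1))) r s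
    _ _ _ _ _ _ _) _ => //.
- by rewrite divr_ge0// ltW.
- move=> y yr; apply: le_trans (ffar y yr) _.
  have t0 : 0 < `|y - x| by exact: lt_trans yr.
  have -> : n%:R + s * m = s * (m - 1) + s + n%:R by ring.
  rewrite !gt0_powRD//.
  rewrite powRM ?invr_ge0 ?(ltW r0)// -[r^-1]powR_inv1 ?(ltW r0)//.
  rewrite powRAC powR_inv1 ?powR_ge0//.
  rewrite le_eqVlt; apply/orP; left; apply/eqP.
  have : `|y - x| `^ s != 0 by rewrite gt_eqF ?powR_gt0.
  have : `|y - x| `^ n%:R != 0 by rewrite gt_eqF ?powR_gt0.
  have : `|y - x| `^ (s * (m - 1)) != 0 by rewrite gt_eqF ?powR_gt0.
  have := lt0r_neq0 (p0 (s * (m - 1))).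
  move: (r `^ (s * (m - 1))) (`|y - x| `^ (s * (m - 1))) (`|y - x| `^ n%:R) (`|y - x| `^ s) => a b c d a0 b0 c0 d0.
  by field; apply/and4P.
- rewrite lee_fin.
  have -> : s * m = s * (m - 1) + s by ring.
  rewrite gt0_powRD// le_eqVlt; apply/orP; left; apply/eqP.
  have := lt0r_neq0 (p0 (s * (m - 1))).
  have := lt0r_neq0 (p0 s).
  have : 1 - 2^-1 `^ s != 0 :> R.
    have /half_powR_lt1 /andP[_ h] := s0.
    by rewrite gt_eqF// subr_gt0.
  move: (r `^ s) (r `^ (s * (m - 1))) (2^-1 `^ s) => a b c c0 a0 b0.
  by field; apply/and3P.
Qed.

End kernel.

(** * Energies *)

Section energy.
Context {R : realType} {n : nat}.
Local Notation mu := (lebesgue_measure_rV R n).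
Implicit Types (s m : R) (x y : 'rV[R]_n) (f g phi eta : 'rV[R]_n -> R).
Implicit Types z : 'rV[R]_n * 'rV[R]_n.

Definition energy_density s m f phi z : R :=
  Jfun m (f z.1 - f z.2) * (phi z.1 - phi z.2) * kernel s m (z.1 - z.2).

Definition gagliardo_density s m f z : R :=
  `|f z.1 - f z.2| `^ m * kernel s m (z.1 - z.2).

(** The double integral without the outer power [m^-1]; by [gagliardo_seminorm_lty] this describes
    the same functions as a finite [gagliardo_seminorm]. *)
Definition finite_gagliardo s m f : Prop :=
  (\int[mu \x mu]_z (gagliardo_density s m f z)%:E < +oo)%E.

Lemma measurable_fst_comp f : measurable_fun setT f ->
  measurable_fun setT (fun z => f z.1).
Proof. by move=> mf; apply: measurableT_comp. Qed.

Lemma measurable_snd_comp f : measurable_fun setT f ->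
  measurable_fun setT (fun z => f z.2).
Proof. by move=> mf; apply: measurableT_comp. Qed.

Lemma measurable_diff_comp f : measurable_fun setT f ->
  measurable_fun setT (fun z => f z.1 - f z.2).
Proof.
move=> mf; apply: measurable_funB;
  [exact: measurable_fst_comp|exact: measurable_snd_comp].
Qed.

Lemma measurable_kernel_diff s m :
  measurable_fun setT (fun z => kernel s m (z.1 - z.2)).
Proof. exact: (measurable_kernel s m measurable_fst measurable_snd). Qed.

Lemma measurable_energy_density s m f phi :
  measurable_fun setT f -> measurable_fun setT phi ->
  measurable_fun setT (energy_density s m f phi).
Proof.
move=> mf mphi; apply: measurable_funM; last exact: measurable_kernel_diff.
apply: measurable_funM; last exact: measurable_diff_comp.
by apply: measurable_fun_Jfun; exact: measurable_diff_comp.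
Qed.

Lemma measurable_gagliardo_density s m f : measurable_fun setT f ->
  measurable_fun setT (gagliardo_density s m f).
Proof.
move=> mf; apply: measurable_funM; last exact: measurable_kernel_diff.
by apply: measurable_fun_powR; apply: measurable_fun_normr; exact: measurable_diff_comp.
Qed.

Lemma gagliardo_density_ge0 s m f z : 0 <= gagliardo_density s m f z.
Proof. by rewrite mulr_ge0 ?powR_ge0 ?kernel_ge0. Qed.

Lemma gagliardo_seminorm_lty s m f : 0 < m ->
  (gagliardo_seminorm s m f < +oo)%E <-> finite_gagliardo s m f.
Proof.
move=> m0; split; last exact: poweR_lty.
by apply: lty_poweRy; rewrite invr_eq0 gt_eqF.
Qed.

Lemma integrable_gagliardo_density s m f : measurable_fun setT f ->
  finite_gagliardo s m f ->
  (mu \x mu)%E.-integrable setT (EFin \o gagliardo_density s m f).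
Proof.
move=> mf ff; apply/integrableP; split.
  by apply/measurable_EFinP; exact: measurable_gagliardo_density.
under eq_integral do rewrite /= ger0_norm ?gagliardo_density_ge0//.
exact: ff.
Qed.

Lemma integrable_energy_density s m f phi : 2 < m ->
  measurable_fun setT f -> measurable_fun setT phi ->
  finite_gagliardo s m f -> finite_gagliardo s m phi ->
  (mu \x mu)%E.-integrable setT (EFin \o energy_density s m f phi).
Proof.
move=> m2 mf mphi ff fphi.
apply: (le_integrable _ _ _ (integrableD measurableT
  (integrable_gagliardo_density mf ff) (integrable_gagliardo_density mphi fphi))) => //.
  by apply/measurable_EFinP; exact: measurable_energy_density.
move=> z _ /=; rewrite lee_fin [leRHS]ger0_norm; last first.
  by rewrite addr_ge0 ?gagliardo_density_ge0.
rewrite -mulrDl normrM (ger0_norm (kernel_ge0 _ _ _)) ler_wpM2r ?kernel_ge0//.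
exact: Jfun_young.
Qed.

(** Pointwise, the [m]-th power of a sum is at most [2 ^ m] times the sum of the powers. Test
    functions built with [Num.max] from a barrier and a solution are controlled in this way. *)
Lemma finite_gagliardo_le s m f g eta : 0 < m ->
  measurable_fun setT f -> measurable_fun setT g -> measurable_fun setT eta ->
  (forall x y, `|eta x - eta y| <= `|f x - f y| + `|g x - g y|) ->
  finite_gagliardo s m f -> finite_gagliardo s m g -> finite_gagliardo s m eta.
Proof.
move=> m0 mf mg meta H ff fg.
apply: (@le_lt_trans _ _ (\int[mu \x mu]_z ((2 `^ m)%:E *
  ((gagliardo_density s m f z)%:E + (gagliardo_density s m g z)%:E)))%E).
  apply: ge0_le_integral => //.
  - by move=> z _; rewrite lee_fin gagliardo_density_ge0.
  - by apply/measurable_EFinP; exact: measurable_gagliardo_density.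
  - apply/measurable_EFinP; apply: measurable_funM => //.
    by apply: measurable_funD; exact: measurable_gagliardo_density.
  - move=> z _; rewrite lee_fin -mulrDl mulrA ler_wpM2r ?kernel_ge0//.
    have {}H := H z.1 z.2.
    have E t : 0 <= t -> 2 `^ m * t `^ m = (2 * t) `^ m.
      by move=> t0; rewrite powRM.
    rewrite mulrDr !E//.
    case: (leP `|f z.1 - f z.2| `|g z.1 - g z.2|) => h.
      apply: (@le_trans _ _ ((2 * `|g z.1 - g z.2|) `^ m)); last first.
        by rewrite lerDr powR_ge0.
      rewrite ge0_ler_powR ?nnegrE ?mulr_ge0 ?(ltW m0)//.
      by apply: (le_trans H); rewrite mulrC mulr_natr mulr2n lerD2r.
    apply: (@le_trans _ _ ((2 * `|f z.1 - f z.2|) `^ m)); last first.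
      by rewrite lerDl powR_ge0.
    rewrite ge0_ler_powR ?nnegrE ?mulr_ge0 ?(ltW m0)//.
    by apply: (le_trans H); rewrite mulrC mulr_natr mulr2n lerD2l ltW.
rewrite ge0_integralZl_EFin; last 4 first.
- exact: measurableT.
- by move=> z _; rewrite adde_ge0// lee_fin gagliardo_density_ge0.
- apply/measurable_EFinP.
  by apply: measurable_funD; exact: measurable_gagliardo_density.
- exact: powR_ge0.
rewrite ge0_integralD//; last 4 first.
- by move=> z _; rewrite lee_fin gagliardo_density_ge0.
- by apply/measurable_EFinP; exact: measurable_gagliardo_density.
- by move=> z _; rewrite lee_fin gagliardo_density_ge0.
- by apply/measurable_EFinP; exact: measurable_gagliardo_density.
apply: lte_mul_pinfty; [by rewrite lee_fin powR_ge0|by []|].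
by apply: lte_add_pinfty; [exact: ff|exact: fg].
Qed.

(** Both summands are integrable by [Jfun_young], so the integral splits without indeterminate
    forms, and the two operators can be estimated one at a time. *)
Lemma pq_energyE s p q f phi : 2 < p -> 2 < q ->
  measurable_fun setT f -> measurable_fun setT phi ->
  finite_gagliardo s p f -> finite_gagliardo s q f ->
  finite_gagliardo s p phi -> finite_gagliardo s q phi ->
  pq_energy s p q f phi =
  (\int[mu \x mu]_z (energy_density s p f phi z)%:E +
   \int[mu \x mu]_z (energy_density s q f phi z)%:E)%E.
Proof.
move=> p2 q2 mf mphi fp fq phip phiq.
rewrite -integralD//; try exact: integrable_energy_density.
apply: eq_integral => z _; rewrite -EFinD /energy_density /kernel; congr EFin.
by rewrite mulrDl; congr (_ + _); rewrite mulrAC.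
Qed.

Lemma ge0_integral_prod_swap (F : 'rV[R]_n * 'rV[R]_n -> \bar R) :
  measurable_fun setT F -> (forall z, 0 <= F z)%E ->
  (\int[mu \x mu]_z F (z.2, z.1) = \int[mu \x mu]_z F z)%E.
Proof.
move=> mF F0.
have mswap : measurable_fun setT (fun z => F (z.2, z.1)).
  by apply: (measurableT_comp mF); exact: measurable_fun_pair.
rewrite (fubini_tonelli1 (fun z => F (z.2, z.1)))// /fubini_F /=.
by rewrite fubini_tonelli2.
Qed.

Lemma integral_prod_swap (F : 'rV[R]_n * 'rV[R]_n -> \bar R) :
  measurable_fun setT F ->
  (\int[mu \x mu]_z F (z.2, z.1) = \int[mu \x mu]_z F z)%E.
Proof.
move=> mF; rewrite [LHS]integralE [RHS]integralE.
congr (_ - _)%E.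
  rewrite -[RHS](ge0_integral_prod_swap (measurable_funepos mF) (funepos_ge0 F)).
  by apply: eq_integral => z _; rewrite !funeposE.
rewrite -[RHS](ge0_integral_prod_swap (measurable_funeneg mF) (funeneg_ge0 F)).
by apply: eq_integral => z _; rewrite !funenegE.
Qed.

Lemma integral_reflect (c : 'rV[R]_n) (F : 'rV[R]_n -> \bar R) :
  measurable_fun setT F -> (\int[mu]_x F (c - x)%R = \int[mu]_x F x)%E.
Proof.
move=> mF; rewrite [LHS]integralE [RHS]integralE.
congr (_ - _)%E.
  rewrite -[RHS](ge0_integral_reflect c (measurable_funepos mF) (funepos_ge0 F)).
  by apply: eq_integral => z _; rewrite !funeposE.
rewrite -[RHS](ge0_integral_reflect c (measurable_funeneg mF) (funeneg_ge0 F)).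
by apply: eq_integral => z _; rewrite !funenegE.
Qed.

End energy.

(** * A bump and its energy *)

Section bump.
Context {R : realType}.
Implicit Types (a b t d e : R).

(** The square of the positive part: not of class [C^2] at [0], but its second differences are still
    quadratic ([possq_second_diff]). *)
Definition possq t : R := Num.max t 0 ^+ 2.

Lemma possq_ge0 t : 0 <= possq t.
Proof. exact: sqr_ge0. Qed.

Lemma possq_cases t : (0 <= t /\ possq t = t ^+ 2) \/ (t <= 0 /\ possq t = 0).
Proof.
rewrite /possq; case: (leP 0 t) => t0; first by left.
by right; split; [exact: ltW|rewrite expr0n].
Qed.

Lemma possq_lipschitz a b : a <= 1 -> b <= 1 ->
  `|possq a - possq b| <= 2 * `|a - b|.
Proof.
wlog ba : a b / b <= a.
  move=> H; case: (leP b a) => [ba|/ltW ab]; first exact: H.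
  by move=> a1 b1; rewrite distrC [`|a - b|]distrC; exact: H.
move=> a1 b1; rewrite [`|a - b|]ger0_norm ?subr_ge0// ler_norml.
by case: (possq_cases a) => -[a0 ->]; case: (possq_cases b) => -[b0 ->];
  apply/andP; split; nra.
Qed.

Lemma possq_second_diff t d :
  `|possq (t + d) + possq (t - d) - 2 * possq t| <= 2 * d ^+ 2.
Proof.
rewrite ler_norml.
by case: (possq_cases (t + d)) => -[h1 ->]; case: (possq_cases (t - d)) => -[h2 ->];
  case: (possq_cases t) => -[h3 ->]; apply/andP; split; nra.
Qed.

Context {n : nat}.
Local Notation mu := (lebesgue_measure_rV R n).
Implicit Types (x y : 'rV[R]_n).
Variables (x0 : 'rV[R]_n) (rho : R).
Hypothesis n0 : (0 < n)%N.
Hypothesis rho0 : 0 < rho.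

Let qf x : R := \sum_(i < n) ((x ord0 i - x0 ord0 i) / rho) ^+ 2.

(** The argument of [possq] is a quadratic polynomial in [x], so its change from [x] to [y] or to
    the reflected point [x + x - y] is an explicit linear part plus a quadratic one. *)
Definition bump x : R := possq (1 - qf x).

Let qf_ge0 x : 0 <= qf x.
Proof. by apply: sumr_ge0 => i _; exact: sqr_ge0. Qed.

Lemma bump_ge0 x : 0 <= bump x.
Proof. exact: possq_ge0. Qed.

Lemma bump_le1 x : bump x <= 1.
Proof.
by rewrite /bump; case: (possq_cases (1 - qf x)) => -[h ->]//;
  have := qf_ge0 x; nra.
Qed.

Lemma bump_out x : rho < `|x - x0| -> bump x = 0.
Proof.
move=> h; have [i hi] : exists i, rho < `|(x - x0) ord0 i|.
  apply: contrapT => /forallNP H.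
  have : `|x - x0| <= rho.
    apply/rV_norm_leP; first exact: ltW.
    by move=> i; rewrite leNgt; apply/negP; exact: H.
  by move=> /(lt_le_trans h); rewrite ltxx.
have q1 : 1 <= qf x.
  rewrite /qf (bigD1 i)//=; apply: (@le_trans _ _ (((x ord0 i - x0 ord0 i) / rho) ^+ 2)).
    rewrite -[leRHS]real_normK ?num_real// exprn_ege1// normrM normfV.
    rewrite (gtr0_norm rho0) ler_pdivlMr// mul1r ltW//.
    by move: hi; rewrite !mxE.
  by rewrite lerDl sumr_ge0// => j _; exact: sqr_ge0.
by rewrite /bump; case: (possq_cases (1 - qf x)) => -[h' ->]//; nra.
Qed.

(** There [qf x <= 1/4], the factor [n%:R] in the radius paying for the sum over the coordinates,
    and [(3/4) ^ 2 >= 1/2]. *)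
Lemma bump_center x : `|x - x0| <= rho / (2 * n%:R) -> 2^-1 <= bump x.
Proof.
move=> h; have n1 : (1 : R) <= n%:R by rewrite ler1n.
have nn0 : (0 : R) < n%:R by rewrite ltr0n.
have q1 : qf x <= 4^-1.
  apply: (@le_trans _ _ (\sum_(i < n) (2 * n%:R)^-1 ^+ 2)).
    apply: ler_sum => i _.
    have hi : `|(x ord0 i - x0 ord0 i) / rho| <= (2 * n%:R)^-1.
      rewrite normrM normfV (gtr0_norm rho0) ler_pdivrMr// mulrC.
      by apply: le_trans h; have := rV_norm_coord (x - x0) i; rewrite !mxE.
    have p0 : 0 <= (2 * n%:R)^-1 :> R by rewrite invr_ge0 mulr_ge0.
    by rewrite -[leLHS]real_normK ?num_real// lerXn2r ?nnegrE.
  rewrite sumr_const card_ord -[leLHS]mulr_natl.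
  have -> : n%:R * (2 * n%:R)^-1 ^+ 2 = 4^-1 * n%:R^-1 :> R.
    by field; rewrite gt_eqF.
  by rewrite ler_piMr// invf_le1.
by rewrite /bump; case: (possq_cases (1 - qf x)) => -[h' ->];
  have := qf_ge0 x; nra.
Qed.

Lemma measurable_bump : measurable_fun setT bump.
Proof.
apply: measurable_funX; apply: measurable_maxr => //.
apply: measurable_funB => //; apply: measurable_sum => i.
apply: measurable_funX; apply: measurable_funM => //.
by apply: measurable_funB => //; exact: rV_measurable_coord.
Qed.

Section increments.
Variables (x y : 'rV[R]_n).
Hypothesis xD : `|x - x0| <= rho.
Let tau : R := `|y - x| / rho.
Hypothesis tau1 : `|y - x| <= rho.

Let tau_ge0 : 0 <= tau. Proof. by rewrite divr_ge0// ltW. Qed.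
Let tau_le1 : tau <= 1. Proof. by rewrite ler_pdivrMr// mul1r. Qed.

Let a i : R := (x ord0 i - x0 ord0 i) / rho.
Let b i : R := (y ord0 i - x ord0 i) / rho.
(** [D] and [E] are the linear and the quadratic part of the increment of [qf]: passing from [y] to
    [x + x - y] changes the sign of [D] and preserves [E]. *)
Let D : R := \sum_(i < n) 2 * (a i * b i).
Let E : R := \sum_(i < n) b i ^+ 2.

Let a1 i : `|a i| <= 1.
Proof.
rewrite normrM normfV (gtr0_norm rho0) ler_pdivrMr// mul1r.
by apply: le_trans xD; have := rV_norm_coord (x - x0) i; rewrite !mxE.
Qed.

Let b1 i : `|b i| <= tau.
Proof.
rewrite normrM normfV (gtr0_norm rho0) ler_wpM2r ?invr_ge0 ?(ltW rho0)//.
by have := rV_norm_coord (y - x) i; rewrite !mxE.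
Qed.

Let D_le : `|D| <= 2 * n%:R * tau.
Proof.
apply: le_trans (ler_norm_sum _ _ _) _.
apply: (@le_trans _ _ (\sum_(i < n) 2 * tau)).
  apply: ler_sum => i _; rewrite normrM ger0_norm// ler_wpM2l//.
  by rewrite normrM -[leRHS]mul1r ler_pM.
by rewrite sumr_const card_ord -[leLHS]mulr_natl mulrA (mulrC 2).
Qed.

Let E_ge0 : 0 <= E. Proof. by apply: sumr_ge0 => i _; exact: sqr_ge0. Qed.

Let E_le : E <= n%:R * tau ^+ 2.
Proof.
apply: (@le_trans _ _ (\sum_(i < n) tau ^+ 2)).
  apply: ler_sum => i _; rewrite -[leLHS]real_normK ?num_real//.
  by rewrite lerXn2r ?nnegrE.
by rewrite sumr_const card_ord mulr_natl.
Qed.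

Let qfy : qf y = qf x + D + E.
Proof.
rewrite /qf /D /E -!big_split/=; apply: eq_bigr => i _; rewrite /a /b.
by field; rewrite gt_eqF.
Qed.

Let qfz : qf (x + x - y) = qf x - D + E.
Proof.
rewrite /qf /D /E -sumrB -big_split/=; apply: eq_bigr => i _; rewrite /a /b !mxE.
by field; rewrite gt_eqF.
Qed.

Let nn1 : (1 : R) <= n%:R. Proof. by rewrite ler1n. Qed.

Lemma bump_lipschitz : `|bump x - bump y| <= 6 * n%:R * tau.
Proof.
apply: le_trans (possq_lipschitz _ _) _; first by have := qf_ge0 x; lra.
  by have := qf_ge0 y; lra.
have -> : 1 - qf x - (1 - qf y) = D + E by rewrite qfy; ring.
have h := ler_normD D E.
have h2 : `|E| <= n%:R * tau.
  rewrite ger0_norm//; apply: (le_trans E_le).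
  by rewrite ler_wpM2l// expr2 ler_piMr.
have := D_le; lra.
Qed.

Lemma bump_reflect_lipschitz : `|bump x - bump (x + x - y)| <= 6 * n%:R * tau.
Proof.
apply: le_trans (possq_lipschitz _ _) _; first by have := qf_ge0 x; lra.
  by have := qf_ge0 (x + x - y); lra.
have -> : 1 - qf x - (1 - qf (x + x - y)) = - D + E by rewrite qfz; ring.
have h := ler_normD (- D) E; rewrite normrN in h.
have h2 : `|E| <= n%:R * tau.
  rewrite ger0_norm//; apply: (le_trans E_le).
  by rewrite ler_wpM2l// expr2 ler_piMr.
have := D_le; lra.
Qed.

(** Moving the base point from [1 - qf x] to [1 - qf x - E] makes the other two arguments symmetric
    about it, at distance [D]. The move costs a Lipschitz term of order [E], the symmetric
    difference is of order [D ^+ 2], and both are of order [tau ^+ 2]. *)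
Lemma bump_second_diff :
  `|(bump x - bump y) + (bump x - bump (x + x - y))| <= 12 * n%:R ^+ 2 * tau ^+ 2.
Proof.
have -> : (bump x - bump y) + (bump x - bump (x + x - y)) =
  2 * (possq (1 - qf x) - possq (1 - qf x - E)) -
  (possq (1 - qf x - E + D) + possq (1 - qf x - E - D) - 2 * possq (1 - qf x - E)).
  rewrite /bump qfy qfz.
  have -> : 1 - (qf x + D + E) = 1 - qf x - E - D by ring.
  have -> : 1 - (qf x - D + E) = 1 - qf x - E + D by ring.
  ring.
apply: le_trans (ler_normB _ _) _.
rewrite normrM (@ger0_norm _ 2)//.
have q0 := qf_ge0 x.
have h1 : `|possq (1 - qf x) - possq (1 - qf x - E)| <= 2 * (n%:R * tau ^+ 2).
  apply: le_trans (possq_lipschitz _ _) _; [lra| |].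
    by have := E_ge0; lra.
  by rewrite (_ : _ - _ - _ = E) ?ger0_norm ?ler_wpM2l//; ring.
have h2 := possq_second_diff (1 - qf x - E) D.
have h3 : D ^+ 2 <= 4 * n%:R ^+ 2 * tau ^+ 2.
  rewrite -[leLHS]real_normK ?num_real//.
  have -> : 4 * n%:R ^+ 2 * tau ^+ 2 = (2 * n%:R * tau) ^+ 2 by ring.
  rewrite lerXn2r ?nnegrE//.
  by rewrite mulr_ge0// mulr_ge0.
have h4 : n%:R * tau ^+ 2 <= n%:R ^+ 2 * tau ^+ 2.
  by rewrite ler_wpM2r ?sqr_ge0// expr2 ler_peMl.
lra.
Qed.

End increments.

Lemma norm_bump_diff_le1 x y : `|bump x - bump y| <= 1.
Proof.
rewrite ler_norml; have := bump_ge0 x; have := bump_ge0 y.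
by have := bump_le1 x; have := bump_le1 y => *; apply/andP; split; lra.
Qed.

End bump.

Lemma le_indicator_cover (R : realType) (b1 b2 : bool) (G : R) :
  0 <= G -> (~~ b1 -> ~~ b2 -> G = 0) -> G <= b1%:R * G + b2%:R * G.
Proof.
by case: b1 b2 => [] [] G0 h; rewrite ?mul1r ?mul0r ?addr0 ?add0r ?lerDl// h.
Qed.

(** Meant for a symmetric density that vanishes when both points lie outside a set: [g] is its
    restriction to pairs whose first point lies in the set. *)
Lemma ge0_integral_le_swap (R : realType) (n : nat)
    (f g : 'rV[R]_n * 'rV[R]_n -> R) :
  measurable_fun setT f -> measurable_fun setT g ->
  (forall z, 0 <= f z) -> (forall z, 0 <= g z) ->
  (forall z, f z <= g z + g (z.2, z.1)) ->
  (\int[lebesgue_measure_rV R n \x lebesgue_measure_rV R n]_z (f z)%:E <=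
   \int[lebesgue_measure_rV R n \x lebesgue_measure_rV R n]_z (g z)%:E +
   \int[lebesgue_measure_rV R n \x lebesgue_measure_rV R n]_z (g z)%:E)%E.
Proof.
move=> mf mg f0 g0 fg.
have mgs : measurable_fun setT (fun z => g (z.2, z.1)).
  by apply: (measurableT_comp mg); exact: measurable_fun_pair.
rewrite -[X in (_ + X)%E](ge0_integral_prod_swap (F := EFin \o g)); last 2 first.
- exact/measurable_EFinP.
- by move=> z; rewrite lee_fin.
rewrite -ge0_integralD//; last 4 first.
- by move=> z _; rewrite lee_fin.
- exact/measurable_EFinP.
- by move=> z _; rewrite lee_fin.
- exact/measurable_EFinP.
apply: ge0_le_integral => //.
- by move=> z _; rewrite lee_fin.
- exact/measurable_EFinP.
- by apply/measurable_EFinP; exact: measurable_funD.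
- by move=> z _; rewrite lee_fin.
Qed.

Section bump_energy.
Context {R : realType} {n : nat}.
Local Notation mu := (lebesgue_measure_rV R n).
Implicit Types (x y : 'rV[R]_n) (z : 'rV[R]_n * 'rV[R]_n).
Variables (s m : R).
Hypothesis n0 : (0 < n)%N.
Hypothesis s01 : 0 < s < 1.
Hypothesis m2 : 2 < m.

Let s0 : 0 < s. Proof. by case/andP: s01. Qed.
Let m0 : 0 < m. Proof. have := m2; lra. Qed.
Let sm0 : 0 < s * m. Proof. exact: mulr_gt0. Qed.
Let smm : s * m < m. Proof. by case/andP: s01 => _ s1; rewrite gtr_pMl. Qed.

Let nn1 : (1 : R) <= n%:R. Proof. by rewrite ler1n. Qed.

Lemma normr_Jfun_le1 (a : R) : `|a| <= 1 -> `|Jfun m a| <= 1.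
Proof.
move=> a1; rewrite normr_Jfun//.
have e : 1 `^ (m - 1) = 1 :> R by rewrite powR1.
by rewrite -[leRHS]e ge0_ler_powR ?nnegrE//; have := m2; lra.
Qed.

(** Up to symmetry the first point lies in the cube. Then the Lipschitz bound provides the factor
    [(|y - x| / rho) ^ m] near [x], increments of size at most [1] suffice far from it, and the cube
    has finite measure. *)
Lemma finite_gagliardo_bump x0 (rho : R) : 0 < rho ->
  finite_gagliardo s m (bump x0 rho).
Proof.
move=> r0; have [C [C0 HC]] := @kernel_integral_le R n s m sm0 smm.
set b := bump x0 rho; pose D := cube x0 rho.
have mb : measurable_fun setT b by exact: measurable_bump.
have mD : measurable D by exact: measurable_cube.
pose g := gagliardo_density s m b.
have mg : measurable_fun setT g by exact: measurable_gagliardo_density.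
have g0 z : 0 <= g z by exact: gagliardo_density_ge0.
pose g1 z := \1_D z.1 * g z.
have mg1 : measurable_fun setT g1.
  by apply: measurable_funM => //; apply: measurable_fst_comp; exact: measurable_indic.
have g10 z : 0 <= g1 z by rewrite mulr_ge0 ?ler0n.
have gout z : z.1 \notin D -> z.2 \notin D -> g z = 0.
  move=> /negP h1 /negP h2; rewrite /g /gagliardo_density /b.
  rewrite (bump_out r0); last first.
    by rewrite ltNge; apply/negP => h; apply: h1; rewrite inE.
  rewrite (bump_out r0); last first.
    by rewrite ltNge; apply/negP => h; apply: h2; rewrite inE.
  by rewrite subrr normr0 powR0 ?mul0r// gt_eqF.
have gle z : g z <= g1 z + g1 (z.2, z.1).
  have gC : g (z.2, z.1) = g z.
    by rewrite /g /gagliardo_density /= distrC kernelC.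
  rewrite /g1 gC; move: (g0 z) (gout z) => /=; move: (g z) => G G0.
  rewrite !indicE; exact: le_indicator_cover.
have ig1 : (\int[mu \x mu]_z (g1 z)%:E < +oo)%E.
  have mEg1 : measurable_fun setT (EFin \o g1) by exact/measurable_EFinP.
  rewrite (fubini_tonelli1 (EFin \o g1))//.
  pose A : R := (6 * n%:R) `^ m.
  have A1 : 1 <= A.
    by rewrite -[leLHS](powRr0 (6 * n%:R)) ler_powR ?(ltW m0)//; have := nn1; lra.
  apply: (@le_lt_trans _ _ (\int[mu]_x ((A * C / rho `^ (s * m))%:E * (\1_D x)%:E))%E).
    apply: ge0_le_integral => //.
    - by move=> x _; apply: integral_ge0 => y _; rewrite lee_fin.
    - exact: measurable_fun_fubini_tonelli_F.
    - by apply/measurable_EFinP/measurable_funM => //; exact: measurable_indic.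
    - move=> x _; rewrite /fubini_F /g1 /=.
      rewrite indicE; case: (boolP (x \in D)) => [/set_mem xD|_]; last first.
        by under eq_integral do rewrite mul0r; rewrite integral0 mule0.
      rewrite mule1; under eq_integral do rewrite mul1r.
      apply: (HC x).
      + exact: r0.
      + exact: le_trans A1.
      + by apply: (measurableT_comp mg); exact: pair1_measurable.
      + by move=> y; exact: g0.
      + move=> y yx; rewrite /g /gagliardo_density /= ler_wpM2r ?kernel_ge0//.
        rewrite /A -powRM ?mulr_ge0 ?invr_ge0 ?(ltW r0)//.
        rewrite ge0_ler_powR ?nnegrE ?mulr_ge0 ?invr_ge0 ?(ltW r0) ?(ltW m0)//.
        exact: bump_lipschitz.
      + move=> y yx; rewrite /g /gagliardo_density /= ler_wpM2r ?kernel_ge0//.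
        apply: le_trans A1; have e : 1 `^ m = 1 :> R by rewrite powR1.
        rewrite -[leRHS]e ge0_ler_powR ?nnegrE ?(ltW m0)//.
        exact: norm_bump_diff_le1.
  rewrite ge0_integralZl_EFin//; last 2 first.
  - by apply/measurable_EFinP; exact: measurable_indic.
  - by rewrite divr_ge0 ?powR_ge0// mulr_ge0 ?(ltW C0)// (le_trans _ A1).
  rewrite integral_indic// setIT lte_mul_pinfty ?lee_fin//.
    by rewrite divr_ge0 ?powR_ge0// mulr_ge0 ?(ltW C0)// (le_trans _ A1).
  by rewrite [ltLHS]measure_cube ?ltry// ltW.
apply: le_lt_trans (ge0_integral_le_swap mg mg1 g0 g10 gle) _.
by apply: lte_add_pinfty; exact: ig1.
Qed.

End bump_energy.

(** * Principal values through truncation and reflection *)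

Section antisymmetric_integrals.
Context {R : realType} {n : nat}.
Local Notation mu := (lebesgue_measure_rV R n).
Local Notation V := 'rV[R]_n.

(* Averaging over the reflection [y |-> c - y] plays the role of the principal
   value: only [G y + G (c - y)] has to be absolutely integrable. *)
Lemma integral_le_symmetrized (c : V) (G h : V -> R) (K : \bar R) :
  mu.-integrable setT (EFin \o G) -> measurable_fun setT h ->
  (forall y, `|G y + G (c - y)| <= h y) -> (\int[mu]_y (h y)%:E <= K)%E ->
  (0 <= K)%E -> (\int[mu]_y (G y)%:E <= K)%E.
Proof.
move=> iG mh Gh hK K0.
have mG : measurable_fun setT G by apply/measurable_EFinP; exact: measurable_int iG.
have mGc : measurable_fun setT (fun y : V => G (c - y)).
  by apply: (measurableT_comp mG); exact: measurable_reflect_rV.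
have iGc : mu.-integrable setT (fun y : V => (G (c - y))%:E).
  apply/integrableP; split; first exact/measurable_EFinP.
  have := @integral_reflect R n c (fun y : V => `|(G y)%:E|%E).
  move=> /(_ _)/=; rewrite /= => ->.
    by case/integrableP : iG.
  exact/measurable_EFinP/measurable_fun_normr.
have E : (\int[mu]_y (G y)%:E + \int[mu]_y (G y)%:E <= K)%E.
  rewrite -[X in (_ + X)%E](@integral_reflect R n c (EFin \o G)); last first.
    exact/measurable_EFinP.
  rewrite -integralD//; apply: le_trans hK.
  apply: (@le_trans _ _ (\int[mu]_y `|(G y)%:E + (G (c - y)%R)%:E|)%E).
    apply: le_integral => //.
    - exact: integrableD.
    - by apply: integrable_abse; exact: integrableD.
    - by move=> y _; rewrite lee_abs.
  apply: ge0_le_integral => //.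
  - by apply: measurableT_comp => //; apply: emeasurable_funD; exact/measurable_EFinP.
  - exact/measurable_EFinP.
  - by move=> y _; rewrite -EFinD lee_fin.
case: (leP 0%E (\int[mu]_y (G y)%:E)%E) => [i0|/ltW i0]; last exact: le_trans K0.
by apply: le_trans E; rewrite leeDl.
Qed.

(** The passage from the weak to the pointwise form of an operator: by antisymmetry the two halves
    of the double integral agree, and Fubini leaves [eta x] times the inner integral. [B] gives the
    absolute convergence behind Fubini and may be huge; the one-sided bound [K] is what enters the
    estimate. *)
Lemma integral_antisymmetric_le (G : V * V -> R) (eta : V -> R) (B K : R) :
  measurable_fun setT G -> (forall z, G (z.2, z.1) = - G z) ->
  mu.-integrable setT (EFin \o eta) -> (forall x, 0 <= eta x) -> 0 <= B -> 0 <= K ->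
  (forall x, \int[mu]_y `|(G (x, y))%:E| <= B%:E)%E ->
  (forall x, eta x != 0 -> (\int[mu]_y (G (x, y))%:E <= K%:E)%E) ->
  (\int[mu \x mu]_z ((eta z.1 - eta z.2) * G z)%:E <=
    (2 * K)%:E * \int[mu]_x (eta x)%:E)%E.
Proof.
move=> mG Ganti ieta eta0 B0 K0 GB GK.
have meta : measurable_fun setT eta.
  by apply/measurable_EFinP; exact: measurable_int ieta.
pose H z := eta z.1 * G z.
have mH : measurable_fun setT H.
  by apply: measurable_funM => //; exact: measurable_fst_comp.
have mGx x : measurable_fun setT (fun y => G (x, y)).
  by apply: (measurableT_comp mG); exact: pair1_measurable.
have iGx x : mu.-integrable setT (fun y => (G (x, y))%:E).
  apply/integrableP; split; first exact/measurable_EFinP.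
  by apply: le_lt_trans (GB x) _; rewrite ltry.
have iH : (mu \x mu)%E.-integrable setT (EFin \o H).
  have mEH : measurable_fun setT (EFin \o H) by exact/measurable_EFinP.
  apply: (integrable12ltyP _ _ mEH).2.
  apply: (@le_lt_trans _ _ (\int[mu]_x (B%:E * (eta x)%:E))%E).
    apply: ge0_le_integral => //.
    - by move=> x _; apply: integral_ge0.
    - apply: (measurable_fun_fubini_tonelli_F (fun z => `|(H z)%:E|%E)) => //.
      exact/measurable_EFinP/measurable_fun_normr.
    - by apply/measurable_EFinP; exact: measurable_funM.
    - move=> x _; rewrite /H /=.
      under eq_integral do rewrite normrM (ger0_norm (eta0 x)) EFinM.
      rewrite ge0_integralZl_EFin//; last first.
        exact/measurable_EFinP/measurable_fun_normr.
      by rewrite muleC lee_wpmul2r ?lee_fin//; exact: GB.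
  rewrite ge0_integralZl_EFin//; last 2 first.
  - by move=> x _; rewrite lee_fin.
  - exact/measurable_EFinP.
  apply: lte_mul_pinfty; rewrite ?lee_fin//.
  by apply: integrable_lty.
have iHs : (mu \x mu)%E.-integrable setT (fun z => (H (z.2, z.1))%:E).
  apply/integrableP; split.
    apply/measurable_EFinP; apply: (measurableT_comp mH).
    exact: measurable_fun_pair.
  rewrite (integral_prod_swap (F := fun z => `|(H z)%:E|%E)); last first.
    exact/measurable_EFinP/measurable_fun_normr.
  by case/integrableP : iH.
rewrite (eq_integral (fun z => (H z)%:E + (H (z.2, z.1))%:E)%E); last first.
  move=> z _; rewrite -EFinD /H /= Ganti; congr EFin; ring.
rewrite integralD//.
rewrite (integral_prod_swap (F := EFin \o H)); last exact/measurable_EFinP.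
suff h : (\int[mu \x mu]_z (H z)%:E <= K%:E * \int[mu]_x (eta x)%:E)%E.
  rewrite mulr_natl mulr2n EFinD ge0_muleDl ?lee_fin//.
  by apply: leeD; exact: h.
rewrite -(integral12_prod_meas1 iH) /fubini_F /= -integralZl//.
apply: le_integral => //.
- exact: (integrable_fubini_F iH).
- exact: integrableZl.
- move=> x _; rewrite /H /=.
  under eq_integral do rewrite EFinM.
  rewrite integralZl//; have [->|ex] := eqVneq (eta x) 0; first by rewrite mul0e mule0.
  by rewrite muleC lee_wpmul2r ?lee_fin//; exact: GK.
Qed.

(** Dominated convergence with dominating function [|e|]. Away from the diagonal the kernel is
    harmless, so estimates may be proved for each truncation, provided that [M] does not depend on
    [k]. *)
Lemma integral_le_truncated (e : V * V -> R) (M : R) :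
  (mu \x mu)%E.-integrable setT (EFin \o e) ->
  (forall x, e (x, x) = 0) ->
  (forall k : nat, \int[mu \x mu]_z (e z * \1_[set z | k.+1%:R^-1 < `|z.1 - z.2|] z)%:E <= M%:E)%E ->
  (\int[mu \x mu]_z (e z)%:E <= M%:E)%E.
Proof.
move=> ie ediag eM.
have me : measurable_fun setT e by apply/measurable_EFinP; exact: measurable_int ie.
pose S (k : nat) : set (V * V) := [set z | k.+1%:R^-1 < `|z.1 - z.2|].
have mS k : measurable (S k).
  have mh : measurable_fun setT (fun z : V * V => `|z.1 - z.2|).
    apply: (measurableT_comp measurable_rV_norm).
    exact: measurable_rVB.
  have -> : S k = setT `&` (fun z : V * V => `|z.1 - z.2|) @^-1` `]k.+1%:R^-1, +oo[.
    by rewrite setTI; apply/seteqP; split => z; rewrite /S /= in_itv/= andbT.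
  exact: mh.
have mek k : measurable_fun setT (fun z => e z * \1_(S k) z).
  by apply: measurable_funM => //; exact: measurable_indic.
have [|||||_ _] := @dominated_convergence _ _ _ (mu \x mu)%E setT measurableT
  (fun k z => (e z * \1_(S k) z)%:E) (EFin \o e) (fun z => `|(e z)%:E|%E).
- by move=> k; exact/measurable_EFinP.
- exact/measurable_EFinP.
- apply: aeW => -[x y] _ /=; have [->|xy] := eqVneq x y.
    by apply: cvg_near_cst; apply: nearW => k; rewrite ediag mul0r.
  have h0 : 0 < `|x - y| by rewrite normr_gt0 subr_eq0.
  apply: cvg_near_cst.
  near=> k; rewrite indicE mem_set ?mulr1// /S /=.
  near: k; exact: near_infty_natSinv_lt (PosNum h0).
- exact: integrable_abse.
- by apply: aeW => z k _; rewrite lee_fin normrM ler_piMr// indicE; case: (_ \in _);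
    rewrite ?normr1 ?normr0.
move=> cv; rewrite -(cvg_lim _ cv)//; apply: lime_le; first exact: cvgP cv.
by apply: nearW => k; exact: eM.
Unshelve. all: by end_near. Qed.

End antisymmetric_integrals.

Section bump_energy_bound.
Context {R : realType} {n : nat}.
Local Notation mu := (lebesgue_measure_rV R n).
Local Notation V := 'rV[R]_n.
Implicit Types (x y : V).
Variables (s m : R).
Hypothesis n0 : (0 < n)%N.
Hypothesis s01 : 0 < s < 1.
Hypothesis m2 : 2 < m.

Let s0 : 0 < s. Proof. by case/andP: s01. Qed.
Let m0 : 0 < m. Proof. by have := m2; lra. Qed.
Let sm0 : 0 < s * m. Proof. exact: mulr_gt0. Qed.
Let smm : s * m < m. Proof. by case/andP: s01 => _ s1; rewrite gtr_pMl. Qed.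
Let nn1 : (1 : R) <= n%:R. Proof. by rewrite ler1n. Qed.

(** The sum is [Jfun m a - Jfun m (- b)]. Both arguments are of order [tau], so the Lipschitz
    constant of [Jfun] is of order [tau ^ (m - 2)]; the second difference [a + b] is of order
    [tau ^+ 2], and the product is of order [tau ^ m]. *)
Lemma Jfun_bump_reflect_le (x0 : V) (rho : R) x y : 0 < rho ->
  `|x - x0| <= rho -> `|y - x| <= rho ->
  `|Jfun m (bump x0 rho x - bump x0 rho y) +
    Jfun m (bump x0 rho x - bump x0 rho (x + x - y))| <=
  (m - 1) * (6 * n%:R) `^ (m - 2) * (12 * n%:R ^+ 2) * (`|y - x| / rho) `^ m.
Proof.
move=> r0 xD yx.
set a := bump x0 rho x - _; set b := bump x0 rho x - _.
set tau := `|y - x| / rho.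
have tau0 : 0 <= tau by rewrite divr_ge0// ltW.
have M0 : 0 <= 6 * n%:R * tau :> R by rewrite mulr_ge0// mulr_ge0.
rewrite -[X in _ + X]opprK -JfunN.
apply: le_trans (Jfun_lipschitz m2 (M := 6 * n%:R * tau) _ _) _.
- exact: bump_lipschitz.
- by rewrite normrN; exact: bump_reflect_lipschitz.
rewrite opprK [(6 * n%:R * tau) `^ _]powRM//.
have -> : tau `^ m = tau `^ (m - 2) * tau ^+ 2.
  rewrite -powR_mulrn// -powRD; first by congr (_ `^ _); ring.
  apply/implyP => /eqP h; have := m2; lra.
have m1 : 0 <= m - 1 by have := m2; lra.
have -> : (m - 1) * (6 * n%:R) `^ (m - 2) * (12 * n%:R ^+ 2) *
  (tau `^ (m - 2) * tau ^+ 2) =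
  (m - 1) * ((6 * n%:R) `^ (m - 2) * tau `^ (m - 2)) *
    (12 * n%:R ^+ 2 * tau ^+ 2) by ring.
apply: ler_wpM2l; last exact: bump_second_diff.
by rewrite mulr_ge0// mulr_ge0 ?powR_ge0.
Qed.

(** In weak form, an upper bound for the fractional [m]-Laplacian of the bump on its cube. The
    reflection [y |-> x + x - y] preserves both the kernel and the truncation at [S], so the
    symmetrised inner integral can be bounded uniformly in [k]. *)
Lemma energy_bump_le : exists C, 0 < C /\
  forall (x0 : V) (rho : R) (eta : V -> R), 0 < rho ->
  mu.-integrable setT (EFin \o eta) -> (forall x, 0 <= eta x) ->
  (forall x, rho < `|x - x0| -> eta x = 0) -> finite_gagliardo s m eta ->
  (\int[mu \x mu]_z (energy_density s m (bump x0 rho) eta z)%:E <=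
    (C / rho `^ (s * m))%:E * \int[mu]_x (eta x)%:E)%E.
Proof.
have [C [C0 HC]] := @kernel_integral_le R n s m sm0 smm.
(* The first summand of [A] bounds second differences near [x] (this needs
   [2 < m]), the second one is the trivial bound away from [x]. *)
pose A : R := (m - 1) * (6 * n%:R) `^ (m - 2) * (12 * n%:R ^+ 2) + 2.
have A20 : 0 <= (m - 1) * (6 * n%:R) `^ (m - 2) * (12 * n%:R ^+ 2).
  rewrite mulr_ge0// mulr_ge0 ?powR_ge0//; have := m2; lra.
have A0 : 0 < A by rewrite /A ltr_wpDl.
exists (2 * (A * C)); split; first by rewrite !mulr_gt0.
move=> x0 rho eta r0 ieta eta0 etaD geta.
have meta : measurable_fun setT eta.
  by apply/measurable_EFinP; exact: measurable_int ieta.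
set b := bump x0 rho.
have mb : measurable_fun setT b by exact: measurable_bump.
have fin_eta := integrable_fin_num measurableT ieta.
rewrite -(fineK fin_eta) -EFinM; apply: integral_le_truncated.
- have gb := finite_gagliardo_bump n0 s01 m2 x0 r0.
  exact: (integrable_energy_density m2 mb meta gb geta).
- by move=> x; rewrite /energy_density /= subrr Jfun0 !mul0r.
move=> k; set S : set (V * V) := [set z | _].
have mS : measurable S.
  have mh : measurable_fun setT (fun z : V * V => `|z.1 - z.2|).
    apply: (measurableT_comp measurable_rV_norm).
    exact: measurable_rVB.
  have -> : S = setT `&` (fun z : V * V => `|z.1 - z.2|) @^-1` `]k.+1%:R^-1, +oo[.
    by rewrite setTI; apply/seteqP; split => z; rewrite /S /= in_itv/= andbT.
  exact: mh.
have SC z : \1_S (z.2, z.1) = \1_S z :> R.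
  by rewrite !indicE; congr (_%:R); congr nat_of_bool; apply/idP/idP;
    rewrite !inE /S /= distrC.
pose G z : R := Jfun m (b z.1 - b z.2) * kernel s m (z.1 - z.2) * \1_S z.
have mG : measurable_fun setT G.
  apply: measurable_funM; last exact: measurable_indic.
  apply: measurable_funM; last exact: measurable_kernel_diff.
  by apply: measurable_fun_Jfun; exact: measurable_diff_comp.
have Ganti z : G (z.2, z.1) = - G z.
  by rewrite /G SC /= -opprB JfunN kernelC !mulNr.
have kr : 0 < (k.+1%:R : R)^-1 by rewrite invr_gt0.
pose K := A * C / rho `^ (s * m).
have K0 : 0 <= K by rewrite divr_ge0 ?powR_ge0// mulr_ge0// ltW.
have Jb1 x y : `|Jfun m (b x - b y)| <= 1.
  by apply: normr_Jfun_le1 => //; exact: norm_bump_diff_le1.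
have i01 z : (0 <= (\1_S z : R)) && ((\1_S z : R) <= 1).
  by rewrite indicE ler0n lern1; case: (_ \in _).
have mGx x : measurable_fun setT (fun y => G (x, y)).
  by apply: (measurableT_comp mG); exact: pair1_measurable.
have Gle x y : `|G (x, y)| <= `|Jfun m (b x - b y)| * kernel s m (x - y).
  rewrite /G normrM normrM (ger0_norm (kernel_ge0 _ _ _)) /=.
  have /andP[h1 h2] := i01 (x, y).
  by rewrite (ger0_norm h1) ler_piMr// mulr_ge0 ?kernel_ge0.
(* This bound blows up as [k] grows and serves only for absolute convergence; the uniform bound is
   [GK]. *)
have GB x : (\int[mu]_y `|(G (x, y))%:E| <= (1 * C / k.+1%:R^-1 `^ (s * m))%:E)%E.
  apply: (HC x k.+1%:R^-1 1 (fun y => `|G (x, y)|)) => //.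
  - exact: measurable_fun_normr.
  - move=> y yx; rewrite /G indicE memNset ?mulr0 ?normr0.
      by rewrite mul1r mulr_ge0 ?kernel_ge0 ?powR_ge0.
    by rewrite /S /= distrC => /(le_lt_trans yx); rewrite ltxx.
  - move=> y _; apply: (le_trans (Gle x y)).
    by rewrite ler_wpM2r ?kernel_ge0.
have iGx x : mu.-integrable setT (EFin \o (fun y => G (x, y))).
  apply/integrableP; split; first exact/measurable_EFinP.
  by apply: le_lt_trans (GB x) _; rewrite ltry.
have GK x : eta x != 0 -> (\int[mu]_y (G (x, y))%:E <= K%:E)%E.
  move=> ex; have xD : `|x - x0| <= rho.
    by rewrite leNgt; apply/negP => /etaD h; rewrite h eqxx in ex.
  pose h y := `|G (x, y) + G (x, x + x - y)|.
  have mh : measurable_fun setT h.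
    apply: measurable_fun_normr; apply: measurable_funD => //.
    by apply: (measurableT_comp (mGx x)); exact: measurable_reflect_rV.
  apply: (@integral_le_symmetrized R n (x + x) (fun y => G (x, y)) h) => //.
  have hE y : h y <= `|Jfun m (b x - b y) + Jfun m (b x - b (x + x - y))| *
      kernel s m (x - y).
    rewrite /h /G /=.
    have e : x - (x + x - y) = - (x - y) by apply/rowP => i; rewrite !mxE; ring.
    have -> : \1_S (x, x + x - y) = \1_S (x, y) :> R.
      rewrite !indicE; congr (_%:R); congr nat_of_bool; apply/idP/idP;
        by rewrite !inE /S /= e normrN.
    rewrite e kernelN -!mulrDl normrM normrM (ger0_norm (kernel_ge0 _ _ _)).
    have /andP[h1 h2] := i01 (x, y).
    by rewrite (ger0_norm h1) ler_piMr// mulr_ge0 ?kernel_ge0.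
  apply: (HC x rho A h); [exact: r0|exact: ltW|exact: mh|by move=> y; exact: normr_ge0| |].
  - move=> y yx; apply: (le_trans (hE y)).
    apply: ler_wpM2r; first exact: kernel_ge0.
    apply: le_trans (Jfun_bump_reflect_le r0 xD yx) _.
    by apply: ler_wpM2r; [exact: powR_ge0|rewrite /A lerDl].
  - move=> y yx; apply: (le_trans (hE y)).
    apply: ler_wpM2r; first exact: kernel_ge0.
    apply: (le_trans (ler_normD _ _)).
    apply: (@le_trans _ _ (1 + 1)); first by apply: lerD; exact: Jb1.
    by rewrite /A; move: A20; lra.
rewrite (eq_integral (fun z => ((eta z.1 - eta z.2) * G z)%:E)); last first.
  by move=> z _; congr EFin; rewrite /energy_density /G; ring.
apply: le_trans (integral_antisymmetric_le mG Ganti ieta eta0 _ K0 GB GK) _.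
  by rewrite mul1r divr_ge0 ?powR_ge0// ltW.
by rewrite -{1}(fineK fin_eta) -EFinM lee_fin /K mulrA !mulrA.
Qed.

End bump_energy_bound.

(** * Barriers *)

Section product_tools.
Context {R : realType} {n : nat}.
Local Notation mu := (lebesgue_measure_rV R n).
Local Notation V := 'rV[R]_n.

Lemma ae_le_integral d (T : measurableType d) (nu : {measure set T -> \bar R})
    (f g : T -> R) :
  nu.-integrable setT (EFin \o f) -> nu.-integrable setT (EFin \o g) ->
  {ae nu, forall x, f x <= g x} ->
  (\int[nu]_x (f x)%:E <= \int[nu]_x (g x)%:E)%E.
Proof.
move=> iF iG fg.
have mf : measurable_fun setT f by apply/measurable_EFinP; exact: measurable_int iF.
have mg : measurable_fun setT g by apply/measurable_EFinP; exact: measurable_int iG.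
have mh : measurable_fun setT (f \max g) by exact: measurable_maxr.
(* [f \max g] equals [g] almost everywhere and dominates [f] everywhere, so pointwise monotonicity
   of the integral applies. *)
rewrite (_ : \int[nu]_x (g x)%:E = \int[nu]_x ((f \max g) x)%:E)%E; last first.
  apply: ae_eq_integral => //; [exact/measurable_EFinP|exact/measurable_EFinP|].
  by apply: filterS fg => x h _ /=; congr EFin; rewrite max_r.
apply: le_integral => //.
- apply: (le_integrable measurableT _ _
    (integrableD measurableT (integrable_abse iF) (integrable_abse iG))).
    exact/measurable_EFinP.
  move=> x _ /=; rewrite lee_fin [leRHS]ger0_norm ?addr_ge0//.
  by case: (leP (f x) (g x)) => _; rewrite ?lerDl ?lerDr.
- by move=> x _ /=; rewrite lee_fin le_max lexx.
Qed.

Lemma ae_prod_pair (P : V -> Prop) : {ae mu, forall x, P x} ->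
  {ae (mu \x mu)%E, forall z : V * V, P z.1 /\ P z.2}.
Proof.
move=> [N [mN N0 PN]].
exists ((N `*` setT) `|` (setT `*` N)); split.
- by apply: measurableU; exact: measurableX.
- apply: null_set_setU.
  + exact: measurableX.
  + exact: measurableX.
  + by rewrite [LHS]product_measure1E// [X in (X * _)%E]N0 mul0e.
  + by rewrite [LHS]product_measure1E// [X in (_ * X)%E]N0 mule0.
- move=> [x y] /= /not_andP[h|h]; [left|right]; split => //=; exact: PN.
Qed.

Lemma integrable_tensor (f g : V -> R) :
  mu.-integrable setT (EFin \o f) -> mu.-integrable setT (EFin \o g) ->
  (mu \x mu)%E.-integrable setT (fun z : V * V => (f z.1 * g z.2)%:E).
Proof.
move=> iF iG.
have mf : measurable_fun setT f by apply/measurable_EFinP; exact: measurable_int iF.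
have mg : measurable_fun setT g by apply/measurable_EFinP; exact: measurable_int iG.
have mfg : measurable_fun setT (fun z : V * V => (f z.1 * g z.2)%:E).
  apply/measurable_EFinP; apply: measurable_funM.
    exact: measurable_fst_comp.
  exact: measurable_snd_comp.
apply: (integrable12ltyP _ _ mfg).2 => /=.
have E x : (\int[mu]_y `|f x * g y|%:E = (`|f x|)%:E * \int[mu]_y `|g y|%:E)%E.
  under eq_integral do rewrite normrM EFinM.
  rewrite ge0_integralZl_EFin//.
  exact/measurable_EFinP/measurable_fun_normr.
under eq_integral do rewrite E.
have gfin : (\int[mu]_y `|g y|%:E < +oo)%E by case/integrableP : iG.
have gge : (0 <= \int[mu]_y `|g y|%:E)%E by exact: integral_ge0.
rewrite ge0_integralZr//; last first.
  exact/measurable_EFinP/measurable_fun_normr.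
rewrite muleC -(@fineK _ (\int[mu]_y `|g y|%:E)%E) ?ge0_fin_numE//.
apply: lte_mul_pinfty => //; first by rewrite lee_fin fine_ge0.
by case/integrableP : iF.
Qed.

Lemma integral_tensor (f g : V -> R) :
  mu.-integrable setT (EFin \o f) -> mu.-integrable setT (EFin \o g) ->
  (\int[mu \x mu]_z (f z.1 * g z.2)%:E =
   \int[mu]_x (f x)%:E * \int[mu]_x (g x)%:E)%E.
Proof.
move=> iF iG.
rewrite -(integral12_prod_meas1 (integrable_tensor iF iG)) /fubini_F /=.
have gfin := integrable_fin_num measurableT iG.
have E x : (\int[mu]_y (f x * g y)%:E = (f x)%:E * \int[mu]_y (g y)%:E)%E.
  under eq_integral do rewrite EFinM.
  by rewrite integralZl.
under eq_integral do rewrite E.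
by rewrite -(fineK gfin) integralZr.
Qed.

Lemma integrable_prod_swap (F : V * V -> \bar R) :
  (mu \x mu)%E.-integrable setT F ->
  (mu \x mu)%E.-integrable setT (fun z => F (z.2, z.1)).
Proof.
move=> iF; have mF := measurable_int _ iF; apply/integrableP; split.
  by apply: (measurableT_comp mF); exact: measurable_fun_pair.
rewrite (integral_prod_swap (F := fun z => `|F z|%E)).
  by case/integrableP : iF.
exact: measurableT_comp mF.
Qed.

Lemma integral_le_tensor (e f : V * V -> R) (eta beta : V -> R) :
  (mu \x mu)%E.-integrable setT (EFin \o e) ->
  (mu \x mu)%E.-integrable setT (EFin \o f) ->
  mu.-integrable setT (EFin \o eta) -> mu.-integrable setT (EFin \o beta) ->
  {ae (mu \x mu)%E, forall z : V * V,
     e z <= f z + (eta z.1 * beta z.2 + eta z.2 * beta z.1)} ->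
  (\int[mu \x mu]_z (e z)%:E <= \int[mu \x mu]_z (f z)%:E +
    (\int[mu]_x (eta x)%:E * \int[mu]_x (beta x)%:E +
     \int[mu]_x (eta x)%:E * \int[mu]_x (beta x)%:E))%E.
Proof.
move=> ie iF ieta ibeta h.
have iT := integrable_tensor ieta ibeta.
have iTs := integrable_prod_swap iT.
have iTT := integrableD measurableT iT iTs.
apply: le_trans (ae_le_integral ie (integrableD measurableT iF iTT) h) _.
rewrite (integralD measurableT iF iTT) (integralD measurableT iT iTs).
rewrite (integral_prod_swap (F := fun z => (eta z.1 * beta z.2)%:E)).
  by rewrite (integral_tensor ieta ibeta).
exact: measurable_int iT.
Qed.

Implicit Types f eta : V -> R.

Lemma JfunZ (m c t : R) : 2 < m -> 0 <= c ->
  Jfun m (c * t) = c `^ (m - 1) * Jfun m t.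
Proof.
move=> m2 c0; rewrite /Jfun normrM (ger0_norm c0) powRM//.
have -> : c `^ (m - 1) = c `^ (m - 2) * c.
  by rewrite -[RHS]mulrC (_ : m - 2 = (m - 1) - 1) ?mulr_powRB1//; lra.
ring.
Qed.

Lemma energy_densityZ s (m c : R) f eta z : 2 < m -> 0 <= c ->
  energy_density s m (fun x => c * f x) eta z =
  c `^ (m - 1) * energy_density s m f eta z.
Proof.
by move=> m2 c0; rewrite /energy_density -mulrBr JfunZ// !mulrA.
Qed.

Lemma finite_gagliardoZ s (m c : R) f : measurable_fun setT f ->
  finite_gagliardo s m f -> finite_gagliardo s m (fun x => c * f x).
Proof.
move=> mf ff.
have E z : (gagliardo_density s m (fun x => c * f x) z)%:E =
    ((`|c| `^ m)%:E * (gagliardo_density s m f z)%:E)%E.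
  by rewrite /gagliardo_density -mulrBr normrM powRM// -EFinM mulrA.
rewrite /finite_gagliardo; under eq_integral do rewrite E.
rewrite ge0_integralZl_EFin; last 4 first.
- exact: measurableT.
- by move=> z _; rewrite lee_fin gagliardo_density_ge0.
- by apply/measurable_EFinP; exact: measurable_gagliardo_density.
- exact: powR_ge0.
by apply: lte_mul_pinfty; [rewrite lee_fin powR_ge0| |exact: ff].
Qed.

Lemma energy_densityC s (m : R) f eta x y :
  energy_density s m f eta (x, y) = energy_density s m f eta (y, x).
Proof.
rewrite /energy_density /= kernelC -(opprB (f y)) JfunN.
by rewrite -(opprB (eta y)) mulrNN.
Qed.

Lemma normr_max_sub_le (a b c d : R) :
  `|Num.max a b - Num.max c d| <= `|a - c| + `|b - d|.
Proof.
have h1 := ler_norm (a - c); have h2 := ler_norm (b - d).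
have h3 := ler_norm (- (a - c)); have h4 := ler_norm (- (b - d)).
rewrite !normrN in h3 h4; rewrite ler_norml.
case: (leP a b) => ab; case: (leP c d) => cd; apply/andP; split;
  have := normr_ge0 (a - c); have := normr_ge0 (b - d); lra.
Qed.

End product_tools.

Section barrier_pointwise.
Context {R : realType} {n : nat}.
Local Notation mu := (lebesgue_measure_rV R n).
Local Notation V := 'rV[R]_n.
Implicit Types (x y : V).
Variables (s m : R) (x0 : V) (r omega delta : R) (v : V -> R).
Hypothesis n0 : (0 < n)%N.
Hypothesis s01 : 0 < s < 1.
Hypothesis m2 : 2 < m.
Hypothesis r0 : 0 < r.
Hypothesis omega0 : 0 < omega.
Hypothesis delta0 : 0 < delta.
Hypothesis delta4 : delta <= 4^-1.

Let s0 : 0 < s. Proof. by case/andP: s01. Qed.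
Let m0 : 0 < m. Proof. by have := m2; lra. Qed.
Let m1 : 0 < m - 1. Proof. by have := m2; lra. Qed.
Let sm0 : 0 < s * m. Proof. exact: mulr_gt0. Qed.
Let nsm0 : 0 < n%:R + s * m. Proof. by rewrite ltr_wpDl. Qed.
(** With a quarter of [r], points of the inner cube keep distance at least [3/4 * |y - x0|] from any
    [y] outside the large cube (hence the factor [4 / 3] in [tail_cost]), and the inner cube takes
    at most a quarter of the volume. *)
Let rho : R := r / 4.
Let rho0 : 0 < rho. Proof. exact: divr_gt0. Qed.
Let do0 : 0 < delta * omega. Proof. exact: mulr_gt0. Qed.

Definition barrier x : R := delta * omega * bump x0 rho x.
Definition barrier_gap x : R := Num.max (barrier x - Num.max (v x) 0) 0.
(* [gain] and [tail_cost] bound, per unit of [eta x], the interaction of [x]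
   with the set where [v] is large and with the complement of the cube, where
   an [admissible] [v] may be negative but grows slower than the kernel
   decays. *)
Definition gain_set : set V :=
  [set y | `|y - x0| <= r /\ rho < `|y - x0| /\ omega / 2 <= v y].
Definition gain y : R :=
  (omega / 4) `^ (m - 1) / (n%:R * (2 * r)) `^ (n%:R + s * m) * \1_gain_set y.
Definition tail_cost y : R :=
  (2 * (delta * omega)) `^ (m - 1) * (4 / 3) `^ (n%:R + s * m) *
  ((`|y - x0| / r) `^ (s * (m - 1)) / `|y - x0| `^ (n%:R + s * m)) *
  \1_(~` cube x0 r) y.
Definition admissible x : Prop :=
  (`|x - x0| <= r -> 0 <= v x) /\
  (r < `|x - x0| -> - (delta * omega * (`|x - x0| / r) `^ s) <= v x).

Let psi := barrier.
Let eta := barrier_gap.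

Lemma barrier_ge0 x : 0 <= psi x.
Proof. by rewrite mulr_ge0 ?bump_ge0// ltW. Qed.

Lemma barrier_le x : psi x <= delta * omega.
Proof. by rewrite /psi /barrier ler_piMr ?bump_le1// ltW. Qed.

Lemma barrier_out x : rho < `|x - x0| -> psi x = 0.
Proof. by move=> h; rewrite /psi /barrier bump_out ?mulr0. Qed.

Lemma barrier_gap_ge0 x : 0 <= eta x.
Proof. by rewrite /eta /barrier_gap le_max lexx orbT. Qed.

Lemma barrier_gap_le x : eta x <= psi x.
Proof.
have := barrier_ge0 x; rewrite /eta /barrier_gap ge_max => -> /=.
by rewrite andbT gerBl le_max lexx orbT.
Qed.

Lemma barrier_gap_out x : rho < `|x - x0| -> eta x = 0.
Proof.
move=> h; apply/eqP; rewrite eq_le barrier_gap_ge0 andbT.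
by rewrite (le_trans (barrier_gap_le x))// barrier_out.
Qed.

Lemma barrier_gap_gt0 x : admissible x -> 0 < eta x ->
  [/\ `|x - x0| <= rho, 0 <= v x, v x < psi x & eta x = psi x - v x].
Proof.
move=> [hx _] e0; have xr : `|x - x0| <= rho.
  by rewrite leNgt; apply/negP => /barrier_gap_out h; rewrite h ltxx in e0.
have vx : 0 <= v x.
  by apply: hx; apply: (le_trans xr); rewrite /rho; have := r0; lra.
have E : eta x = Num.max (psi x - v x) 0.
  by rewrite /eta /barrier_gap (max_l vx).
have vp : v x < psi x.
  by rewrite ltNge; apply/negP => h; move: e0; rewrite E max_r ?ltxx ?subr_le0.
by split=> //; rewrite E max_l// subr_ge0 ltW.
Qed.

Lemma gain_ge0 y : 0 <= gain y.
Proof. by rewrite /gain mulr_ge0 ?ler0n// divr_ge0 ?powR_ge0. Qed.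

Lemma tail_cost_ge0 y : 0 <= tail_cost y.
Proof.
rewrite /tail_cost mulr_ge0 ?ler0n// mulr_ge0 ?divr_ge0 ?powR_ge0//.
by rewrite mulr_ge0 ?powR_ge0.
Qed.

Lemma tail_cost_in y : `|y - x0| <= r -> tail_cost y = 0.
Proof. by move=> h; rewrite /tail_cost indicE memNset ?mulr0//; apply. Qed.

(** Inside the cube [eta y = 0] means [psi y <= v y], so the increment of [v] is below that of
    [psi]. On the gain set it is even below [- omega / 4], because
    [v x < delta * omega <= omega / 4]. Outside the cube the growth condition bounds it by
    [2 * delta * omega * (|y - x0| / r) ^ s]. *)
Lemma barrier_interaction_le x y : admissible x -> admissible y ->
  0 < eta x -> eta y = 0 ->
  Jfun m (v x - v y) * kernel s m (x - y) <=
  Jfun m (psi x - psi y) * kernel s m (x - y) + (tail_cost y - gain y).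
Proof.
move=> Px Py ex ey; have [xr vx vp eE] := barrier_gap_gt0 Px ex.
have k0 := @kernel_ge0 R n s m (x - y).
have xne : x - y != 0.
  by rewrite subr_eq0; apply/eqP => xy; move: ex; rewrite xy ey ltxx.
case: (ltP r `|y - x0|) => yr.
- have rr : rho < `|y - x0| by apply: lt_trans yr; rewrite /rho; have := r0; lra.
  have -> : gain y = 0.
    by rewrite /gain indicE memNset ?mulr0// => -[/(lt_le_trans yr)]; rewrite ltxx.
  rewrite subr0 (barrier_out rr) subr0.
  apply: (@le_trans _ _ (tail_cost y)); last first.
    by rewrite lerDr mulr_ge0// Jfun_ge0// barrier_ge0.
  rewrite /tail_cost indicE mem_set ?mulr1; last first.
    by rewrite /cube /= => /(lt_le_trans yr); rewrite ltxx.
  set t := `|y - x0|; have t0 : 0 < t by apply: lt_trans yr.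
  have tr1 : 1 <= t / r by rewrite ler_pdivlMr// mul1r ltW.
  have trs : 1 <= (t / r) `^ s.
    by rewrite -[leLHS](powRr0 (t / r)) ler_powR// ltW.
  have Jle : Jfun m (v x - v y) <= (2 * (delta * omega)) `^ (m - 1) *
      (t / r) `^ (s * (m - 1)).
    rewrite powRrM -powRM ?powR_ge0//; last by rewrite mulr_ge0// ltW.
    rewrite -Jfun_ge0E//; last first.
      by rewrite mulr_ge0 ?powR_ge0// mulr_ge0// ltW.
    apply: Jfun_nondecreasing => //.
    have := Py.2 yr; have := barrier_le x; rewrite -/t.
    have : delta * omega <= delta * omega * (t / r) `^ s.
      by rewrite ler_peMr// ltW.
    by move: vp; move: (t / r) => *; lra.
  have kle : kernel s m (x - y) <= (4 / 3) `^ (n%:R + s * m) / t `^ (n%:R + s * m).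
    apply: le_trans (kernel_le sm0 xne) _.
    have p0 : 0 < `|x - y| by rewrite normr_gt0.
    rewrite -gt0_powRD// [s * m + _]addrC.
    have h43 : (0 : R) < 4 / 3 by lra.
    rewrite -[4 / 3]invrK -[((4 / 3)^-1)^-1]powR_inv1 ?invr_ge0 ?(ltW h43)//.
    rewrite powRAC powR_inv1 ?powR_ge0// -invfM -powRM ?(ltW t0) ?invr_ge0 ?(ltW h43)//.
    rewrite lef_pV2 ?posrE ?powR_gt0 ?mulr_gt0 ?invr_gt0//.
    apply: ge0_ler_powR; rewrite ?nnegrE ?(ltW nsm0)//.
      by rewrite mulr_ge0 ?(ltW t0)// invr_ge0 ltW.
    have -> : (4 / 3)^-1 * t = t - t / 4 by field.
    have h1 : `|y - x0| <= `|x - y| + `|x - x0|.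
      rewrite [`|x - y|]distrC -[y - x0](subrKA x); exact: ler_normD.
    rewrite -/t in h1; move: h1 xr yr; rewrite -/t /rho; lra.
  case: (ltP 0 (Jfun m (v x - v y))) => J0; last first.
    apply: (@le_trans _ _ 0); first by rewrite mulr_le0_ge0.
    by rewrite mulr_ge0 ?divr_ge0 ?powR_ge0// mulr_ge0 ?powR_ge0.
  apply: le_trans (ler_pM (ltW J0) k0 Jle kle) _.
  rewrite le_eqVlt; apply/orP; left; apply/eqP; ring.
- rewrite tail_cost_in// sub0r.
  have vy : 0 <= v y by apply: Py.1.
  have py : psi y <= v y.
    rewrite leNgt; apply/negP => h; move: ey.
    rewrite /eta /barrier_gap (max_l vy) max_l; last by rewrite subr_ge0 ltW.
    by move=> /eqP; rewrite subr_eq0 => /eqP e; move: h; rewrite -e ltxx.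
  have [Ay|nAy] := pselect (gain_set y); last first.
    rewrite /gain indicE memNset// mulr0 subr0 ler_wpM2r//.
    by apply: Jfun_nondecreasing => //; lra.
  have [_ [yrho vyo]] := Ay.
  rewrite (barrier_out yrho) subr0.
  apply: (@le_trans _ _ (- gain y)); last first.
    by rewrite lerDr mulr_ge0// Jfun_ge0// barrier_ge0.
  rewrite /gain indicE mem_set// mulr1.
  have Jle : Jfun m (v x - v y) <= - (omega / 4) `^ (m - 1).
    rewrite -Jfun_ge0E//; last by rewrite divr_ge0// ltW.
    rewrite -JfunN; apply: Jfun_nondecreasing => //.
    have := barrier_le x.
    have : delta * omega <= 4^-1 * omega by rewrite ler_wpM2r// ltW.
    lra.
  have kge : ((n%:R * (2 * r)) `^ (n%:R + s * m))^-1 <= kernel s m (x - y).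
    apply: kernel_ge => //.
    have h1 : `|x - y| <= `|x - x0| + `|y - x0|.
      rewrite [`|y - x0|]distrC -[x - y](subrKA x0); exact: ler_normD.
    by move: h1 xr yr r0; rewrite /rho; lra.
  apply: (@le_trans _ _ (- (omega / 4) `^ (m - 1) * kernel s m (x - y))).
    exact: ler_wpM2r.
  by rewrite !mulNr lerN2 ler_wpM2l ?powR_ge0.
Qed.

Lemma energy_density_barrier_le x y : admissible x -> admissible y ->
  energy_density s m v eta (x, y) <=
  energy_density s m psi eta (x, y) +
  (eta x * (tail_cost y - gain y) + eta y * (tail_cost x - gain x)).
Proof.
move=> Px Py.
have one a b : admissible a -> admissible b -> 0 < eta a -> eta b = 0 ->
  energy_density s m v eta (a, b) <= energy_density s m psi eta (a, b) +
  (eta a * (tail_cost b - gain b) + eta b * (tail_cost a - gain a)).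
  move=> Pa Pb ea eb; have h := barrier_interaction_le Pa Pb ea eb.
  rewrite /energy_density /= eb mul0r addr0 subr0.
  have e1 (J k : R) : J * eta a * k = eta a * (J * k) by ring.
  by rewrite !e1 -mulrDr ler_wpM2l// ltW.
have [ex|ex] := eqVneq (eta x) 0; have [ey|ey] := eqVneq (eta y) 0.
- by rewrite /energy_density /= ex ey subrr !mulr0 !mul0r !addr0.
- have ey0 : 0 < eta y by rewrite lt0r ey barrier_gap_ge0.
  by have := one _ _ Py Px ey0 ex; rewrite 2!(energy_densityC _ _ _ _ y) [X in _ <= _ + X]addrC.
- have ex0 : 0 < eta x by rewrite lt0r ex barrier_gap_ge0.
  exact: one.
(* Both points lie in the inner cube, where there is neither gain nor tail. The increment of [eta]
   is that of [psi] minus that of [v], so monotonicity of [Jfun] gives the inequality. *)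
- have ex0 : 0 < eta x by rewrite lt0r ex barrier_gap_ge0.
  have ey0 : 0 < eta y by rewrite lt0r ey barrier_gap_ge0.
  have [xr vx vpx ->] := barrier_gap_gt0 Px ex0.
  have [yr vy vpy ->] := barrier_gap_gt0 Py ey0.
  have nb a : `|a - x0| <= rho -> tail_cost a - gain a = 0.
    move=> ar; rewrite tail_cost_in; last by move: ar r0; rewrite /rho; lra.
    rewrite /gain indicE memNset ?mulr0 ?subrr// => -[_ [h _]].
    by move: (le_lt_trans ar h); rewrite ltxx.
  rewrite !nb// !mulr0 !addr0 /energy_density /=.
  have [_ _ _ ->] := barrier_gap_gt0 Px ex0.
  have [_ _ _ ->] := barrier_gap_gt0 Py ey0.
  rewrite ler_wpM2r ?kernel_ge0//.
  case: (leP (v x - v y) (psi x - psi y)) => h.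
    by rewrite ler_wpM2r ?Jfun_nondecreasing//; lra.
  by rewrite ler_wnM2r ?Jfun_nondecreasing//; lra.
Qed.

End barrier_pointwise.

Section barrier_energy.
Context {R : realType} {n : nat}.
Local Notation mu := (lebesgue_measure_rV R n).
Local Notation V := 'rV[R]_n.
Implicit Types (x y : V) (r omega delta : R) (v : V -> R).

Lemma measurable_barrier (x0 : V) r omega delta :
  measurable_fun setT (barrier x0 r omega delta).
Proof. by apply: measurable_funM => //; exact: measurable_bump. Qed.

Lemma measurable_barrier_gap (x0 : V) r omega delta v : measurable_fun setT v ->
  measurable_fun setT (barrier_gap x0 r omega delta v).
Proof.
move=> mv; apply: measurable_maxr => //; apply: measurable_funB.
  exact: measurable_barrier.
exact: measurable_maxr.
Qed.

Lemma integrable_bounded_cube (x0 : V) r (M : R) (f : V -> R) : 0 < r ->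
  measurable_fun setT f -> (forall x, 0 <= f x <= M) ->
  (forall x, r < `|x - x0| -> f x = 0) -> mu.-integrable setT (EFin \o f).
Proof.
move=> r0 mf fM fout; apply/integrableP; split; first exact/measurable_EFinP.
apply: (@le_lt_trans _ _ (\int[mu]_x (M%:E * (\1_(cube x0 r) x)%:E))%E).
  apply: ge0_le_integral => //.
  - exact/measurable_EFinP/measurable_fun_normr.
  - apply/measurable_EFinP/measurable_funM => //.
    by apply: measurable_indic; exact: measurable_cube.
  - move=> x _; have /andP[f0 f1] := fM x.
    rewrite lee_fin ger0_norm// indicE.
    case: (boolP (x \in cube x0 r)) => /= xr; first by rewrite mulr1.
    rewrite fout ?mulr0// ltNge; apply/negP => h; move/negP: xr; apply.
    by rewrite inE.
have M0 : 0 <= M by have /andP[h1 h2] := fM 0; exact: le_trans h2.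
rewrite ge0_integralZl_EFin//; last first.
  by apply/measurable_EFinP; apply: measurable_indic; exact: measurable_cube.
rewrite integral_indic; [|exact: measurableT|exact: measurable_cube].
rewrite setIT [X in (_ * X)%E]measure_cube ?(ltW r0)//.
by rewrite -EFinM ltry.
Qed.

Lemma integrable_barrier_gap (x0 : V) r omega delta v : 0 < r -> 0 < omega ->
  0 < delta -> measurable_fun setT v ->
  mu.-integrable setT (EFin \o barrier_gap x0 r omega delta v).
Proof.
move=> r0 o0 d0 mv; have r4 : 0 < r / 4 by rewrite divr_gt0.
apply: (@integrable_bounded_cube x0 (r / 4) (delta * omega)) => //.
- exact: measurable_barrier_gap.
- move=> x; rewrite barrier_gap_ge0 (le_trans (barrier_gap_le x0 r v o0 d0 x))//.
  exact: barrier_le.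
- exact: barrier_gap_out.
Qed.

Lemma finite_gagliardo_barrier_gap s m (x0 : V) r omega delta v :
  (0 < n)%N -> 0 < s < 1 -> 2 < m -> 0 < r ->
  measurable_fun setT v -> finite_gagliardo s m v ->
  finite_gagliardo s m (barrier_gap x0 r omega delta v).
Proof.
move=> n0 s01 m2 r0 mv fv; have m0 : 0 < m by lra.
have r4 : 0 < r / 4 by rewrite divr_gt0.
have mb : measurable_fun setT (barrier x0 r omega delta) by exact: measurable_barrier.
have fb : finite_gagliardo s m (barrier x0 r omega delta).
  apply: finite_gagliardoZ; first exact: measurable_bump.
  exact: finite_gagliardo_bump.
apply: (finite_gagliardo_le m0 mb mv _ _ fb fv).
  exact: measurable_barrier_gap.
move=> x y; rewrite /barrier_gap.
apply: le_trans (normr_max_sub_le _ _ _ _) _; rewrite subrr normr0 addr0.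
set a := barrier _ _ _ _ x; set b := barrier _ _ _ _ y.
have -> : a - Num.max (v x) 0 - (b - Num.max (v y) 0) =
  (a - b) - (Num.max (v x) 0 - Num.max (v y) 0) by ring.
apply: le_trans (ler_normB _ _) _; rewrite lerD2l.
by apply: le_trans (normr_max_sub_le _ _ _ _) _; rewrite subrr normr0 addr0.
Qed.

Lemma measurable_gain_set (x0 : V) r omega v : measurable_fun setT v ->
  measurable (gain_set x0 r omega v).
Proof.
move=> mv.
have -> : gain_set x0 r omega v =
  (cube x0 r `\` cube x0 (r / 4)) `&` (setT `&` v @^-1` `[omega / 2, +oo[).
  apply/seteqP; split => y; rewrite /gain_set /cube /= in_itv/= andbT.
    move=> [h1 [h2 h3]]; split => //; split => //.
    by apply/negP; rewrite -ltNge.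
  by move=> [[h1 /negP h2] [_ h3]]; split => //; split => //; rewrite ltNge.
apply: measurableI; first by apply: measurableD; exact: measurable_cube.
exact: mv.
Qed.

(** The inner cube removed from the half has the fraction [4 ^ (- n) <= 1/4] of the volume. *)
Lemma measure_gain_set_ge (x0 : V) r omega v : (0 < n)%N -> 0 < r ->
  measurable_fun setT v ->
  ((2^-1 * (2 * r) ^+ n)%:E <= mu (cube x0 r `&` [set y | (omega / 2 <= v y)%R]))%E ->
  ((4^-1 * (2 * r) ^+ n)%:E <= mu (gain_set x0 r omega v))%E.
Proof.
move=> n0 r0 mv h.
have mg := measurable_gain_set x0 r omega mv.
have r4 : 0 < r / 4 by rewrite divr_gt0.
have mA : measurable (cube x0 r `&` [set y | omega / 2 <= v y]).
  apply: measurableI; first exact: measurable_cube.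
  have -> : [set y | omega / 2 <= v y] = setT `&` v @^-1` `[omega / 2, +oo[.
    by rewrite setTI; apply/seteqP; split => y; rewrite /= in_itv/= andbT.
  exact: mv.
have sub : cube x0 r `&` [set y | omega / 2 <= v y] `<=`
    gain_set x0 r omega v `|` cube x0 (r / 4).
  move=> y [yr vy]; case: (leP `|y - x0| (r / 4)) => h4; first by right.
  by left.
have mD := measurable_cube x0 (r / 4).
have := le_trans h (le_trans (le_measure mu _ _ sub) (measureU2 mu mg mD)).
rewrite !inE => /(_ mA (measurableU _ _ mg mD)).
rewrite [X in (_ <= _ + X)%E -> _]measure_cube ?(ltW r4)// => h2.
have p0 : 0 < (2 * r) ^+ n by rewrite exprn_gt0// mulr_gt0.
have small : (2 * (r / 4)) ^+ n <= 4^-1 * (2 * r) ^+ n.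
  have -> : 2 * (r / 4) = 4^-1 * (2 * r) by field.
  rewrite exprMn ler_wpM2r ?(ltW p0)//.
  by case: (n) n0 => // k _; rewrite exprS ler_piMr// exprn_ile1// invf_le1// ler1n.
rewrite -leeBlDr// in h2.
apply: le_trans h2; rewrite -EFinB lee_fin; lra.
Qed.

(** All costs carry the factor [delta ^ (m - 1) <= delta], while the gain does not depend on
    [delta]; hence half of the gain survives for small [delta]. Allowing every [delta] up to the
    threshold lets one value serve both [p] and [q]. *)
Lemma energy_barrier_gap_le (s m : R) : (0 < n)%N -> 0 < s < 1 -> 2 < m ->
  exists delta0 c, [/\ 0 < delta0, delta0 <= 4^-1, 0 < c &
  forall (x0 : V) r omega delta v, 0 < r -> 0 < omega -> 0 < delta ->
  delta <= delta0 -> measurable_fun setT v -> finite_gagliardo s m v ->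
  {ae mu, forall x, admissible s x0 r omega delta v x} ->
  ((2^-1 * (2 * r) ^+ n)%:E <= mu (cube x0 r `&` [set y | (omega / 2 <= v y)%R]))%E ->
  (\int[mu \x mu]_z
     (energy_density s m v (barrier_gap x0 r omega delta v) z)%:E <=
   (- (c * omega `^ (m - 1) / r `^ (s * m)))%:E *
   \int[mu]_x (barrier_gap x0 r omega delta v x)%:E)%E].
Proof.
move=> n0 s01 m2; have /andP[s0 s1] := s01.
have m1 : 1 < m by lra.
have m11 : 1 <= m - 1 by lra.
have sm0 : 0 < s * m by rewrite mulr_gt0//; lra.
have [C1 [C10 H1]] := energy_bump_le n0 s01 m2.
have [C2 [C20 H2]] := @tail_integral_le R n s m s0 m1.
have nn0 : (0 : R) < n%:R by rewrite ltr0n.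
pose Q : R := (4 / 3) `^ (n%:R + s * m).
(* [delta `^ (m - 1) * K1] is the total cost and [2 * K2] the gain, in units
   of [omega `^ (m - 1) / r `^ (s * m)]. *)
pose K1 : R := C1 * 4 `^ (s * m) + 2 * (2 `^ (m - 1) * Q * C2).
pose K2 : R := 4^-1 `^ (m - 1) / (n%:R * 2) `^ (n%:R + s * m) * (4^-1 * 2 ^+ n).
have K10 : 0 < K1.
  rewrite /K1 addr_gt0//; first by rewrite mulr_gt0// powR_gt0.
  by rewrite !mulr_gt0// /Q powR_gt0//; lra.
have K20 : 0 < K2.
  rewrite /K2; apply: mulr_gt0.
    by rewrite divr_gt0 ?powR_gt0 ?mulr_gt0.
  by rewrite mulr_gt0 ?exprn_gt0.
exists (Num.min 4^-1 (K2 / K1)), K2; split => //.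
- by rewrite lt_min invr_gt0 ltr0n/= divr_gt0.
- by rewrite ge_min lexx.
move=> x0 r omega delta v r0 o0 d0; rewrite le_min => /andP[d4 dK] mv fv adm mass.
have r4 : 0 < r / 4 by rewrite divr_gt0.
set eta := barrier_gap x0 r omega delta v.
have meta : measurable_fun setT eta by exact: measurable_barrier_gap.
have ieta : mu.-integrable setT (EFin \o eta) by exact: integrable_barrier_gap.
have feta : finite_gagliardo s m eta by exact: finite_gagliardo_barrier_gap.
have eta0 x : 0 <= eta x by exact: barrier_gap_ge0.
have eta_out x : r / 4 < `|x - x0| -> eta x = 0.
  by move=> h; exact: barrier_gap_out.
have fin_eta := integrable_fin_num measurableT ieta.
set I := fine (\int[mu]_x (eta x)%:E).
have IE : (\int[mu]_x (eta x)%:E)%E = I%:E by rewrite /I fineK.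
have I0 : 0 <= I by rewrite fine_ge0// integral_ge0// => x _; rewrite lee_fin.
set psi := barrier x0 r omega delta.
have mb : measurable_fun setT (bump x0 (r / 4)) by exact: measurable_bump.
have fb := @finite_gagliardo_bump R n s m n0 s01 m2 x0 (r / 4) r4.
have mpsi : measurable_fun setT psi by exact: measurable_barrier.
have fpsi : finite_gagliardo s m psi by exact: finite_gagliardoZ.
pose t := @tail_cost R n s m x0 r omega delta.
pose g := gain s m x0 r omega v.
have t0 y : 0 <= t y by exact: tail_cost_ge0.
have g0 y : 0 <= g y by exact: gain_ge0.
have mt : measurable_fun setT t.
  apply: measurable_funM; last first.
    by apply: measurable_indic; apply: measurableC; exact: measurable_cube.
  have mn : measurable_fun setT (fun y : V => `|y - x0|).
    by apply: (measurableT_comp measurable_rV_norm); exact: measurable_rVB.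
  apply: measurable_funM => //; apply: measurable_funM.
    by apply: measurable_fun_powR; apply: measurable_funM.
  by apply: measurable_fun_inv; exact: measurable_fun_powR.
have mg : measurable_fun setT g.
  apply: measurable_funM => //; apply: measurable_indic.
  exact: measurable_gain_set.
pose B := (2 * (delta * omega)) `^ (m - 1) * Q.
have B0 : 0 <= B by rewrite mulr_ge0 ?powR_ge0.
have tI : (\int[mu]_y (t y)%:E <= (B * C2 / r `^ (s * m))%:E)%E.
  apply: (H2 x0 r B t r0 B0 mt t0) => y yr; first exact: tail_cost_in.
  rewrite /t /tail_cost -/Q -/B mulrA.
  apply: ler_piMr; last by rewrite indicE lern1; case: (_ \in _).
  by rewrite divr_ge0 ?powR_ge0// mulr_ge0 ?powR_ge0.
have it : mu.-integrable setT (EFin \o t).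
  apply/integrableP; split; first exact/measurable_EFinP.
  under eq_integral do rewrite /= ger0_norm//.
  by apply: le_lt_trans tI _; rewrite ltry.
have ig : mu.-integrable setT (EFin \o g).
  apply: (@integrable_bounded_cube x0 r
    ((omega / 4) `^ (m - 1) / (n%:R * (2 * r)) `^ (n%:R + s * m))) => //.
    move=> y; rewrite g0 /=; apply: ler_piMr.
      by rewrite divr_ge0 ?powR_ge0.
    by rewrite indicE lern1; case: (_ \in _).
  move=> y yr; rewrite /g /gain indicE memNset ?mulr0//.
  by move=> -[/(lt_le_trans yr)]; rewrite ltxx.
have gI : ((K2 * omega `^ (m - 1) / r `^ (s * m))%:E <= \int[mu]_y (g y)%:E)%E.
  rewrite /g /gain; under eq_integral do rewrite EFinM.
  rewrite ge0_integralZl_EFin; last 4 first.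
  - exact: measurableT.
  - by move=> y _; rewrite lee_fin.
  - by apply/measurable_EFinP/measurable_indic; exact: measurable_gain_set.
  - by rewrite divr_ge0 ?powR_ge0.
  rewrite integral_indic; [|exact: measurableT|exact: measurable_gain_set].
  rewrite setIT; apply: le_trans (lee_wpmul2l _ (measure_gain_set_ge n0 r0 mv mass)).
    rewrite -EFinM lee_fin le_eqVlt; apply/orP; left; apply/eqP.
    have -> : omega / 4 = 4^-1 * omega by rewrite mulrC.
    rewrite [(4^-1 * omega) `^ _]powRM ?(ltW o0)// mulrA.
    rewrite [(n%:R * 2 * r) `^ _]powRM ?mulr_ge0 ?(ltW r0)//.
    rewrite [r `^ (n%:R + _)]gt0_powRD// powR_mulrn ?(ltW r0)// exprMn /K2.
    have h1 : (n%:R * 2) `^ (n%:R + s * m) != 0 :> R.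
      by rewrite gt_eqF// powR_gt0// mulr_gt0.
    have h2 : r `^ (s * m) != 0 by rewrite gt_eqF// powR_gt0.
    have h3 : r ^+ n != 0 by rewrite gt_eqF// exprn_gt0.
    move: (4^-1 `^ (m - 1)) (omega `^ (m - 1)) h1 h2 h3.
    move: ((n%:R * 2) `^ _) (r `^ _) (r ^+ n) (2 ^+ n) => a b c d e f a0 b0 c0.
    by field; apply/and3P.
  by rewrite lee_fin divr_ge0 ?powR_ge0.
have finT := integrable_fin_num measurableT it.
have finG := integrable_fin_num measurableT ig.
have psiI : (\int[mu \x mu]_z (energy_density s m psi eta z)%:E <=
    ((delta * omega) `^ (m - 1) * (C1 / (r / 4) `^ (s * m) * I))%:E)%E.
  have do0 : 0 <= delta * omega by rewrite ltW// mulr_gt0.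
  have ib := integrable_energy_density m2 mb meta fb feta.
  under eq_integral do rewrite energy_densityZ// EFinM.
  rewrite integralZl// EFinM lee_wpmul2l ?lee_fin ?powR_ge0// EFinM -IE.
  exact: H1.
pose beta y := t y - g y.
have ibeta : mu.-integrable setT (EFin \o beta).
  by rewrite (_ : _ \o _ = (EFin \o t) \- (EFin \o g))%E//; exact: integrableB.
have betaE : (\int[mu]_y (beta y)%:E = \int[mu]_y (t y)%:E - \int[mu]_y (g y)%:E)%E.
  by rewrite -integralB.
have iE := integrable_energy_density m2 mv meta fv feta.
have iPsi := integrable_energy_density m2 mpsi meta fpsi feta.
apply: (@le_trans _ _ (\int[mu \x mu]_z (energy_density s m psi eta z)%:E +
    (\int[mu]_x (eta x)%:E * \int[mu]_x (beta x)%:E +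
     \int[mu]_x (eta x)%:E * \int[mu]_x (beta x)%:E))%E).
  apply: (integral_le_tensor iE iPsi ieta ibeta).
  apply: filterS (ae_prod_pair adm) => -[x y] [Px Py].
  exact: (energy_density_barrier_le s01 m2 r0 o0 d0 d4 Px Py).
rewrite betaE IE.
rewrite -(fineK finT) -(fineK finG) in tI gI *.
move: tI gI; set T := fine _; set G := fine _; rewrite !lee_fin => tI gI.
rewrite -EFinB -!EFinM -EFinD.
apply: le_trans (leeD psiI (lexx _)) _; rewrite -EFinD lee_fin.
pose W := omega `^ (m - 1) / r `^ (s * m).
have W0 : 0 <= W by rewrite divr_ge0 ?powR_ge0.
have dd : delta `^ (m - 1) <= delta.
  by apply: ge1r_powR => //; rewrite d0 (le_trans d4)// invf_le1// ler1n.
have e1 : (delta * omega) `^ (m - 1) * (C1 / (r / 4) `^ (s * m) * I) =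
    delta `^ (m - 1) * (C1 * 4 `^ (s * m)) * (W * I).
  rewrite powRM ?(ltW d0) ?(ltW o0)// powRM ?(ltW r0)// /W.
  rewrite -[4^-1]powR_inv1// powRAC powR_inv1 ?powR_ge0//.
  have h2 : r `^ (s * m) != 0 by rewrite gt_eqF// powR_gt0.
  have h4 : 4 `^ (s * m) != 0 :> R by rewrite gt_eqF// powR_gt0.
  move: (r `^ _) (4 `^ _) (delta `^ _) (omega `^ _) h2 h4 => a b c d a0 b0.
  by field; apply/andP.
have e2 : B * C2 / r `^ (s * m) = delta `^ (m - 1) * (2 `^ (m - 1) * Q * C2) * W.
  rewrite /B powRM ?mulr_ge0 ?(ltW d0) ?(ltW o0)// powRM ?(ltW d0) ?(ltW o0)//.
  by rewrite /W; ring.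
have e3 : K2 * omega `^ (m - 1) / r `^ (s * m) = K2 * W by rewrite /W mulrA.
rewrite e1 e3; rewrite e2 in tI; rewrite e3 in gI.
have dK1 : delta `^ (m - 1) * K1 <= K2.
  apply: le_trans (ler_wpM2r (ltW K10) dd) _.
  by rewrite -ler_pdivlMr.
have TG : T - G <= delta `^ (m - 1) * (2 `^ (m - 1) * Q * C2) * W - K2 * W.
  by apply: lerB.
have key : delta `^ (m - 1) * (C1 * 4 `^ (s * m)) * W + 2 * (T - G) <= - (K2 * W).
  apply: (@le_trans _ _ (delta `^ (m - 1) * K1 * W - 2 * (K2 * W))).
    have -> : delta `^ (m - 1) * K1 * W =
      delta `^ (m - 1) * (C1 * 4 `^ (s * m)) * W +
      2 * (delta `^ (m - 1) * (2 `^ (m - 1) * Q * C2) * W) by rewrite /K1; ring.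
    by move: TG; clear; lra.
  by have := ler_wpM2r W0 dK1; clear; lra.
have := ler_wpM2r I0 key.
by move: (delta `^ _ * _) (T - G) (K2 * W) => a b c; clear; lra.
Qed.

End barrier_energy.

(** * Growth and decay of oscillation *)

Section growth.
Context {R : realType} {n : nat}.
Local Notation mu := (lebesgue_measure_rV R n).
Local Notation V := 'rV[R]_n.
Implicit Types (x y : V) (u v phi : V -> R).

(** The weak form of the statement that the sum of the two operators on [v] is bounded by [K] in
    absolute value. Membership of [v] in [Wspace] is not demanded: the condition has to survive
    subtracting constants, which destroys integrability at infinity. *)
Definition bounded_energy (s p q K : R) v : Prop :=
  [/\ measurable_fun setT v, finite_gagliardo s p v, finite_gagliardo s q v &
    forall phi, Wspace s p q phi -> (forall x, 0 <= phi x) ->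
      (`|pq_energy s p q v phi| <= K%:E * \int[mu]_x (phi x)%:E)%E].

Lemma WspaceP (s p q : R) phi : 0 < p -> 0 < q ->
  Wspace s p q phi <->
  [/\ phi \in Lfun mu (sobolev_exponent n s p)%:E,
      phi \in Lfun mu (sobolev_exponent n s q)%:E,
      finite_gagliardo s p phi & finite_gagliardo s q phi].
Proof.
move=> p0 q0; rewrite /Wspace /Dspace; split.
  by move=> [[h1 /gagliardo_seminorm_lty h2] [h3 /gagliardo_seminorm_lty h4]];
    split => //; [exact: h2|exact: h4].
move=> [h1 h2 h3 h4]; split; split => //.
  exact: (gagliardo_seminorm_lty _ _ p0).2 h3.
exact: (gagliardo_seminorm_lty _ _ q0).2 h4.
Qed.

Lemma Lfun_measurable (t : \bar R) phi : phi \in Lfun mu t -> measurable_fun setT phi.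
Proof. by move=> /andP[/[!inE]]. Qed.

Lemma LfunP_real (t : R) phi : 0 < t -> measurable_fun setT phi ->
  phi \in Lfun mu t%:E <-> (\int[mu]_x (`|phi x| `^ t)%:E < +oo)%E.
Proof.
move=> t0 mphi.
have E : finite_norm mu t%:E phi = ((\int[mu]_x (`|phi x| `^ t)%:E) `^ t^-1 < +oo)%E.
  by rewrite /finite_norm unlock.
split.
  move=> /andP[_ /[!inE]]; rewrite /= E; apply: lty_poweRy.
  by rewrite invr_eq0 gt_eqF.
move=> h; apply/andP; split; first by rewrite inE.
by rewrite inE /= E; exact: poweR_lty.
Qed.

Lemma pq_energy_const_sub (s p q c : R) v phi : 2 < p -> 2 < q ->
  measurable_fun setT v -> measurable_fun setT phi ->
  finite_gagliardo s p v -> finite_gagliardo s q v ->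
  finite_gagliardo s p phi -> finite_gagliardo s q phi ->
  pq_energy s p q (fun x => c - v x) phi = (- pq_energy s p q v phi)%E.
Proof.
move=> p2 q2 mv mphi vp vq phip phiq.
have mcv : measurable_fun setT (fun x => c - v x) by exact: measurable_funB.
have G m : finite_gagliardo s m v -> finite_gagliardo s m (fun x => c - v x).
  rewrite /finite_gagliardo => h; under eq_integral => z _.
    rewrite (_ : gagliardo_density s m (fun x => c - v x) z =
                 gagliardo_density s m v z); last first.
      rewrite /gagliardo_density; congr (_ `^ _ * _).
      by rewrite -normrN; congr (`|_|); ring.
    over.
  exact: h.
have E m z : energy_density s m (fun x => c - v x) phi z =
    - energy_density s m v phi z.
  rewrite /energy_density (_ : _ - _ - _ = - (v z.1 - v z.2)); last by ring.
  by rewrite JfunN !mulNr.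
rewrite (pq_energyE p2 q2 mv mphi vp vq phip phiq).
rewrite (pq_energyE p2 q2 mcv mphi (G p vp) (G q vq) phip phiq).
have ip := integrable_energy_density p2 mv mphi vp phip.
have iq := integrable_energy_density q2 mv mphi vq phiq.
under eq_integral do rewrite E EFinN.
under [X in (_ + X)%E]eq_integral do rewrite E EFinN.
rewrite integralN; last exact: integrable_add_def.
rewrite integralN; last exact: integrable_add_def.
apply/esym/fin_num_oppeD; exact: (integrable_fin_num measurableT iq).
Qed.

End growth.

Section oscillation.
Context {R : realType} {n : nat}.
Local Notation mu := (lebesgue_measure_rV R n).
Local Notation V := 'rV[R]_n.
Implicit Types (x y : V) (u v phi : V -> R).

Lemma bounded_energy_sub (s p q K c : R) v : bounded_energy s p q K v ->
  bounded_energy s p q K (fun x => v x - c).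
Proof.
case=> mv vp vq H.
have E x y : (v x - c) - (v y - c) = v x - v y by ring.
have mvc : measurable_fun setT (fun x => v x - c) by exact: measurable_funB.
have G m : finite_gagliardo s m v -> finite_gagliardo s m (fun x => v x - c).
  rewrite /finite_gagliardo => h; under eq_integral => z _.
    rewrite (_ : gagliardo_density s m (fun x => v x - c) z =
                 gagliardo_density s m v z); last by rewrite /gagliardo_density E.
    over.
  exact: h.
split; [exact: mvc|exact: G|exact: G|move=> phi W phi0].
have -> : pq_energy s p q (fun x => v x - c) phi = pq_energy s p q v phi.
  by rewrite /pq_energy; apply: eq_integral => z _; rewrite E.
exact: H.
Qed.

Lemma bounded_energy_const_sub (s p q K c : R) v : 2 < p -> 2 < q ->
  bounded_energy s p q K v -> bounded_energy s p q K (fun x => c - v x).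
Proof.
move=> p2 q2 [mv vp vq H].
have p0 : 0 < p by lra.
have q0 : 0 < q by lra.
have mcv : measurable_fun setT (fun x => c - v x) by exact: measurable_funB.
have G m : finite_gagliardo s m v -> finite_gagliardo s m (fun x => c - v x).
  rewrite /finite_gagliardo => h; under eq_integral => z _.
    rewrite (_ : gagliardo_density s m (fun x => c - v x) z =
                 gagliardo_density s m v z); last first.
      rewrite /gagliardo_density; congr (_ `^ _ * _).
      by rewrite -normrN; congr (`|_|); ring.
    over.
  exact: h.
split; [exact: mcv|exact: G|exact: G|move=> phi W phi0].
have [hp hq gp gq] := (WspaceP s phi p0 q0).1 W.
have mphi := Lfun_measurable hp.
rewrite (pq_energy_const_sub c p2 q2 mv mphi vp vq gp gq) abseN.
exact: H.
Qed.

Lemma Lfun_barrier_gap (x0 : V) r omega delta v (t : R) : 0 < t ->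
  0 < r -> 0 < omega -> 0 < delta -> measurable_fun setT v ->
  barrier_gap x0 r omega delta v \in Lfun mu t%:E.
Proof.
move=> t0 r0 o0 d0 mv.
have mg := measurable_barrier_gap x0 r omega delta mv.
have r4 : 0 < r / 4 by rewrite divr_gt0.
apply/(LfunP_real t0 mg).
apply: integrable_lty => //.
apply: (@integrable_bounded_cube _ _ x0 (r / 4) ((delta * omega) `^ t)) => //.
- by apply: measurable_fun_powR; exact: measurable_fun_normr.
- move=> x; rewrite powR_ge0/= ger0_norm ?barrier_gap_ge0//.
  have do0 : 0 <= delta * omega by rewrite ltW// mulr_gt0.
  rewrite ge0_ler_powR ?nnegrE ?(ltW t0) ?barrier_gap_ge0//.
  exact: (le_trans (barrier_gap_le x0 r v o0 d0 x) (barrier_le x0 r o0 d0 x)).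
- by move=> x xr; rewrite barrier_gap_out// normr0 powR0// gt_eqF.
Qed.

Lemma ge0_integral_eq0_ae (f : V -> R) : measurable_fun setT f ->
  (forall x, 0 <= f x) -> (\int[mu]_x (f x)%:E = 0)%E ->
  {ae mu, forall x, f x = 0}.
Proof.
move=> mf f0 h.
have mEf : measurable_fun setT (EFin \o f) by exact/measurable_EFinP.
have /(ae_eq_integral_abs mu measurableT mEf) : (\int[mu]_x `|(EFin \o f) x| = 0)%E.
  by rewrite -[RHS]h; apply: eq_integral => x _; rewrite /= ger0_norm.
by apply: filterS => x /(_ I)[].
Qed.

Lemma energy_balance_eq0 (Ep Eq I : \bar R) (K c e : R) :
  Ep \is a fin_num -> Eq \is a fin_num -> I \is a fin_num -> (0 <= I)%E ->
  0 <= e -> K < c -> (Ep <= (- c)%:E * I)%E -> (Eq <= (- e)%:E * I)%E ->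
  (`|Ep + Eq| <= K%:E * I)%E -> I = 0%E.
Proof.
move: Ep Eq I => [Ep| |] [Eq| |] [I| |] // _ _ _.
rewrite -EFinD -!EFinM abse_EFin !lee_fin ler_norml => I0 e0 Kc hp hq /andP[h _].
congr EFin; apply/eqP; rewrite eq_le I0 andbT leNgt; apply/negP => Ipos.
have : K * I < c * I by rewrite ltr_pM2r.
have : 0 <= e * I by rewrite mulr_ge0.
lra.
Qed.

(** The test function forces an energy more negative than the equation allows unless its integral is
    [0]. Then [v] lies above the barrier, and [r / (8 * n%:R)] is the radius [(r / 4) / (2 * n%:R)]
    on which the bump is at least [1/2]. *)
Lemma growth (s p q : R) : (0 < n)%N -> 0 < s < 1 -> 2 < p -> 2 < q ->
  s * p < n%:R -> s * q < n%:R ->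
  exists delta c, [/\ 0 < delta, delta <= 4^-1, 0 < c &
  forall (x0 : V) r omega K v, 0 < r -> 0 < omega ->
  bounded_energy s p q K v -> K < c * omega `^ (p - 1) / r `^ (s * p) ->
  {ae mu, forall x, admissible s x0 r omega delta v x} ->
  ((2^-1 * (2 * r) ^+ n)%:E <= mu (cube x0 r `&` [set y | (omega / 2 <= v y)%R]))%E ->
  {ae mu, forall x, `|x - x0| <= r / (8 * n%:R) -> delta * omega / 2 <= v x}].
Proof.
move=> n0 s01 p2 q2 spn sqn; have /andP[s0 s1] := s01.
have p0 : 0 < p by lra.
have q0 : 0 < q by lra.
have [dp [cp [dp0 dp4 cp0 Hp]]] := @energy_barrier_gap_le R n s p n0 s01 p2.
have [dq [cq [dq0 dq4 cq0 Hq]]] := @energy_barrier_gap_le R n s q n0 s01 q2.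
pose d := Num.min dp dq.
have d0 : 0 < d by rewrite lt_min dp0 dq0.
have ddp : d <= dp by rewrite ge_min lexx.
have ddq : d <= dq by rewrite ge_min lexx orbT.
exists d, cp; split => //; first exact: le_trans dp4.
move=> x0 r omega K v r0 o0 [mv vp vq HE] Kc adm mass.
set eta := barrier_gap x0 r omega d v.
have meta : measurable_fun setT eta by exact: measurable_barrier_gap.
have eta0 x : 0 <= eta x by exact: barrier_gap_ge0.
have ieta : mu.-integrable setT (EFin \o eta) by exact: integrable_barrier_gap.
have etap := finite_gagliardo_barrier_gap x0 omega d n0 s01 p2 r0 mv vp.
have etaq := finite_gagliardo_barrier_gap x0 omega d n0 s01 q2 r0 mv vq.
have nn0 : (0 : R) < n%:R by rewrite ltr0n.
have W : Wspace s p q eta.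
  apply/(WspaceP s eta p0 q0); split.
  - by apply: Lfun_barrier_gap => //; rewrite divr_gt0 ?subr_gt0// mulr_gt0.
  - by apply: Lfun_barrier_gap => //; rewrite divr_gt0 ?subr_gt0// mulr_gt0.
  - exact: etap.
  - exact: etaq.
have fin_eta := integrable_fin_num measurableT ieta.
have hp := Hp x0 r omega d v r0 o0 d0 ddp mv vp adm mass.
have hq := Hq x0 r omega d v r0 o0 d0 ddq mv vq adm mass.
have := HE eta W eta0.
rewrite (pq_energyE p2 q2 mv meta vp vq etap etaq).
have ip := integrable_fin_num measurableT (integrable_energy_density p2 mv meta vp etap).
have iq := integrable_fin_num measurableT (integrable_energy_density q2 mv meta vq etaq).
have I0 : (0 <= \int[mu]_x (eta x)%:E)%E.
  by apply: integral_ge0 => x _; rewrite lee_fin.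
have e0 : 0 <= cq * omega `^ (q - 1) / r `^ (s * q).
  by rewrite divr_ge0 ?powR_ge0// mulr_ge0 ?powR_ge0// ltW.
move=> /(energy_balance_eq0 ip iq fin_eta I0 e0 Kc hp hq) Iz.
have ae0 : {ae mu, forall x, eta x = 0}.
  exact: ge0_integral_eq0_ae.
move: adm ae0; apply: filterS2 => x [Px _] ex xr.
have r4 : 0 < r / 4 by rewrite divr_gt0.
have n1 : (1 : R) <= n%:R by rewrite ler1n.
have xrr : `|x - x0| <= r.
  apply: (le_trans xr); rewrite ler_pdivrMr ?mulr_gt0//.
  by rewrite ler_peMr ?(ltW r0)// -natrM ler1n muln_gt0.
have vx := Px xrr.
have hb : 2^-1 <= bump x0 (r / 4) x.
  apply: bump_center => //; apply: (le_trans xr).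
  rewrite le_eqVlt; apply/orP; left; apply/eqP; field.
  by rewrite gt_eqF.
have : barrier x0 r omega d x <= v x.
  rewrite leNgt; apply/negP => h; move: ex.
  rewrite /eta /barrier_gap (max_l vx) max_l; last by rewrite subr_ge0 ltW.
  by move=> /eqP; rewrite subr_eq0 => /eqP e; move: h; rewrite e ltxx.
apply: le_trans; rewrite /barrier; apply: ler_wpM2l => //.
by apply: ltW; exact: mulr_gt0.
Qed.

Lemma half_mass_dichotomy (x0 : V) (r omega m : R) u : (0 < n)%N -> 0 < r ->
  measurable_fun setT u ->
  ((2^-1 * (2 * r) ^+ n)%:E <=
     mu (cube x0 r `&` [set y | (omega / 2 <= u y - m)%R]))%E \/
  ((2^-1 * (2 * r) ^+ n)%:E <=
     mu (cube x0 r `&` [set y | (omega / 2 <= m + omega - u y)%R]))%E.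
Proof.
move=> n0 r0 mu_.
set A := cube x0 r `&` _; set B := cube x0 r `&` _.
have mA : measurable A.
  apply: measurableI; first exact: measurable_cube.
  have -> : [set y | omega / 2 <= u y - m] = setT `&` u @^-1` `[m + omega / 2, +oo[.
    by rewrite setTI; apply/seteqP; split => y; rewrite /= in_itv/= andbT; lra.
  exact: mu_.
have mB : measurable B.
  apply: measurableI; first exact: measurable_cube.
  have -> : [set y | omega / 2 <= m + omega - u y] =
      setT `&` u @^-1` `]-oo, m + omega / 2].
    by rewrite setTI; apply/seteqP; split => y; rewrite /= in_itv/=; lra.
  exact: mu_.
have sub : cube x0 r `<=` A `|` B.
  move=> y yr; case: (leP (omega / 2) (u y - m)) => h; first by left.
  by right; split => //=; lra.
have := le_trans (le_measure mu _ _ sub) (measureU2 mu mA mB).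
rewrite !inE => /(_ (measurable_cube _ _) (measurableU _ _ mA mB)).
rewrite [X in (X <= _)%E -> _]measure_cube ?(ltW r0)// => h.
case: (leP (2^-1 * (2 * r) ^+ n)%:E (mu A)) => hA; first by left.
right; rewrite leNgt; apply/negP => hB.
by have := le_lt_trans h (lteD hA hB); rewrite -EFinD lte_fin; lra.
Qed.

(** Concavity of a small power, read off from [powR_bernoulli] with exponent [l^-1] at [X ^ l]. The
    factor [l] is what can be made small later. *)
Lemma powR_sub1_le (X l : R) : 1 <= X -> 0 < l <= 1 -> X `^ l - 1 <= l * X.
Proof.
move=> X1 /andP[l0 l1]; have X0 : 0 <= X by lra.
have k1 : 1 <= l^-1 by rewrite invf_ge1.
have := powR_bernoulli k1 (powR_ge0 X l).
rewrite -powRrM mulfV ?gt_eqF// powRr1// -(ler_pM2l l0).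
have -> : l * (l^-1 * X `^ l) = X `^ l by field; rewrite gt_eqF.
have -> : l * (X + (l^-1 - 1)) = l * X + 1 - l by field; rewrite gt_eqF.
lra.
Qed.

End oscillation.

Section oscillation_decay.
Context {R : realType} {n : nat}.
Local Notation mu := (lebesgue_measure_rV R n).
Local Notation V := 'rV[R]_n.
Implicit Types (x y : V) (u v phi : V -> R).

Lemma invr_powR (x l : R) : 0 <= x -> (x^-1) `^ l = (x `^ l)^-1.
Proof.
by move=> x0; rewrite -[x^-1]powR_inv1// powRAC powR_inv1 ?powR_ge0.
Qed.

(** With [X = (theta ^ s) ^ (i - j)] the left side is the [j]-th term times [X ^ l - 1 <= l * X].
    Since [D] is only known to exceed [theta ^+ i.+1], one factor [theta ^ s] is lost; it is
    absorbed by [l <= delta * theta ^ s]. *)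
Lemma geometric_tail_le (theta s l delta D : R) (i j : nat) :
  0 < theta < 1 -> 0 < s -> 0 < l <= 1 -> l <= delta * theta `^ s ->
  (i <= j)%N -> theta ^+ i.+1 < D ->
  (theta `^ s `^ l) ^+ i - (theta `^ s `^ l) ^+ j <=
  delta * (theta `^ s `^ l) ^+ j * (D / theta ^+ j) `^ s.
Proof.
move=> /andP[t0 t1] s0 l01 ld ij Di.
set b := theta `^ s; have b0 : 0 < b by rewrite powR_gt0.
have b1 : b <= 1.
  have e : 1 `^ s = 1 :> R by rewrite powR1.
  by rewrite -[leRHS]e ge0_ler_powR ?nnegrE ?ltW.
set a := b `^ l; have a0 : 0 < a by rewrite powR_gt0.
pose k := (j - i)%N; have jE : j = (i + k)%N by rewrite subnKC.
pose X := (b ^+ k)^-1.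
have X1 : 1 <= X by rewrite invf_ge1 ?exprn_gt0// exprn_ile1// ltW.
have XE : X `^ l = (a ^+ k)^-1.
  by rewrite /X invr_powR ?exprn_ge0 ?(ltW b0)// powR_exprn// ltW.
have h1 := powR_sub1_le X1 l01.
have aj0 : 0 < a ^+ j by rewrite exprn_gt0.
have -> : a ^+ i - a ^+ j = a ^+ j * (X `^ l - 1).
  rewrite XE jE exprD; field; by rewrite expf_neq0// gt_eqF.
have h2 : b * X <= (D / theta ^+ j) `^ s.
  have tk : 0 < theta ^+ i.+1 / theta ^+ j by rewrite divr_gt0 ?exprn_gt0.
  have -> : b * X = (theta ^+ i.+1 / theta ^+ j) `^ s.
    have -> : theta ^+ i.+1 / theta ^+ j = theta * (theta ^+ k)^-1.
      by rewrite jE exprD exprS; field; rewrite !expf_neq0// gt_eqF.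
    rewrite powRM ?invr_ge0 ?exprn_ge0 ?(ltW t0)// invr_powR ?exprn_ge0 ?(ltW t0)//.
    by rewrite powR_exprn// ltW.
  apply: ge0_ler_powR; rewrite ?nnegrE ?(ltW s0) ?(ltW tk)//.
    by rewrite divr_ge0 ?exprn_ge0 ?(ltW t0)// (le_trans _ (ltW Di))// exprn_ge0 ?ltW.
  by rewrite ler_wpM2r ?invr_ge0 ?exprn_ge0 ?(ltW t0)// ltW.
have l0 : 0 < l by case/andP: l01.
have d0 : 0 <= delta.
  rewrite leNgt; apply/negP => dn; have : delta * b < 0 by rewrite nmulr_rlt0.
  by move: ld; rewrite -/b; lra.
rewrite [delta * _]mulrC -mulrA ler_wpM2l ?(ltW aj0)//.
apply: (le_trans h1); apply: le_trans (ler_wpM2l d0 h2).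
by rewrite mulrA ler_wpM2r// (le_trans _ X1).
Qed.

Lemma exists_shell (theta D : R) (j : nat) : 0 < theta < 1 ->
  theta ^+ j < D -> D <= 1 -> exists i, [/\ (i < j)%N, theta ^+ i.+1 < D & D <= theta ^+ i].
Proof.
move=> /andP[t0 t1] jD D1.
have ex : exists i, theta ^+ i < D by exists j.
case: (ex_minnP ex) => -[|i] h1 h2; first by move: h1; rewrite expr0; lra.
exists i; split => //; first exact: h2.
by rewrite leNgt; apply/negP => /h2; rewrite ltnn.
Qed.

Section interval_steps.
Variables (m wi wj wk d t : R).

(** The interval [[m - wi + wj, m + wi]] is the bound for [u] on the cube of index [i] at stage [j]:
    for [i = j] it is [[m, m + wj]], and in general it says that [u - m] and [m + wj - u] are both
    at least [wj - wi]. Raising the lower end replaces [m] by [m + wj - wk]; lowering the upper end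
    keeps [m]. *)
Lemma shrink_from_below : m - wi + wj <= t <= m + wi -> wk <= wj ->
  (m + wj - wk) - wi + wk <= t <= (m + wj - wk) + wi.
Proof. by move=> /andP[? ?] ?; apply/andP; split; lra. Qed.

Lemma improve_from_below : m - wj + wj <= t <= m + wj -> d <= t - m ->
  wj - wk <= d -> (m + wj - wk) - wk + wk <= t <= (m + wj - wk) + wk.
Proof. by move=> /andP[? ?] ? ?; apply/andP; split; lra. Qed.

Lemma shrink_from_above : m - wi + wj <= t <= m + wi -> wk <= wj ->
  m - wi + wk <= t <= m + wi.
Proof. by move=> /andP[? ?] ?; apply/andP; split; lra. Qed.

Lemma improve_from_above : m - wj + wj <= t <= m + wj -> d <= m + wj - t ->
  wj - wk <= d -> m - wk + wk <= t <= m + wk.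
Proof. by move=> /andP[? ?] ? ?; apply/andP; split; lra. Qed.

Lemma interval_tail_below : m - wi + wj <= t <= m + wi -> wj - wi <= t - m.
Proof. by move=> /andP[? ?]; lra. Qed.

Lemma interval_tail_above : m - wi + wj <= t <= m + wi -> wj - wi <= m + wj - t.
Proof. by move=> /andP[? ?]; lra. Qed.

End interval_steps.

Lemma oscillation_decay (s p q K M : R) u : (0 < n)%N -> 0 < s < 1 ->
  2 < p -> 2 < q -> s * p < n%:R -> s * q < n%:R -> 0 <= K -> 0 <= M ->
  bounded_energy s p q K u -> {ae mu, forall x, 0 <= u x <= M} ->
  exists theta alpha omega0, [/\ 0 < theta < 1, 0 < alpha < 1, 0 < omega0 &
    forall (x0 : V) (j : nat), exists m, {ae mu, forall x,
      `|x - x0| <= theta ^+ j ->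
      m <= u x <= m + omega0 * (theta `^ alpha) ^+ j}].
Proof.
move=> n0 s01 p2 q2 spn sqn K0 M0 uE uM; have /andP[s0 s1] := s01.
have p1 : 1 <= p - 1 by lra.
have [delta [c [d0 d4 c0 H]]] := @growth R n s p q n0 s01 p2 q2 spn sqn.
have nn1 : (1 : R) <= n%:R by rewrite ler1n.
have nn0 : (0 : R) < n%:R by rewrite ltr0n.
(* With [theta `^ (s * l)] as ratio of oscillations, [l] is so small that the
   improvement [delta / 2] suffices and that the nested bounds on the larger
   cubes make [u - m] and [m + w j - u] admissible. *)
pose theta : R := (8 * n%:R)^-1.
have t0 : 0 < theta by rewrite invr_gt0 mulr_gt0.
have t1 : theta < 1 by rewrite invf_lt1 ?mulr_gt0//; lra.
have t01 : 0 < theta < 1 by rewrite t0 t1.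
pose b := theta `^ s; have b0 : 0 < b by rewrite powR_gt0.
have b1 : b < 1.
  have e : 1 `^ s = 1 :> R by rewrite powR1.
  by rewrite -[ltRHS]e gt0_ltr_powR ?nnegrE// ltW.
pose l := delta * b / 4.
have l0 : 0 < l by rewrite divr_gt0// mulr_gt0.
have dbl : delta * b <= delta by rewrite ler_piMr// ltW.
have l1 : l <= 1 by rewrite /l; lra.
have l01 : 0 < l <= 1 by rewrite l0.
have ld : l <= delta * b.
  by rewrite /l; have : 0 < delta * b by [rewrite mulr_gt0|]; lra.
pose a := b `^ l; have a0 : 0 < a by rewrite powR_gt0.
have a1 : a < 1.
  have e : 1 `^ l = 1 :> R by rewrite powR1.
  by rewrite -[ltRHS]e gt0_ltr_powR ?nnegrE// ltW.
have aE : theta `^ (s * l) = a by rewrite powRrM.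
have ha : 1 - a <= delta / 2.
  have X1 : 1 <= b^-1 by rewrite invf_ge1// ltW.
  have := powR_sub1_le X1 l01; rewrite invr_powR ?(ltW b0)// -/a.
  have -> : l * b^-1 = delta / 4 by rewrite /l; field; rewrite gt_eqF.
  rewrite -(ler_pM2l a0) mulrBr mulfV ?gt_eqF// mulr1 => h.
  have : a * (delta / 4) <= delta / 4 by rewrite ler_piMl ?(ltW a1)// divr_ge0// ltW.
  lra.
(* [M] covers the initial oscillation, [K / c] the smallness condition of [growth] at the first
   scale, and [1] ensures [omega0 <= omega0 ^ (p - 1)]. *)
pose omega0 := 1 + M + K / c.
have Kc0 : 0 <= K / c by rewrite divr_ge0// ltW.
have o1 : 1 <= omega0 by rewrite /omega0; lra.
have o0 : 0 < omega0 by lra.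
have oM : M <= omega0 by rewrite /omega0; lra.
have oK : K < c * omega0.
  rewrite mulrC -ltr_pdivrMr// /omega0; lra.
exists theta, (s * l), omega0; split => //.
  by rewrite mulr_gt0//= (le_lt_trans _ s1)// ler_piMr// ltW.
move=> x0 j; rewrite aE.
pose w i := omega0 * a ^+ i.
have w0 i : 0 < w i by rewrite mulr_gt0// exprn_gt0.
have wS i : w i.+1 = a * w i by rewrite /w exprS; ring.
(* The bounds on all larger cubes and the one on the whole space are carried through the induction,
   since admissibility at the next step depends on the values of [u] outside the current cube. *)
suff [m hm] : exists m, {ae mu, forall x,
    (forall i, (i <= j)%N -> `|x - x0| <= theta ^+ i ->
       m - w i + w j <= u x <= m + w i) /\
    m - w 0%N + w j <= u x <= m + w 0%N}.
  exists m; apply: filterS hm => x [hx _] xj.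
  by have := hx j (leqnn j) xj; rewrite subrK.
elim: j => [|j [m IH]].
  exists 0; apply: filterS uM => x ux.
  have hx : 0 - w 0%N + w 0%N <= u x <= 0 + w 0%N.
    rewrite subrK add0r /w expr0 mulr1; case/andP: ux => -> /=.
    by move=> /le_trans; apply.
  by split => // i; rewrite leqn0 => /eqP ->.
pose r := theta ^+ j.
have r0 : 0 < r by rewrite exprn_gt0.
have rS : theta ^+ j.+1 = r / (8 * n%:R) by rewrite exprSr.
(* As [s * l * (p - 1) <= s * p], the numerator decays no faster than the denominator, so the
   condition at scale [1] is inherited by all smaller scales. *)
have Kj : K < c * w j `^ (p - 1) / r `^ (s * p).
  rewrite /w powRM ?exprn_ge0 ?(ltW o0) ?(ltW a0)// !powR_exprn ?(ltW t0) ?(ltW a0)//.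
  have e1 : theta `^ (s * p) <= a `^ (p - 1).
    rewrite -aE -powRrM; apply: ger_powR; first by rewrite t0 ltW.
    rewrite -mulrA ler_wpM2l ?(ltW s0)//.
    apply: (@le_trans _ _ (1 * (p - 1))).
      by rewrite ler_wpM2r// (le_trans ler01).
    by rewrite mul1r gerBl ler01.
  have e2 : (theta `^ (s * p)) ^+ j <= (a `^ (p - 1)) ^+ j.
    by rewrite lerXn2r ?nnegrE ?powR_ge0.
  have e3 : omega0 <= omega0 `^ (p - 1) by apply: le1r_powR.
  apply: (lt_le_trans oK).
  rewrite ler_pdivlMr ?exprn_gt0 ?powR_gt0// -mulrA ler_wpM2l ?(ltW c0)//.
  by apply: ler_pM => //; [exact: ltW|rewrite exprn_ge0 ?powR_ge0].
(* A point outside the cube is placed in its shell and the bound of that index is used; beyond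
   distance [1] the global bound takes over, with [i = 0]. *)
have tail (f : V -> R) x : (forall i, (i <= j)%N -> `|x - x0| <= theta ^+ i ->
       w j - w i <= f x) -> w j - w 0%N <= f x ->
    admissible s x0 r (w j) delta f x.
  move=> f1 f2; split.
    by move=> xr; have := f1 j (leqnn j) xr; rewrite subrr.
  move=> xr.
  have key i : (i <= j)%N -> theta ^+ i.+1 < `|x - x0| ->
      - (delta * w j * (`|x - x0| / r) `^ s) <= w j - w i.
    move=> ij Di; have := geometric_tail_le t01 s0 l01 ld ij Di.
    rewrite -/b -/a -/r => /(ler_wpM2l (ltW o0)).
    have -> : omega0 * (delta * a ^+ j * (`|x - x0| / r) `^ s) =
      delta * w j * (`|x - x0| / r) `^ s by rewrite /w; ring.
    by rewrite mulrBr -/(w i) -/(w j) lerNl opprB.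
  case: (leP `|x - x0| 1) => x1.
    have [i [ij h1 h2]] := exists_shell t01 xr x1.
    exact: le_trans (key i (ltnW ij) h1) (f1 i (ltnW ij) h2).
  apply: le_trans (key 0%N _ _) f2 => //.
  by rewrite expr1 (lt_trans t1).
have ws : w j - w j.+1 <= delta * w j / 2.
  by have := ler_wpM2r (ltW (w0 j)) ha; rewrite mulrBl mul1r mulrAC -wS.
have ws0 : w j.+1 <= w j by rewrite wS ler_piMl// ltW.
have tS x : `|x - x0| <= theta ^+ j.+1 -> `|x - x0| <= theta ^+ j.
  by move=> /le_trans; apply; rewrite exprS ler_piMl ?exprn_ge0// ltW.
have [mA|mB] := half_mass_dichotomy x0 (w j) m n0 r0 (let: And4 h _ _ _ := uE in h).
- have adm : {ae mu, forall x, admissible s x0 r (w j) delta (fun x => u x - m) x}.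
    apply: filterS IH => x [hx gx]; apply: tail.
      by move=> i ij xi; exact: interval_tail_below (hx i ij xi).
    exact: interval_tail_below gx.
  have G := H x0 r (w j) K (fun x => u x - m) r0 (w0 j)
    (bounded_energy_sub m uE) Kj adm mA.
  exists (m + w j - w j.+1).
  move: IH G; apply: filterS2 => x [hx gx] Gx.
  split; last exact: shrink_from_below gx ws0.
  move=> i; rewrite leq_eqVlt => /predU1P[->|].
    move=> xr; apply: improve_from_below (hx j (leqnn j) (tS x xr)) _ ws.
    by apply: Gx; rewrite -rS.
  rewrite ltnS => ij xi; exact: shrink_from_below (hx i ij xi) ws0.
- have adm : {ae mu, forall x, admissible s x0 r (w j) delta (fun x => m + w j - u x) x}.
    apply: filterS IH => x [hx gx]; apply: tail.
      by move=> i ij xi; exact: interval_tail_above (hx i ij xi).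
    exact: interval_tail_above gx.
  have G := H x0 r (w j) K (fun x => m + w j - u x) r0 (w0 j)
    (bounded_energy_const_sub (m + w j) p2 q2 uE) Kj adm mB.
  exists m.
  move: IH G; apply: filterS2 => x [hx gx] Gx.
  split; last exact: shrink_from_above gx ws0.
  move=> i; rewrite leq_eqVlt => /predU1P[->|].
    move=> xr; apply: improve_from_above (hx j (leqnn j) (tS x xr)) _ ws.
    by apply: Gx; rewrite -rS.
  rewrite ltnS => ij xi; exact: shrink_from_above (hx i ij xi) ws0.
Qed.

End oscillation_decay.

(** * From oscillation decay to a Hoelder continuous representative *)

Section hoelder_representative.
Context {R : realType} {n : nat}.
Local Notation mu := (lebesgue_measure_rV R n).
Local Notation V := 'rV[R]_n.
Implicit Types (x y c : V) (u v : V -> R).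

Lemma ae_cube_exists (P : V -> Prop) c (r : R) : 0 < r ->
  {ae mu, forall x, P x} -> exists2 x, `|x - c| <= r & P x.
Proof.
move=> r0 [N [mN N0 PN]]; apply: contrapT => h.
have sub : cube c r `<=` N.
  by move=> x xr; apply: PN => /= Px; apply: h; exists x.
have := le_measure mu _ _ sub; rewrite !inE => /(_ (measurable_cube _ _) mN).
rewrite [X in (_ <= X)%E -> _]N0 [X in (X <= _)%E -> _]measure_cube ?(ltW r0)//.
rewrite lee_fin leNgt.
by rewrite exprn_gt0// mulr_gt0.
Qed.

Lemma rational_approx x (r : R) : 0 < r ->
  exists c : 'rV[rat]_n, `|x - map_mx ratr c| <= r.
Proof.
move=> r0; have cP i : {q : rat | `|x ord0 i - ratr q| <= r}.
  apply/cid; have /rat_in_itvoo[q] : x ord0 i - r < x ord0 i + r by lra.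
  rewrite in_itv/= => /andP[h1 h2]; exists q; rewrite ler_norml.
  by apply/andP; split; lra.
exists (\row_i sval (cP i)); apply/rV_norm_leP; first exact: ltW.
by move=> i; rewrite !mxE; exact: (svalP (cP i)).
Qed.

Lemma ae_forall_countType (T : countType) (P : T -> V -> Prop) :
  (forall t, {ae mu, forall x, P t x}) -> {ae mu, forall x, forall t, P t x}.
Proof.
move=> h; pose Q (k : nat) x := if unpickle k is Some t then P t x else True.
have : {ae mu, forall x, forall k, Q k x}.
  apply: ae_foralln => k; rewrite /Q; case: (unpickle k) => [t|]; first exact: h.
  exact: aeW.
by apply: filterS => x hx t; have := hx (pickle t); rewrite /Q pickleK.
Qed.

(** The exceptional null set depends on the centre, so values of [u] at single points are
    meaningless. The representative is built from the intervals attached to every centre, and its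
    agreement with [u] is checked through the countably many rational centres. *)
Lemma hoelder_representative (u : V -> R) (M theta alpha omega0 : R) :
  0 < theta < 1 -> 0 < alpha < 1 -> 0 < omega0 -> 0 <= M ->
  {ae mu, forall x, 0 <= u x <= M} ->
  (forall x0 (j : nat), exists m, {ae mu, forall x, `|x - x0| <= theta ^+ j ->
      m <= u x <= m + omega0 * (theta `^ alpha) ^+ j}) ->
  hoelder_loc alpha u.
Proof.
move=> /andP[t0 t1] /andP[al0 al1] o0 M0 uM H.
have tj j : 0 < theta ^+ j by rewrite exprn_gt0.
pose a := theta `^ alpha.
have a0 : 0 < a by rewrite powR_gt0.
have a1 : a < 1.
  have e : 1 `^ alpha = 1 :> R by rewrite powR1.
  by rewrite -[ltRHS]e gt0_ltr_powR ?nnegrE// ltW.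
pose w j := omega0 * a ^+ j.
have w0 j : 0 < w j by rewrite mulr_gt0// exprn_gt0.
pose m x j := sval (cid (H x j)).
have mP x j : {ae mu, forall y, `|y - x| <= theta ^+ j -> m x j <= u y <= m x j + w j}.
  exact: svalP (cid (H x j)).
have mle x j k : m x k <= m x j + w j.
  have r0 : 0 < Num.min (theta ^+ j) (theta ^+ k) by rewrite lt_min !tj.
  have [y yr [h1 h2]] := @ae_cube_exists _ x _ r0 (filterI (mP x j) (mP x k)).
  move: yr; rewrite le_min => /andP[/h1/andP[_ h3] /h2/andP[h4 _]].
  exact: le_trans h4 h3.
(* The cube of half the radius around the midpoint lies in both cubes and has positive measure, so
   some value of [u] there lies in both intervals. *)
have mxy x y j : `|x - y| <= theta ^+ j -> m x j <= m y j + w j.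
  move=> xy; pose c : V := 2^-1 *: (x + y).
  have r0 : 0 < theta ^+ j / 2 by rewrite divr_gt0.
  have [z zr [h1 h2]] := @ae_cube_exists _ c _ r0 (filterI (mP x j) (mP y j)).
  have cx : c - x = 2^-1 *: (y - x) by apply/rowP => i; rewrite !mxE; field.
  have cy : c - y = 2^-1 *: (x - y) by apply/rowP => i; rewrite !mxE; field.
  have zx : `|z - x| <= theta ^+ j.
    rewrite -(subrKA c); apply: (le_trans (ler_normD _ _)).
    by rewrite cx normrZ [`|y - x|]distrC ger0_norm//; lra.
  have zy : `|z - y| <= theta ^+ j.
    rewrite -(subrKA c); apply: (le_trans (ler_normD _ _)).
    by rewrite cy normrZ ger0_norm//; lra.
  have /andP[h3 _] := h1 zx; have /andP[_ h4] := h2 zy.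
  exact: le_trans h3 h4.
(* The intervals [m x j, m x j + w j] pairwise intersect for fixed [x], so the
   supremum of their left ends lies in all of them. *)
pose S x : set R := range (m x).
have Sub x j : ubound (S x) (m x j + w j) by move=> _ [k _ <-].
have supS x : has_sup (S x).
  split; first by exists (m x 0%N), 0%N.
  by exists (m x 0%N + w 0%N); exact: Sub.
pose v x := sup (S x).
have v_ge x j : m x j <= v x.
  by apply: (sup_upper_bound (supS x)); exists j.
have v_le x j : v x <= m x j + w j.
  by apply: ge_sup; [exact: (supS x).1|exact: Sub].
have v_osc x y j : `|x - y| <= theta ^+ j -> `|v x - v y| <= 2 * w j.
  move=> xy; have yx : `|y - x| <= theta ^+ j by rewrite distrC.
  have h1 := mxy x y j xy; have h2 := mxy y x j yx.
  have := v_ge x j; have := v_le x j; have := v_ge y j; have := v_le y j.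
  by rewrite ler_norml; move: h1 h2; clear => *; apply/andP; split; lra.
have mM x j : m x j <= M /\ - w j <= m x j.
  have [y yr [h1 /andP[h2 h3]]] := @ae_cube_exists _ x _ (tj j) (filterI (mP x j) uM).
  by have /andP[h4 h5] := h1 yr; move: h2 h3 h4 h5; clear => *; split; lra.
have vM x : `|v x| <= M + 2 * omega0.
  have w00 : w 0%N = omega0 by rewrite /w expr0 mulr1.
  have [h1 h2] := mM x 0%N; have := v_ge x 0%N; have := v_le x 0%N.
  rewrite w00 in h2 *.
  by rewrite ler_norml; move: h1 h2; clear => *; apply/andP; split; lra.
exists v; split.
- have : {ae mu, forall x, forall cj : 'rV[rat]_n * nat,
      `|x - map_mx ratr cj.1| <= theta ^+ cj.2 ->
      m (map_mx ratr cj.1) cj.2 <= u x <= m (map_mx ratr cj.1) cj.2 + w cj.2}.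
    by apply: ae_forall_countType => -[c j]; exact: mP.
  apply: filterS => x hx _.
  have close j : `|u x - v x| <= 4 * w j.
    have [c xc] := rational_approx x (tj j).
    have /andP[h1 h2] := hx (c, j) xc.
    have := v_osc x (map_mx ratr c) j xc.
    have := v_ge (map_mx ratr c) j; have := v_le (map_mx ratr c) j.
    move: h1 h2 => /=; move: (m _ _) (v (map_mx _ _)) => m' v' h1 h2 h3 h4.
    rewrite !ler_norml => /andP[h5 h6]; move: h1 h2 h3 h4 h5 h6; clear => *.
    by apply/andP; split; lra.
  apply/eqP; rewrite -subr_eq0 -normr_eq0 eq_le normr_ge0 andbT.
  have cv : (fun j => 4 * w j) @ \oo --> (0 : R).
    have : (fun j => geometric (4 * omega0) a j) @ \oo --> (0 : R).
      by apply: cvg_geometric; rewrite gtr0_norm.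
    by apply: cvg_trans; apply: near_eq_cvg; apply: nearW => j /=; rewrite /w mulrA.
  rewrite -(cvg_lim _ cv)//; apply: limr_ge; first exact: cvgP cv.
  by apply: nearW => j; exact: close.
- by exists (M + 2 * omega0).
(* The first summand serves [|x - y| > 1], through the bound on [v]; the second serves
   [|x - y| <= 1], where dividing by [a] pays for passing from [theta ^+ i] to
   [theta ^+ i.+1 < |x - y|]. *)
- move=> Omega _; exists (2 * (M + 2 * omega0) + 2 * omega0 / a) => x y _ _ xy.
  have D0 : 0 < `|x - y| by rewrite normr_gt0 subr_eq0.
  have De := norm_le_euclidean_norm (x - y).
  have e0 := lt_le_trans D0 De.
  have C1 : 0 <= 2 * (M + 2 * omega0) by lra.
  have C2 : 0 <= 2 * omega0 / a by rewrite divr_ge0 ?mulr_ge0 ?(ltW o0) ?(ltW a0).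
  have Da : `|x - y| `^ alpha <= euclidean_norm (x - y) `^ alpha.
    by rewrite ge0_ler_powR ?nnegrE ?(ltW al0) ?(ltW e0).
  rewrite ler_pdivrMr ?powR_gt0//; apply: le_trans (ler_wpM2l (addr_ge0 C1 C2) Da).
  case: (leP `|x - y| 1) => D1.
    have [i [h1 h2]] : exists i, theta ^+ i.+1 < `|x - y| /\ `|x - y| <= theta ^+ i.
      have [j hj] : exists j, theta ^+ j < `|x - y|.
        have /cvgrPdist_lt /(_ _ D0) [j _ hj] : theta ^+ k @[k --> \oo] --> (0 : R).
          by apply: cvg_expr; rewrite gtr0_norm.
        exists j; have := hj j (leqnn j); rewrite sub0r normrN gtr0_norm//.
      have t01 : 0 < theta < 1 by rewrite t0.
      by have [i [_ h1 h2]] := exists_shell t01 hj D1; exists i.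
    apply: (le_trans (v_osc x y i h2)); rewrite [leRHS]mulrDl.
    apply: (@le_trans _ _ (2 * omega0 / a * `|x - y| `^ alpha)); last first.
      by rewrite lerDr mulr_ge0// powR_ge0.
    have -> : 2 * w i = 2 * omega0 / a * a ^+ i.+1.
      by rewrite /w exprS; field; rewrite gt_eqF.
    rewrite ler_wpM2l// /a -powR_exprn ?(ltW t0)//.
    by rewrite ge0_ler_powR ?nnegrE ?(ltW al0) ?(ltW (tj _)) ?(ltW h1).
  have p1 : 1 <= `|x - y| `^ alpha.
    by rewrite -[leLHS](powRr0 `|x - y|) ler_powR ?(ltW D1) ?(ltW al0).
  apply: (@le_trans _ _ (2 * (M + 2 * omega0))).
    by apply: (le_trans (ler_normB _ _)); have := vM x; have := vM y; clear; lra.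
  apply: (@le_trans _ _ (2 * (M + 2 * omega0) + 2 * omega0 / a)); first by rewrite lerDl.
  by rewrite ler_peMr// addr_ge0.
Qed.

End hoelder_representative.

(** * The Sobolev inequality *)

Section sobolev.
Context {R : realType} {n : nat}.
Local Notation mu := (lebesgue_measure_rV R n).
Local Notation V := 'rV[R]_n.
Implicit Types (x y c : V) (f : V -> R).

Lemma chebyshev_powR f (P t X : R) : 0 < P -> 0 < t -> measurable_fun setT f ->
  (\int[mu]_y (`|f y| `^ P)%:E = X%:E)%E ->
  (mu [set y | (t < `|f y|)%R] <= (X / t `^ P)%:E)%E.
Proof.
move=> P0 t0 mf fX.
have tP : 0 < t `^ P by rewrite powR_gt0.
have mfa : measurable_fun setT (fun y => `|f y|) by exact: measurable_fun_normr.
have mB : measurable [set y | t < `|f y|].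
  have -> : [set y | t < `|f y|] = setT `&` (fun y => `|f y|) @^-1` `]t, +oo[.
    by rewrite setTI; apply/seteqP; split => y; rewrite /= in_itv/= andbT.
  exact: mfa.
rewrite EFinM -fX -ge0_integralZr; last 4 first.
- exact: measurableT.
- by apply/measurable_EFinP; exact: measurable_fun_powR.
- by move=> y _; rewrite lee_fin powR_ge0.
- by rewrite lee_fin invr_ge0 ltW.
have -> : mu [set y | t < `|f y|] = (\int[mu]_y (\1_[set y | (t < `|f y|)%R] y)%:E)%E.
  by rewrite integral_indic// setIT.
apply: ge0_le_integral => //.
- by apply/measurable_EFinP; exact: measurable_indic.
- by apply/measurable_EFinP; apply: measurable_funM => //; exact: measurable_fun_powR.
move=> y _; rewrite -EFinM lee_fin indicE.
case: (boolP (y \in _)) => [/set_mem/= h|_]; last by rewrite divr_ge0 ?powR_ge0// ltW.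
by rewrite ler_pdivlMr// mul1r ge0_ler_powR ?nnegrE ?(ltW P0) ?(ltW t0)// ltW.
Qed.

(* Choose the cube around [x] whose volume is twice the Chebyshev bound for
   the set where [|f| > |f x| / 2]: on at least half of it,
   [|f x - f y| >= |f x| / 2]. *)
Lemma sobolev_pointwise (s p : R) : (0 < n)%N -> 0 < s -> 0 < p -> s * p < n%:R ->
  exists C, 0 < C /\ forall f (X : R), measurable_fun setT f -> 0 < X ->
  (\int[mu]_y (`|f y| `^ sobolev_exponent n s p)%:E = X%:E)%E ->
  forall x, ((`|f x| `^ sobolev_exponent n s p)%:E <=
    (C * X `^ (s * p / n%:R))%:E * \int[mu]_y (gagliardo_density s p f (x, y))%:E)%E.
Proof.
move=> n0 s0 p0 spn.
have nn0 : (0 : R) < n%:R by rewrite ltr0n.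
have sp0 : 0 < s * p by rewrite mulr_gt0.
set P := sobolev_exponent n s p; pose e := s * p / n%:R.
have nsp : 0 < n%:R - s * p by rewrite subr_gt0.
have P0 : 0 < P by rewrite divr_gt0// mulr_gt0.
(* This identity balances the powers of [|f x|]: [p] comes from the increment, [P * e] from the
   dependence of the size of the cube on [f x]. *)
have PE : P = p + P * e by rewrite /P /e /sobolev_exponent; field; rewrite !gt_eqF.
pose K : R := (n%:R `^ (n%:R + s * p))^-1 * (2 ^+ n / 2) / (2 / 2 ^+ n) `^ e.
have e2 : (0 : R) < 2 ^+ n by rewrite exprn_gt0.
have K0 : 0 < K.
  rewrite /K divr_gt0 ?powR_gt0 ?divr_gt0// mulr_gt0 ?divr_gt0//.
  by rewrite invr_gt0 powR_gt0.
exists (2 `^ P / K); split; first by rewrite divr_gt0// powR_gt0.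
move=> f X mf X0 fX x.
have gd0 y : 0 <= gagliardo_density s p f (x, y) by exact: gagliardo_density_ge0.
have [fx0|fxn] := eqVneq (f x) 0.
  rewrite fx0 normr0 powR0 ?gt_eqF//; apply: mule_ge0.
    by rewrite lee_fin mulr_ge0 ?powR_ge0// ltW// divr_gt0// powR_gt0.
  by apply: integral_ge0 => y _; rewrite lee_fin.
have t0 : 0 < `|f x| by rewrite normr_gt0.
set t := `|f x| in t0 *.
pose t2 := t / 2; have t20 : 0 < t2 by rewrite divr_gt0.
pose Y := X / t2 `^ P; have Y0 : 0 < Y by rewrite divr_gt0// powR_gt0.
pose Z := 2 / 2 ^+ n * Y; have Z0 : 0 < Z by rewrite mulr_gt0// divr_gt0.
pose rho := Z `^ n%:R^-1; have rho0 : 0 < rho by rewrite powR_gt0.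
have rhon : rho ^+ n = Z.
  rewrite /rho -powR_mulrn ?powR_ge0// -powRrM mulVf ?gt_eqF//.
  by rewrite powRr1// ltW.
have cubeY : (2 * rho) ^+ n = 2 * Y.
  by rewrite exprMn rhon /Z; field; rewrite gt_eqF.
have bad := chebyshev_powR P0 t20 mf fX.
rewrite -/Y in bad.
pose Bad := [set y | (t2 < `|f y|)%R].
have mBad : measurable Bad.
  have -> : Bad = setT `&` (fun y => `|f y|) @^-1` `]t2, +oo[.
    by rewrite setTI; apply/seteqP; split => y; rewrite /= in_itv/= andbT.
  exact: (measurable_fun_normr mf).
pose Good := cube x rho `\` Bad.
have mGood : measurable Good by apply: measurableD => //; exact: measurable_cube.
have goodY : (Y%:E <= mu Good)%E.
  have sub : cube x rho `<=` Good `|` Bad.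
    by move=> y yr; have [h|h] := pselect (Bad y); [right|left].
  have := le_trans (le_measure mu _ _ sub) (measureU2 mu mGood mBad).
  rewrite !inE => /(_ (measurable_cube _ _) (measurableU _ _ mGood mBad)).
  rewrite [X in (X <= _)%E -> _]measure_cube ?(ltW rho0)// cubeY => h.
  rewrite leNgt; apply/negP => hG.
  have finB : mu [set y | (t2 < `|f y|)%R] \is a fin_num.
    by rewrite ge0_fin_numE//; exact: le_lt_trans bad (ltry _).
  have := le_lt_trans h (lte_leD finB hG bad); rewrite -EFinD lte_fin; lra.
pose k := (n%:R * rho) `^ (n%:R + s * p).
have k0 : 0 < k by rewrite powR_gt0// mulr_gt0.
have low : ((t2 `^ p / k * Y)%:E <= \int[mu]_y (gagliardo_density s p f (x, y))%:E)%E.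
  apply: (@le_trans _ _ (\int[mu]_y ((t2 `^ p / k)%:E * (\1_Good y)%:E))%E).
    rewrite ge0_integralZl_EFin; last 4 first.
    - exact: measurableT.
    - by move=> y _; rewrite lee_fin.
    - by apply/measurable_EFinP; exact: measurable_indic.
    - by rewrite divr_ge0 ?powR_ge0.
    rewrite integral_indic// setIT EFinM lee_wpmul2l// lee_fin.
    by rewrite divr_ge0 ?powR_ge0.
  apply: ge0_le_integral.
  - exact: measurableT.
  - by move=> y _; rewrite -EFinM lee_fin mulr_ge0 ?divr_ge0 ?powR_ge0.
  - by apply/measurable_EFinP/measurable_funM => //; exact: measurable_indic.
  - apply/measurable_EFinP; apply: (measurableT_comp (measurable_gagliardo_density s p mf)).
    exact: pair1_measurable.
  move=> y _; rewrite -EFinM lee_fin indicE.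
  case: (boolP (y \in Good)) => [/set_mem [yr /negP yb]|_]; last by rewrite mulr0.
  rewrite mulr1 /gagliardo_density /=; rewrite -leNgt in yb.
  have df : t2 <= `|f x - f y|.
    have := ler_distD (f y) (f x) 0; rewrite !subr0 -/t.
    by move: yb; rewrite /t2; lra.
  have xy : x - y != 0.
    rewrite subr_eq0; apply/eqP => xy; move: yb; rewrite -xy -/t /t2; lra.
  apply: ler_pM; rewrite ?powR_ge0 ?invr_ge0 ?powR_ge0//.
    by rewrite ge0_ler_powR ?nnegrE ?(ltW p0) ?(ltW t20).
  by apply: kernel_ge => //; rewrite distrC.
apply: le_trans (lee_wpmul2l _ low); last first.
  by rewrite lee_fin mulr_ge0 ?powR_ge0// ltW// divr_gt0// powR_gt0.
rewrite -EFinM lee_fin le_eqVlt; apply/orP; left; apply/eqP.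
have tE : t `^ P = 2 `^ P * (t2 `^ p * t2 `^ (P * e)).
  rewrite -gt0_powRD// -PE -powRM ?(ltW t20)//; congr (_ `^ _).
  by rewrite /t2; field.
have kE : k = n%:R `^ (n%:R + s * p) * (Z * Z `^ e).
  rewrite /k powRM ?(ltW rho0) ?ler0n//; congr (_ * _).
  rewrite gt0_powRD// powR_mulrn ?(ltW rho0)// rhon; congr (_ * _).
  by rewrite /rho -powRrM /e mulrC.
have ZE : Z `^ e = (2 / 2 ^+ n) `^ e * (X `^ e / t2 `^ (P * e)).
  rewrite /Z powRM ?(ltW Y0) ?divr_ge0//; congr (_ * _).
  by rewrite /Y powRM ?invr_ge0 ?powR_ge0 ?(ltW X0)// invr_powR ?powR_ge0// -powRrM.
rewrite -/e tE kE ZE /Z /K.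
have n1 : n%:R `^ (n%:R + s * p) != 0 :> R by rewrite gt_eqF// powR_gt0.
have n2 : (2 / 2 ^+ n) `^ e != 0 :> R by rewrite gt_eqF// powR_gt0// divr_gt0.
have n3 : X `^ e != 0 by rewrite gt_eqF// powR_gt0.
have n4 : t2 `^ (P * e) != 0 by rewrite gt_eqF// powR_gt0.
have n5 : (2 : R) ^+ n != 0 by rewrite gt_eqF.
have n6 : Y != 0 by rewrite gt_eqF.
field.
by rewrite ?n1 ?n2 ?n3 ?n4 ?n5 ?n6.
Qed.

(** Integrating the pointwise estimate gives [X <= C * X ^ (s * p / n) * G], and
    [1 - s * p / n = p / P]. Dividing by the power of [X] requires [X] to be finite and non-zero. *)
Lemma sobolev (s p : R) : (0 < n)%N -> 0 < s -> 0 < p -> s * p < n%:R ->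
  exists C, 0 < C /\ forall f, measurable_fun setT f ->
  (\int[mu]_y (`|f y| `^ sobolev_exponent n s p)%:E < +oo)%E ->
  finite_gagliardo s p f ->
  fine (\int[mu]_y (`|f y| `^ sobolev_exponent n s p)%:E)
    `^ (p / sobolev_exponent n s p) <=
  C * fine (\int[mu \x mu]_z (gagliardo_density s p f z)%:E).
Proof.
move=> n0 s0 p0 spn; have [C [C0 H]] := sobolev_pointwise n0 s0 p0 spn.
exists C; split => // f mf; set P := sobolev_exponent n s p => fX ff.
have nn0 : (0 : R) < n%:R by rewrite ltr0n.
have nsp : 0 < n%:R - s * p by rewrite subr_gt0.
have P0 : 0 < P by rewrite divr_gt0// mulr_gt0.
have X0 : (0 <= \int[mu]_y (`|f y| `^ P)%:E)%E.
  by apply: integral_ge0 => y _; rewrite lee_fin powR_ge0.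
have G0 : (0 <= \int[mu \x mu]_z (gagliardo_density s p f z)%:E)%E.
  by apply: integral_ge0 => z _; rewrite lee_fin gagliardo_density_ge0.
have Xfin : (\int[mu]_y (`|f y| `^ P)%:E)%E \is a fin_num by rewrite ge0_fin_numE.
have Gfin : (\int[mu \x mu]_z (gagliardo_density s p f z)%:E)%E \is a fin_num.
  by rewrite ge0_fin_numE//; exact: ff.
have XE := esym (fineK Xfin); have GE := esym (fineK Gfin).
set X := fine _ in XE *; set G := fine _ in GE *.
rewrite XE lee_fin in X0; rewrite GE lee_fin in G0.
have [->|Xn] := eqVneq X 0.
  by rewrite powR0 ?mulr_ge0 ?(ltW C0)// gt_eqF// divr_gt0.
have Xpos : 0 < X by rewrite lt0r Xn.
have mgd : measurable_fun setT (fun z => (gagliardo_density s p f z)%:E).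
  by apply/measurable_EFinP; exact: measurable_gagliardo_density.
have gd0 z : (0 <= (gagliardo_density s p f z)%:E)%E.
  by rewrite lee_fin gagliardo_density_ge0.
have key : X <= C * X `^ (s * p / n%:R) * G.
  rewrite -lee_fin -XE EFinM -GE.
  rewrite (fubini_tonelli1 _ mgd gd0).
  rewrite -ge0_integralZl_EFin; last 4 first.
  - exact: measurableT.
  - by move=> x _; apply: integral_ge0 => y _; rewrite lee_fin gagliardo_density_ge0.
  - exact: (measurable_fun_fubini_tonelli_F _ mgd gd0).
  - by rewrite mulr_ge0 ?powR_ge0// ltW.
  apply: ge0_le_integral; [exact: measurableT| | | |].
  - by move=> y _; rewrite lee_fin powR_ge0.
  - by apply/measurable_EFinP/measurable_fun_powR/measurable_fun_normr.
  - apply: measurable_funeM.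
    exact: (measurable_fun_fubini_tonelli_F _ mgd gd0).
  - by move=> x _; exact: H.
have -> : p / P = 1 - s * p / n%:R.
  rewrite /P /sobolev_exponent; field.
  by rewrite !gt_eqF.
rewrite powRB ?Xn ?implybT// powRr1 ?(ltW Xpos)// ler_pdivrMr ?powR_gt0//.
by apply: (le_trans key); rewrite mulrAC.
Qed.

End sobolev.

(** * Boundedness *)

Lemma de_giorgi_iteration (R : realType) (D b g : R) : 0 < D -> 1 < b -> 1 < g ->
  exists eta rho, [/\ 0 < eta, 0 < rho < 1 & forall y : nat -> R,
    (forall j, 0 <= y j) -> (forall j, y j.+1 <= (D * b ^+ j * y j) `^ g) ->
    y 0%N <= eta -> forall j, y j <= eta * rho ^+ j].
Proof.
move=> D0 b1 g1; have b0 : 0 < b by lra.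
have g0 : 0 < g by lra.
have gm : 0 < g - 1 by lra.
(* [rho] solves [b `^ g * rho `^ (g - 1) = 1], then [eta] is chosen so that
   [D `^ g * eta `^ (g - 1) = rho]. *)
have [rho rhoD] : exists rho, rho = b `^ (- (g / (g - 1))) by eexists.
have r0 : 0 < rho by rewrite rhoD powR_gt0.
have r1 : rho < 1.
  have := @gt0_ltr_powR R (g / (g - 1)) (divr_gt0 g0 gm) 1 b.
  rewrite !nnegrE powR1 rhoD powRN => h.
  by rewrite invf_lt1 ?powR_gt0//; apply: h => //; exact: ltW.
have [eta etaD] : exists eta, eta = D `^ (- (g / (g - 1))) * rho `^ (g - 1)^-1.
  by eexists.
have e0 : 0 < eta by rewrite etaD mulr_gt0// powR_gt0.
have etaE : D `^ g * eta `^ (g - 1) = rho.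
  rewrite etaD powRM ?powR_ge0// -!powRrM mulVf ?gt_eqF// powRr1 ?(ltW r0)//.
  rewrite mulNr divfK ?gt_eqF// powRN mulrA mulfV ?mul1r// gt_eqF//.
  exact: powR_gt0.
have rhoE : b `^ g * rho `^ (g - 1) = 1.
  rewrite rhoD -powRrM mulNr divfK ?gt_eqF// powRN mulfV// gt_eqF//.
  exact: powR_gt0.
have spl x : 0 < x -> x `^ g = x * x `^ (g - 1).
  by move=> x0; rewrite mulr_powRB1// ltW.
exists eta, rho; split; rewrite ?r0//.
move=> y y0 yS h0; elim => [|j IH]; first by rewrite expr0 mulr1.
apply: (le_trans (yS j)).
have pj : 0 < eta * rho ^+ j by rewrite mulr_gt0// exprn_gt0.
apply: (@le_trans _ _ ((D * b ^+ j * (eta * rho ^+ j)) `^ g)).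
  have Db : 0 <= D * b ^+ j by rewrite mulr_ge0 ?exprn_ge0// ltW.
  apply: ge0_ler_powR; rewrite ?nnegrE ?(ltW g0)//.
  - exact: mulr_ge0.
  - by rewrite mulr_ge0// ltW.
  - exact: ler_wpM2l.
rewrite powRM ?mulr_ge0 ?exprn_ge0 ?(ltW D0) ?(ltW b0) ?(ltW e0) ?(ltW r0)//.
rewrite powRM ?exprn_ge0 ?(ltW D0) ?(ltW b0)//.
rewrite [(eta * _) `^ g]powRM ?exprn_ge0 ?(ltW e0) ?(ltW r0)//.
rewrite !powR_exprn ?(ltW b0) ?(ltW r0)// (spl eta e0).
have -> : (rho `^ g) ^+ j = rho ^+ j * (rho `^ (g - 1)) ^+ j.
  by rewrite (spl rho r0) exprMn.
have e1 : (b `^ g) ^+ j * (rho `^ (g - 1)) ^+ j = 1.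
  by rewrite -exprMn rhoE expr1n.
rewrite exprS -[X in _ <= _ * (X * _)]etaE.
set A := D `^ g; set B := eta `^ (g - 1); set F := _ ^+ j in e1 *.
set G := (rho `^ (g - 1)) ^+ j in e1 *.
have -> : A * F * (eta * B * (rho ^+ j * G)) = (F * G) * (A * B * eta * rho ^+ j) by ring.
by rewrite e1 mul1r le_eqVlt; apply/orP; left; apply/eqP; ring.
Qed.

Section boundedness.
Context {R : realType} {n : nat}.
Local Notation mu := (lebesgue_measure_rV R n).
Local Notation V := 'rV[R]_n.
Implicit Types (x y c : V) (u v phi : V -> R).

Definition truncation (k : R) u x : R := Num.max (u x - k) 0.

Lemma truncation_ge0 k u x : 0 <= truncation k u x.
Proof. by rewrite /truncation le_max lexx orbT. Qed.

Lemma truncation_le_norm k u x : 0 <= k -> truncation k u x <= `|u x|.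
Proof.
move=> k0; rewrite /truncation ge_max normr_ge0 andbT.
by have := ler_norm (u x); lra.
Qed.

Lemma measurable_truncation k u : measurable_fun setT u ->
  measurable_fun setT (truncation k u).
Proof. by move=> mu_; apply: measurable_maxr => //; exact: measurable_funB. Qed.

Lemma truncation_contraction k u x y :
  `|truncation k u x - truncation k u y| <= `|u x - u y|.
Proof.
apply: le_trans (normr_max_sub_le _ _ _ _) _.
rewrite subrr normr0 addr0 le_eqVlt; apply/orP; left; apply/eqP.
by congr (`|_|); ring.
Qed.

Lemma truncation_monotone k u x y :
  0 <= (u x - u y) * (truncation k u x - truncation k u y).
Proof.
rewrite /truncation; case: (leP (u x - k) 0) => hx; case: (leP (u y - k) 0) => hy.
- by rewrite subrr mulr0.
- by rewrite mulr_le0//; lra.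
- by rewrite mulr_ge0//; lra.
- by rewrite (_ : u x - k - (u y - k) = u x - u y) -?expr2 ?sqr_ge0//; ring.
Qed.

Lemma gagliardo_truncation_le s m k u z : 2 < m ->
  gagliardo_density s m (truncation k u) z <=
  energy_density s m u (truncation k u) z.
Proof.
move=> m2; rewrite /gagliardo_density /energy_density ler_wpM2r ?kernel_ge0//.
by apply: Jfun_mul_ge => //; [exact: truncation_contraction|exact: truncation_monotone].
Qed.

Lemma finite_gagliardo_truncation s m k u : 0 < m -> measurable_fun setT u ->
  finite_gagliardo s m u -> finite_gagliardo s m (truncation k u).
Proof.
move=> m0 mu_ fu; apply: le_lt_trans fu; apply: ge0_le_integral.
- exact: measurableT.
- by move=> z _; rewrite lee_fin gagliardo_density_ge0.
- apply/measurable_EFinP; apply: measurable_gagliardo_density.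
  exact: measurable_truncation.
- by apply/measurable_EFinP; exact: measurable_gagliardo_density.
move=> z _; rewrite lee_fin ler_wpM2r ?kernel_ge0// ge0_ler_powR ?nnegrE ?(ltW m0)//.
exact: truncation_contraction.
Qed.

Lemma Lfun_truncation k u (t : R) : 0 < t -> 0 <= k ->
  u \in Lfun mu t%:E -> truncation k u \in Lfun mu t%:E.
Proof.
move=> t0 k0 ut; have mu_ := Lfun_measurable ut.
have mt := measurable_truncation k mu_.
apply/(LfunP_real t0 mt); have := (LfunP_real t0 mu_).1 ut.
apply: le_lt_trans; apply: ge0_le_integral.
- exact: measurableT.
- by move=> x _; rewrite lee_fin powR_ge0.
- by apply/measurable_EFinP/measurable_fun_powR/measurable_fun_normr.
- by apply/measurable_EFinP/measurable_fun_powR/measurable_fun_normr.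
move=> x _; rewrite lee_fin ge0_ler_powR ?nnegrE ?(ltW t0)//.
by rewrite ger0_norm ?truncation_ge0// truncation_le_norm.
Qed.

Lemma gagliardo_truncation_le_pq_energy s p q k u : 2 < p -> 2 < q ->
  measurable_fun setT u -> finite_gagliardo s p u -> finite_gagliardo s q u ->
  (\int[mu \x mu]_z (gagliardo_density s p (truncation k u) z)%:E <=
   pq_energy s p q u (truncation k u))%E.
Proof.
move=> p2 q2 mu_ up uq.
have p0 : 0 < p by lra.
have q0 : 0 < q by lra.
have mt := measurable_truncation k mu_.
have tp := finite_gagliardo_truncation k p0 mu_ up.
have tq := finite_gagliardo_truncation k q0 mu_ uq.
rewrite (pq_energyE p2 q2 mu_ mt up uq tp tq).
rewrite -[leLHS]adde0; apply: leeD.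
  apply: le_integral.
  - exact: measurableT.
  - exact: integrable_gagliardo_density.
  - exact: (integrable_energy_density p2 mu_ mt up tp).
  - by move=> z _; rewrite lee_fin gagliardo_truncation_le.
apply: integral_ge0 => z _; rewrite lee_fin.
by apply: le_trans (gagliardo_truncation_le _ _ _ _ q2); exact: gagliardo_density_ge0.
Qed.

End boundedness.

(** * Testing the equation with truncations *)

Section weak_solutions.
Context {R : realType} {n : nat}.
Local Notation mu := (lebesgue_measure_rV R n).
Local Notation V := 'rV[R]_n.
Implicit Types (x y c : V) (u v g phi : V -> R).

(** The norm of [Lfun mu +oo] is an essential supremum only when the whole space has positive
    measure. *)
Lemma measure_rV_setT_gt0 : (0 < mu setT)%E.
Proof.
apply: (@lt_le_trans _ _ (mu (cube 0 1))).
  by rewrite [ltRHS]measure_cube// lte_fin exprn_gt0// mulr_gt0.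
apply: le_measure; [rewrite inE; exact: measurable_cube|by rewrite inE|by []].
Qed.

Lemma Lfun_infty_bounded g : g \in Lfun mu +oo%E ->
  exists2 G, 0 <= G & {ae mu, forall x, `|g x| <= G}.
Proof.
move=> /andP[_ /[!inE]]; rewrite /= /finite_norm unlock measure_rV_setT_gt0.
have := ess_sup_ge mu (abse \o (EFin \o g)).
case: (ess_sup _ _) => [e h _| //|h _].
  exists (Num.max e 0); first by rewrite le_max lexx orbT.
  by apply: filterS h => x /=; rewrite lee_fin le_max => ->.
by exists 0 => //; apply: filterS h => x /=; rewrite leeNy_eq.
Qed.

Lemma Lfun_infty_of_bounded g (M : R) : measurable_fun setT g ->
  {ae mu, forall x, `|g x| <= M} -> g \in Lfun mu +oo%E.
Proof.
move=> mg gM; apply/andP; split; first by rewrite inE.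
rewrite inE /= /finite_norm unlock measure_rV_setT_gt0.
apply: (@le_lt_trans _ _ M%:E); last exact: ltry.
by apply/ess_supP; apply: filterS gM => x; rewrite /= lee_fin.
Qed.

Variables (s p q r lambda : R) (g u : V -> R) (G : R).
Hypothesis n0 : (0 < n)%N.
Hypothesis s01 : 0 < s < 1.
Hypothesis q2 : 2 < q.
Hypothesis qp : q <= p.
Hypothesis pr : p < r.
Hypothesis rP : r < sobolev_exponent n s p.
Hypothesis spn : s * p < n%:R.
Hypothesis lambda0 : 0 < lambda.
Hypothesis mg : measurable_fun setT g.
Hypothesis G0 : 0 <= G.
Hypothesis gG : {ae mu, forall x, `|g x| <= G}.
Hypothesis uW : weak_solution s p q r lambda g u.

Let P : R := sobolev_exponent n s p.
Let s0 : 0 < s. Proof. by case/andP: s01. Qed.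
Let p2 : 2 < p. Proof. exact: lt_le_trans qp. Qed.
Let p0 : 0 < p. Proof. by have := p2; lra. Qed.
Let q0 : 0 < q. Proof. by have := q2; lra. Qed.
Let sqn : s * q < n%:R.
Proof. by apply: le_lt_trans spn; rewrite ler_wpM2l// ltW. Qed.
Let pP : p < P. Proof. exact: lt_trans rP. Qed.
Let P0 : 0 < P. Proof. by have := p0; have := pP; lra. Qed.
Let nn0 : (0 : R) < n%:R. Proof. by rewrite ltr0n. Qed.

Let uP := (WspaceP s u p0 q0).1 (let: And3 h _ _ := uW in h).
Let uLP : u \in Lfun mu P%:E. Proof. by case: uP. Qed.
Let mu_ : measurable_fun setT u. Proof. exact: Lfun_measurable uLP. Qed.
Let fup : finite_gagliardo s p u. Proof. by case: uP. Qed.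
Let fuq : finite_gagliardo s q u. Proof. by case: uP. Qed.

Let critical phi x : R := u^\+ x `^ (P - 2) * u^\+ x * phi x.
Let subcritical phi x : R := g x * (u^\+ x `^ (r - 2)) * u^\+ x * phi x.

Lemma measurable_critical phi : measurable_fun setT phi ->
  measurable_fun setT (critical phi).
Proof.
move=> mphi; have mup := measurable_funrpos mu_.
by do 2 apply: measurable_funM => //; exact: measurable_fun_powR.
Qed.

Lemma measurable_subcritical phi : measurable_fun setT phi ->
  measurable_fun setT (subcritical phi).
Proof.
move=> mphi; have mup := measurable_funrpos mu_.
by do 3 apply: measurable_funM => //; exact: measurable_fun_powR.
Qed.

(** Applied with [h] the critical power of a truncation, for the De Giorgi step, and with [h = phi],
    once [u] is known to be bounded. *)
Lemma weak_rhs_le phi (h : V -> R) (A B : R) : measurable_fun setT phi ->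
  measurable_fun setT h -> (forall x, 0 <= h x) -> 0 <= A -> 0 <= B ->
  {ae mu, forall x, `|critical phi x| <= A * h x} ->
  {ae mu, forall x, `|subcritical phi x| <= B * h x} ->
  Wspace s p q phi ->
  (`|pq_energy s p q u phi| <= (A + lambda * B)%:E * \int[mu]_x (h x)%:E)%E.
Proof.
move=> mphi mh h0 A0 B0 hA hB W.
have [_ _ -> //] := uW; rewrite -/P.
have bound (f : V -> R) (C : R) : measurable_fun setT f -> 0 <= C ->
    {ae mu, forall x, `|f x| <= C * h x} ->
    (`|\int[mu]_x (f x)%:E| <= C%:E * \int[mu]_x (h x)%:E)%E.
  move=> mf C0 fC.
  apply: (@le_trans _ _ (\int[mu]_x `|(f x)%:E|)%E).
    by apply: le_abse_integral => //; exact/measurable_EFinP.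
  rewrite -ge0_integralZl_EFin//; last 2 first.
  - by move=> x _; rewrite lee_fin.
  - exact/measurable_EFinP.
  apply: ae_ge0_le_integral => //.
  - exact/measurable_EFinP/measurable_fun_normr.
  - by move=> x _; rewrite -EFinM lee_fin mulr_ge0.
  - by apply: measurable_funeM; exact/measurable_EFinP.
  - by apply: filterS fC => x fx _; rewrite -EFinM /= lee_fin.
apply: (le_trans (lee_abs_add _ _)).
rewrite EFinD ge0_muleDl ?lee_fin//; last by rewrite mulr_ge0// ltW.
apply: leeD.
  by apply: (bound (critical phi)) => //; exact: measurable_critical.
rewrite abseM EFinM -muleA abse_EFin gtr0_norm//; apply: lee_wpmul2l.
  by rewrite lee_fin ltW.
by apply: (bound (subcritical phi)) => //; exact: measurable_subcritical.
Qed.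


Let trunc_interaction k k' x : 1 <= k -> k < k' ->
  u^\+ x `^ (P - 1) * truncation k' u x <=
  (k' / (k' - k)) `^ (P - 1) * `|truncation k u x| `^ P.
Proof.
move=> k1 kk; have P1 : 0 < P - 1 by have := pP; have := p2; lra.
rewrite (ger0_norm (truncation_ge0 _ _ _)).
have kk0 : 0 < k' - k by lra.
have [ux|ux] := leP (u x) k'.
  have -> : truncation k' u x = 0 by rewrite /truncation max_r//; lra.
  by rewrite mulr0 mulr_ge0 ?powR_ge0.
have -> : truncation k' u x = u x - k' by rewrite /truncation max_l//; lra.
have -> : truncation k u x = u x - k by rewrite /truncation max_l//; lra.
have -> : u^\+ x = u x by rewrite /funrpos max_l//; lra.
have uk : 0 < u x - k by lra.
rewrite -(mulr_powRB1 (ltW uk) P0) mulrCA mulrC.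
apply: ler_pM; rewrite ?powR_ge0//; try lra.
have a0 : 0 <= k' / (k' - k) by rewrite divr_ge0//; lra.
rewrite -powRM ?(ltW uk)//.
apply: ge0_ler_powR; rewrite ?nnegrE ?(ltW P1)//; first lra.
  by rewrite (mulr_ge0 a0)// ltW.
by rewrite mulrAC ler_pdivlMr//; nra.
Qed.

Let criticalE phi x : critical phi x = u^\+ x `^ (P - 1) * phi x.
Proof.
rewrite /critical; congr (_ * _); rewrite mulrC.
have -> : P - 2 = (P - 1) - 1 by ring.
by rewrite mulr_powRB1 ?funrpos_ge0//; have := pP; have := p2; lra.
Qed.

Let subcriticalE phi x : subcritical phi x = g x * (u^\+ x `^ (r - 1) * phi x).
Proof.
rewrite /subcritical -!mulrA; congr (_ * _); rewrite mulrA; congr (_ * _).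
rewrite mulrC; have -> : r - 2 = (r - 1) - 1 by ring.
by rewrite mulr_powRB1 ?funrpos_ge0//; have := pr; have := p2; lra.
Qed.

Let Wspace_truncation k : 0 <= k -> Wspace s p q (truncation k u).
Proof.
move=> k0; have [h1 h2 _ _] := uP; apply/(WspaceP s _ p0 q0); split.
- exact: Lfun_truncation.
- by apply: Lfun_truncation => //; rewrite divr_gt0 ?mulr_gt0// subr_gt0.
- exact: (finite_gagliardo_truncation k p0 mu_ fup).
- exact: (finite_gagliardo_truncation k q0 mu_ fuq).
Qed.

Let level k : R := fine (\int[mu]_x (`|truncation k u x| `^ P)%:E).

Let levelE k : 0 <= k ->
  (\int[mu]_x (`|truncation k u x| `^ P)%:E)%E = (level k)%:E.
Proof.
move=> k0; rewrite /level fineK// ge0_fin_numE; last first.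
  by apply: integral_ge0 => x _; rewrite lee_fin powR_ge0.
have mt := measurable_truncation k mu_.
exact: (LfunP_real P0 mt).1 (Lfun_truncation P0 k0 uLP).
Qed.

Let level_ge0 k : 0 <= level k.
Proof.
by rewrite fine_ge0// integral_ge0// => x _; rewrite lee_fin powR_ge0.
Qed.

(* Where [truncation k' u] is positive, [u <= k' / (k' - k) * (u - k)]: the
   critical power of [u] is absorbed by the previous level, whatever [u]. *)
Lemma level_step : exists C, 0 < C /\ forall k k', 1 <= k -> k < k' ->
  level k' `^ (p / P) <= C * (k' / (k' - k)) `^ (P - 1) * level k.
Proof.
have [C [C0 H]] := @sobolev R n s p n0 s0 p0 spn.
exists (C * (1 + lambda * G)); split.
  by rewrite mulr_gt0// ltr_wpDr// mulr_ge0// ltW.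
move=> k k' k1 kk; have k0 : 0 <= k by lra.
have k'0 : 0 <= k' by lra.
have mt := measurable_truncation k mu_.
have mt' := measurable_truncation k' mu_.
pose B := (k' / (k' - k)) `^ (P - 1).
have B0 : 0 <= B by rewrite powR_ge0.
pose h x := `|truncation k u x| `^ P.
have mh : measurable_fun setT h.
  by apply: measurable_fun_powR; exact: measurable_fun_normr.
have h0 x : 0 <= h x by rewrite powR_ge0.
have tp := finite_gagliardo_truncation k' p0 mu_ fup.
have hX : (\int[mu]_x (`|truncation k' u x| `^ P)%:E < +oo)%E.
  by rewrite levelE// ltry.
have := H _ mt' hX tp; rewrite -/(level k') => /le_trans; apply.
rewrite -!mulrA ler_wpM2l ?(ltW C0)//.
rewrite -lee_fin fineK; last first.
  rewrite ge0_fin_numE; first exact: tp.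
  by apply: integral_ge0 => z _; rewrite lee_fin gagliardo_density_ge0.
apply: le_trans (gagliardo_truncation_le_pq_energy k' p2 q2 mu_ fup fuq) _.
apply: (le_trans (lee_abs _)).
have := @weak_rhs_le (truncation k' u) h B (G * B) mt' mh h0 B0 (mulr_ge0 G0 B0).
rewrite levelE// -EFinM.
have -> : (B + lambda * (G * B)) * level k = (1 + lambda * G) * (B * level k) by ring.
apply; last exact: Wspace_truncation.
- apply: aeW => x; rewrite criticalE ger0_norm; first exact: trunc_interaction.
  by rewrite mulr_ge0 ?powR_ge0 ?truncation_ge0.
- apply: filterS gG => x gx; rewrite subcriticalE normrM -mulrA.
  apply: ler_pM => //; rewrite ger0_norm; last first.
    by rewrite mulr_ge0 ?powR_ge0 ?truncation_ge0.
  apply: le_trans (trunc_interaction x k1 kk).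
  have [ux|ux] := leP (u x) k'.
    have -> : truncation k' u x = 0 by rewrite /truncation max_r//; lra.
    by rewrite !mulr0.
  (* Here [1 <= k] matters: [u x > 1] where the truncation is positive, so the power [r - 1] of [u]
     is below the critical power [P - 1]. *)
  rewrite ler_wpM2r ?truncation_ge0// ler_powR//; last by have := rP; rewrite -/P; lra.
  by rewrite /funrpos le_max; apply/orP; left; lra.
Qed.

(** Scaling yields no smallness at the critical exponent. It comes from dominated convergence under
    [|u| ^ P], so [M] depends on [u] itself and not merely on its norm. *)
Lemma level_small (eta : R) : 0 < eta -> exists2 M, 1 <= M & level M <= eta.
Proof.
move=> eta0.
have mup : measurable_fun setT (fun x => (`|u x| `^ P)%:E).
  by apply/measurable_EFinP/measurable_fun_powR/measurable_fun_normr.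
have iu : mu.-integrable setT (fun x => (`|u x| `^ P)%:E).
  apply/integrableP; split => //.
  under eq_integral do rewrite /= ger0_norm ?powR_ge0//.
  exact: (LfunP_real P0 mu_).1 uLP.
have mtk (k : nat) : measurable_fun setT (fun x => (`|truncation k%:R u x| `^ P)%:E).
  apply/measurable_EFinP/measurable_fun_powR/measurable_fun_normr.
  exact: measurable_truncation.
have [|||||_ _] := @dominated_convergence _ _ _ mu setT measurableT
  (fun k x => (`|truncation k%:R u x| `^ P)%:E) (cst 0%E) (fun x => (`|u x| `^ P)%:E).
- exact: mtk.
- exact: measurable_cst.
- apply: aeW => x _; apply: cvg_near_cst.
  have [k hk] : exists k : nat, u x < k%:R.
    exists (Num.bound `|u x|).
    exact: le_lt_trans (ler_norm _) (archi_boundP (normr_ge0 _)).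
  exists k => // j /= kj.
  rewrite /truncation max_r; first by rewrite normr0 powR0// gt_eqF.
  have kjR : (k%:R : R) <= j%:R by rewrite ler_nat.
  by move: hk kjR; lra.
- exact: iu.
- apply: aeW => x k _; rewrite /= lee_fin ger0_norm ?powR_ge0//.
  rewrite ge0_ler_powR ?nnegrE ?(ltW P0)//.
  by rewrite ger0_norm ?truncation_ge0// truncation_le_norm.
rewrite integral_cst// mul0e => cv.
have : (fun k : nat => (level k%:R)%:E) @ \oo --> 0%E.
  by apply: cvg_trans cv; apply: near_eq_cvg; apply: nearW => k; rewrite /= levelE.
move/fine_cvgP => [_ /cvgrPdist_le /(_ _ eta0) [k _ hk]].
exists k.+1%:R; first by rewrite ler1n.
by have := hk k.+1 (leqnSn k); rewrite /= sub0r normrN ger0_norm.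
Qed.

Lemma weak_solution_bounded : exists2 M, 1 <= M & {ae mu, forall x, 0 <= u x <= M}.
Proof.
have [C [C0 step]] := level_step.
have P1 : 0 < P - 1 by have := pP; have := p2; lra.
have b1 : 1 < 2 `^ (P - 1) :> R.
  have e : 1 `^ (P - 1) = 1 :> R by rewrite powR1.
  by rewrite -[ltLHS]e gt0_ltr_powR ?nnegrE//; lra.
have g1 : 1 < P / p by rewrite ltr_pdivlMr// mul1r.
(* For the levels [k j] below, [k j.+1 / (k j.+1 - k j)] is at most [4 * 2 ^+ j]; its power [P - 1]
   gives the constant [C * 4 ^ (P - 1)] and the ratio [2 ^ (P - 1)] of the iteration. *)
have D0 : 0 < C * 4 `^ (P - 1) by rewrite mulr_gt0// powR_gt0.
have [eta [rho [eta0 /andP[r0 r1] dg]]] := de_giorgi_iteration D0 b1 g1.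
have [M M1 hM] := level_small eta0.
have M0 : 0 < M by exact: lt_le_trans ltr01 M1.
have M2 : 0 <= 2 * M by rewrite mulr_ge0// ltW.
have M3 : 1 <= 2 * M by rewrite mulr_natl mulr2n (le_trans M1)// lerDl ltW.
pose k (j : nat) := M * (2 - 2^-1 ^+ j).
have h2 (j : nat) : 0 < (2^-1 : R) ^+ j <= 1.
  by rewrite exprn_gt0//= exprn_ile1// invf_le1// ler1n.
have k1 j : 1 <= k j.
  by have /andP[h3 h4] := h2 j; rewrite /k; nra.
have k2 j : k j <= 2 * M.
  by have /andP[h3 h4] := h2 j; rewrite /k; nra.
have kS j : k j.+1 - k j = M * 2^-1 ^+ j.+1 by rewrite /k !exprS; field.
have kk j : k j < k j.+1.
  by rewrite -subr_gt0 kS mulr_gt0 ?exprn_gt0//; lra.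
have lev j : level (k j) <= eta * rho ^+ j.
  apply: (dg (fun j => level (k j))).
  - by move=> i; exact: level_ge0.
  - move=> i; have st := step (k i) (k i.+1) (k1 i) (kk i).
    have -> : level (k i.+1) = (level (k i.+1) `^ (p / P)) `^ (P / p).
      rewrite -powRrM (_ : p / P * (P / p) = 1) ?powRr1 ?level_ge0//.
      by field; rewrite !gt_eqF.
    apply: ge0_ler_powR; rewrite ?nnegrE ?powR_ge0//.
    + by rewrite ltW// divr_gt0.
    + apply: mulr_ge0; last exact: level_ge0.
      by rewrite (mulr_ge0 (ltW D0))// exprn_ge0 ?powR_ge0.
    apply: (le_trans st); rewrite ler_wpM2r ?level_ge0//.
    rewrite -[leRHS]mulrA ler_wpM2l ?(ltW C0)// -powR_exprn// -powRM ?exprn_ge0//.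
    apply: ge0_ler_powR; rewrite ?nnegrE ?(ltW P1)//.
    + by rewrite divr_ge0// ?subr_ge0 ?(ltW (kk i))// (le_trans _ (k1 i.+1)).
    rewrite kS ler_pdivrMr; last by rewrite mulr_gt0//; have /andP[] := h2 i.+1.
    have -> : 4 * 2 ^+ i * (M * 2^-1 ^+ i.+1) = 2 * M.
      rewrite exprS exprVn; field; by rewrite expf_neq0.
    exact: k2.
  - by rewrite /k expr0 (_ : M * (2 - 1) = M)//; ring.
have mt := measurable_truncation (2 * M) mu_.
have lev0 : level (2 * M) = 0.
  apply/eqP; rewrite eq_le level_ge0 andbT.
  have le j : level (2 * M) <= eta * rho ^+ j.
    apply: le_trans (lev j).
    have kj0 : 0 <= k j by exact: le_trans ler01 (k1 j).
    rewrite -lee_fin -[X in (X <= _)%E](levelE M2) -[X in (_ <= X)%E](levelE kj0).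
    apply: ge0_le_integral.
    - exact: measurableT.
    - by move=> x _; rewrite lee_fin powR_ge0.
    - by apply/measurable_EFinP/measurable_fun_powR/measurable_fun_normr.
    - apply/measurable_EFinP/measurable_fun_powR/measurable_fun_normr.
      exact: measurable_truncation.
    move=> x _; rewrite lee_fin ge0_ler_powR ?nnegrE ?(ltW P0)//.
    rewrite !ger0_norm ?truncation_ge0// /truncation ge_max !le_max lexx !orbT andbT.
    by rewrite lerB.
  have cv : (fun j => geometric eta rho j) @ \oo --> (0 : R).
    by apply: cvg_geometric; rewrite gtr0_norm.
  rewrite -(cvg_lim _ cv)//; apply: limr_ge; first exact: cvgP cv.
  by apply: nearW => j; exact: le.
exists (2 * M); first exact: M3.
have : {ae mu, forall x, `|truncation (2 * M) u x| `^ P = 0}.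
  apply: ge0_integral_eq0_ae.
  - by apply: measurable_fun_powR; exact: measurable_fun_normr.
  - by move=> x; rewrite powR_ge0.
  - by rewrite levelE// lev0.
have tr0 x : `|truncation (2 * M) u x| `^ P = 0 -> u x <= 2 * M.
  move=> /powR_eq0_eq0 /normr0_eq0; rewrite /truncation => h.
  by rewrite -subr_le0 -h le_max lexx.
have [_ u0 _] := uW; move: u0; apply: filterS2 => x ux /tr0 ->.
by rewrite ux.
Qed.

(** Once [0 <= u <= M], both nonlinear terms are bounded sources, of size [M ^ (P - 1)] and
    [G * M ^ (r - 1)]. *)
Lemma weak_solution_bounded_energy (M : R) : 1 <= M ->
  {ae mu, forall x, 0 <= u x <= M} ->
  bounded_energy s p q (M `^ (P - 1) + lambda * (G * M `^ (r - 1))) u.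
Proof.
move=> M1 uM; split=> // phi W phi0.
have [hp _ _ _] := (WspaceP s phi p0 q0).1 W.
have mphi := Lfun_measurable hp.
have up (e : R) x : 0 <= e -> 0 <= u x <= M -> u^\+ x `^ e <= M `^ e.
  move=> e0 /andP[u0 u1]; rewrite /funrpos max_l//.
  by rewrite ge0_ler_powR ?nnegrE//; lra.
apply: (weak_rhs_le mphi mphi phi0) => //.
- exact: powR_ge0.
- by rewrite mulr_ge0 ?powR_ge0.
- apply: filterS uM => x ux; rewrite criticalE normrM (ger0_norm (phi0 x)).
  rewrite ler_wpM2r// ger0_norm ?powR_ge0//; apply: up => //.
  by have := pP; have := p2; lra.
- move: uM gG; apply: filterS2 => x ux gx; rewrite subcriticalE !normrM.
  rewrite (ger0_norm (phi0 x)) mulrA ler_wpM2r//.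
  rewrite (ger0_norm (powR_ge0 _ _)); apply: ler_pM; rewrite ?powR_ge0//.
  by apply: up => //; have := pr; have := p2; lra.
Qed.

End weak_solutions.

Theorem theorem1p3 (R : realType) (N : nat) (s p q r lambda : R)
    (g u : 'rV[R]_N -> R) :
  (1 <= N)%N -> 0 < s < 1 ->
  2 < q -> q <= p -> p < r -> r < sobolev_exponent N s p ->
  s * p < N%:R ->
  0 < lambda ->
  g \in Lfun (lebesgue_measure_rV R N) +oo%E ->
  (lebesgue_measure_rV R N).-integrable setT (EFin \o g) ->
  g \in Lfun (lebesgue_measure_rV R N)
    (sobolev_exponent N s p / (sobolev_exponent N s p - r))%:E ->
  weak_solution s p q r lambda g u ->
  u \in Lfun (lebesgue_measure_rV R N) +oo%E /\
  exists alpha : R, 0 < alpha < 1 /\ hoelder_loc alpha u.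
Proof.
move=> n0 s01 q2 qp pr rP spn lambda0 gLoo _ _ uW.
have mg := Lfun_measurable gLoo.
have [G G0 gG] := Lfun_infty_bounded gLoo.
have [M M1 uM] := weak_solution_bounded n0 s01 q2 qp pr rP spn lambda0 mg G0 gG uW.
have p2 : 2 < p by exact: lt_le_trans qp.
have [s0 _] := andP s01.
have sqn : s * q < N%:R.
  by apply: le_lt_trans spn; rewrite ler_wpM2l// ltW.
have M0 : 0 <= M by exact: le_trans ler01 M1.
have uE := weak_solution_bounded_energy q2 qp pr rP lambda0 mg G0 gG uW M1 uM.
have [mu_ _ _ _] := uE.
split.
  apply: (Lfun_infty_of_bounded mu_ (M := M)).
  by apply: filterS uM => x /andP[u0 u1]; rewrite ger0_norm.
have K0 : 0 <= M `^ (sobolev_exponent N s p - 1) + lambda * (G * M `^ (r - 1)).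
  by rewrite addr_ge0 ?powR_ge0// mulr_ge0 ?(ltW lambda0)// mulr_ge0 ?powR_ge0.
have [theta [alpha [omega0 [t01 a01 o0 osc]]]] :=
  oscillation_decay n0 s01 p2 q2 spn sqn K0 M0 uE uM.
exists alpha; split => //.
exact: (hoelder_representative t01 a01 o0 M0 uM osc).
Qed.
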